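(* Let $s\ge -1$ and let $(a_n)_{n=0}^\infty\subset S^1$ be a greedy $s$-energy sequence on the unit circle, with associated normalized energies $(T_{N,s})_{N\ge2}$. Then $$\lim_{N\to\infty}\bigl(T_{2N,s}-T_{N,s}\bigr)=0.$$
   Context: $S^1=\{z\in\mathbb{C}:|z|=1\}$. For $s\in\mathbb{R}$ the Riesz kernel is $k_s(z,w)=|z-w|^{-s}$ if $s\ne 0$ and $k_0(z,w)=-\log|z-w|$ (with value $+\infty$ at $z=w$ when $s\ge 0$). For points $z_1,\dots,z_N$, $N\geq 2$, the energy is $E_s((z_1,\dots,z_N))=\sum_{1\le i\ne j\le N}k_s(z_i,z_j)$. A greedy $s$-energy sequence is a sequence $(a_n)_{n=0}^\infty\subset S^1$ with $a_0\in S^1$ arbitrary and, for all $N\ge 1$, $E_s((a_0,\dots,a_{N-1},a_N))=\min_{z\in S^1}E_s((a_0,\dots,a_{N-1},z))$ if $s\ge 0$; if $s<0$ the minimum is replaced by the maximum. Write $\alpha_{N,s}=(a_0,\dots,a_{N-1})$. For $-2<s<1$, $s\ne0$, let $I_s(\sigma)=\frac{2^{-s}}{\sqrt\pi}\frac{\Gamma((1-s)/2)}{\Gamma(1-s/2)}$, which is the $s$-energy $\iint|x-y|^{-s}d\sigma(x)d\sigma(y)$ of the normalized arclength measure $\sigma$ on $S^1$. For $N\ge2$ define $$T_{N,s}=\begin{cases}\dfrac{E_{-1}(\alpha_{N,-1})-N^2I_{-1}(\sigma)}{\log N}, & s=-1,\\[2mm] \dfrac{E_0(\alpha_{N,0})+N\log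 N}{N}, & s=0,\\[2mm] \dfrac{E_s(\alpha_{N,s})-N^2I_s(\sigma)}{N^{1+s}}, & -1<s<1,\ s\ne0,\\[2mm] \dfrac{E_1(\alpha_{N,1})-\pi^{-1}N^2\log N}{N^2}, & s=1,\\[2mm] \dfrac{E_s(\alpha_{N,s})}{N^{1+s}}, & s>1.\end{cases}$$ *)

(* Defs.v *)
From mathcomp Require Import all_boot all_order all_algebra.
From mathcomp Require Import complex.
From mathcomp Require Import all_classical all_reals all_analysis.
Set Implicit Arguments.
Unset Strict Implicit.
Unset Printing Implicit Defensive.
Import Order.TTheory GRing.Theory Num.Theory.
Import numFieldNormedType.Exports.
Local Open Scope classical_set_scope.
Local Open Scope ring_scope.

Definition unit_circle (R : realType) : set R[i] :=
  [set z | ComplexField.Normc.normc z = 1].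

(* The value at z = w is imposed explicitly when 0 <= s, because the library
   sets 0 `^ (- s) = 0 for s > 0 and ln 0 = 0. *)
Definition riesz_kernel (R : realType) (s : R) (z w : R[i]) : \bar R :=
  let r := ComplexField.Normc.normc (z - w) in
  if (0 <= s) && (z == w) then +oo%E
  else if s == 0 then (- ln r)%:E
  else (r `^ (- s))%:E.

Definition riesz_energy (R : realType) (s : R) (N : nat)
    (z : N.-tuple R[i]) : \bar R :=
  (\sum_(i < N) \sum_(j < N | j != i)
     riesz_kernel s (tnth z i) (tnth z j))%E.

Definition greedy_section (R : realType) (a : nat -> R[i]) (N : nat) :
  N.-tuple R[i] := [tuple a i | i < N].

Definition greedy_energy_sequence (R : realType) (s : R)
    (a : nat -> R[i]) : Prop :=
  (forall n, unit_circle (a n)) /\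
  forall N : nat, (1 <= N)%N -> forall z : R[i], unit_circle z ->
    let alpha := greedy_section a N in
    if 0 <= s then
      (riesz_energy s [tuple of rcons alpha (a N)]
       <= riesz_energy s [tuple of rcons alpha z])%E
    else
      (riesz_energy s [tuple of rcons alpha z]
       <= riesz_energy s [tuple of rcons alpha (a N)])%E.

(* Euler's integral; it represents the Gamma function only for x > 0. *)
Definition Gamma (R : realType) (x : R) : R :=
  \int[@lebesgue_measure R]_(t in `]0, +oo[) (t `^ (x - 1) * expR (- t)).

Definition circle_energy (R : realType) (s : R) : R :=
  2 `^ (- s) / Num.sqrt pi * (Gamma ((1 - s) / 2) / Gamma (1 - s / 2)).

(* For s < -1 no normalization is intended; such s fall into the s < 1 case. *)
Definition normalized_energy (R : realType) (s : R) (a : nat -> R[i])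
    (N : nat) : \bar R :=
  let E := riesz_energy s (greedy_section a N) in
  let n : R := N%:R in
  if s == -1 then
    ((E - (n ^+ 2 * circle_energy (- 1 : R))%R%:E) / (ln n)%:E)%E
  else if s == 0 then ((E + (n * ln n)%R%:E) / n%:E)%E
  else if s < 1 then
    ((E - (n ^+ 2 * circle_energy s)%R%:E) / (n `^ (1 + s))%R%:E)%E
  else if s == 1 then
    ((E - (pi^-1 * n ^+ 2 * ln n)%R%:E) / (n ^+ 2)%R%:E)%E
  else (E / (n `^ (1 + s))%R%:E)%E.

(* Main.v *)
Require Import Defs.
From mathcomp Require Import all_boot all_order all_algebra.
From mathcomp Require Import complex.
From mathcomp Require Import all_classical all_reals all_analysis.
From mathcomp Require Import ring lra zify.
Set Implicit Arguments.
Unset Strict Implicit.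
Unset Printing Implicit Defensive.
Import Order.TTheory GRing.Theory Num.Theory.
Import numFieldNormedType.Exports.
Local Open Scope classical_set_scope.
Local Open Scope ring_scope.

(** The proof rests on the rigidity of greedy configurations. Let [P k] be the
    energy per point of the group of [2 ^ k]-th roots of unity. If a greedy
    configuration is a coset of that group, the next point must be a midpoint,
    because the kernel, negated when [s < 0], is strictly convex along the
    circle; and as long as a shorter greedy configuration fits inside the coset of midpoints, a minimizer
    of the total potential minimizes both partial potentials at once. By
    induction the potential at the [n]-th greedy point is the sum of
    [P (k + 1) - P k] over the binary digits [k] of [n] ([greedy_structure],
    [greedy_potential]), so the energy of [N] points is a functional
    [binary_energy P N] that no longer depends on the sequence
    ([greedy_energyE]).

    This functional is linear in [P]; it sends the constant sequence [c] to
    [N c] and the sequence [2 ^ k] to [N ^ 2]; and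
    [binary_energy P (2 N) = 2 binary_energy (P shifted) N], since doubling
    shifts digits. The normalizing terms of the energy can therefore be moved
    into the sequence: for [-1 < s < 1] and [s <> 0] the normalized energy is
    [binary_energy w N / N ^ (1 + s)] with [w k = P k - I 2 ^ k], where [I] is
    the energy of the uniform measure, and the difference to be studied is
    [binary_energy d N / N ^ (1 + s)] with [d k = 2 ^ (- s) w (k + 1) - w k].
    Since [binary_energy d N] is at most a constant times the sum of
    [2 ^ k |d k|] over the digits of [N], it suffices that
    [d k = o (2 ^ (k s))], which holds as soon as [w k 2 ^ (- k s)] has a limit,
    whatever its value. For [s > 1] the same argument applies with [w = P], and
    for [s = -1] it applies with the denominator [ln N].

    That limit comes from the trapezoidal defects of the powers of the sine:
    up to terms at the singularity, [P (k + 1) - 2 P k] is a sum of defects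
    which, multiplied by [2 ^ (- k s)], converge one by one, with a uniformly
    small tail because the derivative is monotone ([is_cvg_sin_power_step], with a
    closed form at [s = -1]); the recursion then yields the asymptotics of [P]
    itself ([is_cvg_of_step]). For [s < 1] this requires that [I] be exactly the
    limit of [P k / 2 ^ k]. The limits of the means of [sin ^ p] satisfy the
    same recursion [p -> p + 2] as a quotient of two Gamma values, and both families are monotone enough for the recursion to have only
    one solution ([sine_moment_Gamma]). For [s = 0] the product formula for the
    sine makes the difference vanish identically, and for [s = 1] the only
    constant needed is the growth rate of the harmonic sums ([cvg_step1]). *)

(** * Binary digits and the energy functional *)

Definition bit (n k : nat) : bool := odd (n %/ 2 ^ k).

(** The range [k < n] contains every nonzero digit because [n < 2 ^ n]. *)
Definition bit_sum {R : realType} (u : nat -> R) (n : nat) : R :=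
  \sum_(k < n) (bit n k)%:R * u k.

Lemma bit_small (n k : nat) : (n < 2 ^ k)%N -> bit n k = false.
Proof. by move=> h; rewrite /bit divn_small. Qed.

Lemma bit_sum_widen {R : realType} (u : nat -> R) (n K : nat) :
  (n < 2 ^ K)%N -> bit_sum u n = \sum_(k < K) (bit n k)%:R * u k.
Proof.
have aux m K1 : (n < 2 ^ m)%N -> (m <= K1)%N ->
  \sum_(k < K1) (bit n k)%:R * u k = \sum_(k < m) (bit n k)%:R * u k.
  move=> h1 h2; rewrite -!(big_mkord xpredT (fun k => (bit n k)%:R * u k)).
  rewrite (big_cat_nat (n := m)) //= [X in _ + X]big1_seq ?addr0 // => k.
  rewrite mem_index_iota => /andP[_ /andP[mk _]].
  rewrite bit_small ?mul0r// (leq_trans h1)// leq_exp2l//.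
move=> nK; have n2 : (n < 2 ^ n)%N by apply: ltn_expl.
rewrite /bit_sum -(aux n (maxn n K)) ?leq_maxl//.
by rewrite -(aux K (maxn n K)) ?leq_maxr.
Qed.

Lemma bit_double0 (n : nat) (b : bool) : bit (n.*2 + b) 0 = b.
Proof. by rewrite /bit expn0 divn1 oddD odd_double /=; case: b. Qed.

Lemma bit_doubleS (n : nat) (b : bool) (k : nat) :
  bit (n.*2 + b) k.+1 = bit n k.
Proof.
rewrite /bit expnS divnMA divn2; congr (odd (_ %/ _)).
by rewrite addnC half_bit_double.
Qed.

Lemma bit_sum_double {R : realType} (u : nat -> R) (n : nat) (b : bool) :
  bit_sum u (n.*2 + b) = b%:R * u 0%N + bit_sum (u \o S) n.
Proof.
have h : (n.*2 + b < 2 ^ n.+1)%N.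
  have := ltn_expl n (isT : (1 < 2)%N); rewrite expnS; lia.
rewrite (bit_sum_widen _ h) big_ord_recl bit_double0; congr (_ + _).
by apply: eq_bigr => k _; rewrite bit_doubleS.
Qed.

Lemma bit_sum0 {R : realType} (u : nat -> R) : bit_sum u 0 = 0.
Proof. by rewrite /bit_sum big_ord0. Qed.

Lemma bit_sum_top {R : realType} (u : nat -> R) (k m : nat) :
  (m < 2 ^ k)%N -> bit_sum u (2 ^ k + m) = u k + bit_sum u m.
Proof.
move=> mk; have k2 : (0 < 2 ^ k)%N by rewrite expn_gt0.
rewrite (@bit_sum_widen _ u (2 ^ k + m) k.+1); last by rewrite expnS; lia.
rewrite big_ord_recr /= (@bit_sum_widen _ u m k)// addrC; congr (_ + _).
  by rewrite /bit divnDl// divnn k2 divn_small//= mul1r.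
apply: eq_bigr => i _; congr ((_ : bool)%:R * _).
rewrite /bit divnDl ?dvdn_exp2l ?(ltnW (ltn_ord i))//.
rewrite -{1}(subnK (ltnW (ltn_ord i))) expnD mulnK ?expn_gt0//.
by rewrite oddD oddX /= orbF subn_eq0 leqNgt ltn_ord.
Qed.

(** When [P k] is the energy per point of the [2 ^ k]-th roots of unity, this is
    the energy of [N] greedy points. The last term vanishes then; it is there for
    the formula to stay covariant when a multiple of [2 ^ k] is subtracted from
    [P]. *)
Definition binary_energy {R : realType} (P : nat -> R) (N : nat) : R :=
  2 * (\sum_(n < N) bit_sum (fun k => P k.+1 - P k) n) + N%:R * P 0%N.

Section BinaryEnergy.
Context {R : realType}.
Implicit Types (P Q : nat -> R) (N L : nat).

Lemma binary_energyS P N : binary_energy P N.+1 =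
  binary_energy P N + 2 * bit_sum (fun k => P k.+1 - P k) N + P 0%N.
Proof. by rewrite /binary_energy big_ord_recr /= -natr1; ring. Qed.

Lemma binary_energy0 P : binary_energy P 0 = 0.
Proof. by rewrite /binary_energy big_ord0 mulr0 mul0r addr0. Qed.

Lemma binary_energy_lin (a b : R) P Q N :
  binary_energy (fun k => a * P k + b * Q k) N =
  a * binary_energy P N + b * binary_energy Q N.
Proof.
elim: N => [|N IH]; first by rewrite !binary_energy0; ring.
rewrite !binary_energyS IH.
suff -> : bit_sum (fun k => (a * P k.+1 + b * Q k.+1) - (a * P k + b * Q k)) N =
  a * bit_sum (fun k => P k.+1 - P k) N + b * bit_sum (fun k => Q k.+1 - Q k) N.
  by ring.
rewrite /bit_sum !mulr_sumr -big_split /=; apply: eq_bigr => k _; ring.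
Qed.

Lemma bit_sum_shift P n :
  bit_sum ((fun k => P k.+1 - P k) \o S) n =
  bit_sum (fun k => (P \o S) k.+1 - (P \o S) k) n.
Proof. by []. Qed.

(** The digits of [2 n] and [2 n + 1] are those of [n], shifted, followed by a
    last digit whose contribution [P 1 - P 0] moves the term in [P 0] to [P 1]. *)
Lemma binary_energy_double P N :
  binary_energy P N.*2 = 2 * binary_energy (P \o S) N.
Proof.
elim: N => [|N IH]; first by rewrite !binary_energy0 mulr0.
rewrite doubleS !binary_energyS IH.
have -> : N.*2.+1 = (N.*2 + true)%N by rewrite addn1.
have e : N.*2 = (N.*2 + false)%N by rewrite addn0.
rewrite [in bit_sum _ N.*2]e !bit_sum_double bit_sum_shift /=; ring.
Qed.

Lemma binary_energy_cst (c : R) N : binary_energy (fun=> c) N = N%:R * c.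
Proof.
elim: N => [|N IH]; first by rewrite binary_energy0 mul0r.
rewrite binary_energyS IH /bit_sum big1; first by rewrite -natr1; ring.
by move=> k _; rewrite subrr mulr0.
Qed.

Lemma bit_sum_expn n : bit_sum (fun k => 2 ^+ k.+1 - 2 ^+ k) n = n%:R :> R.
Proof.
elim/ltn_ind: n => -[|n] IH; first exact: bit_sum0.
have e : n.+1 = ((n.+1)./2.*2 + odd n.+1)%N by rewrite addnC odd_double_half.
have h : (n.+1./2 < n.+1)%N by rewrite ltn_half_double -addnn; lia.
rewrite {1}e bit_sum_double.
have -> : bit_sum ((fun k => 2 ^+ k.+1 - 2 ^+ k) \o S) (n.+1)./2 =
  2 * bit_sum (fun k => 2 ^+ k.+1 - 2 ^+ k) (n.+1)./2 :> R.
  rewrite /bit_sum mulr_sumr; apply: eq_bigr => k _ /=.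
  by rewrite !exprS; ring.
rewrite IH// [in RHS]e natrD -muln2 natrM expr1 expr0; ring.
Qed.

Lemma binary_energy_expn N : binary_energy (fun k => 2 ^+ k) N = N%:R ^+ 2 :> R.
Proof.
elim: N => [|N IH]; first by rewrite binary_energy0 expr0n.
by rewrite binary_energyS IH bit_sum_expn -natr1; ring.
Qed.

Lemma bit_sum_le P n L : (n < 2 ^ L)%N ->
  `|bit_sum (fun k => P k.+1 - P k) n| <= 2 * \sum_(k < L.+1) `|P k|.
Proof.
move=> nL; rewrite (bit_sum_widen _ nL).
apply: le_trans (ler_norm_sum _ _ _) _.
apply: (@le_trans _ _ (\sum_(k < L) (`|P k.+1| + `|P k|))).
  apply: ler_sum => k _; rewrite normrM.
  apply: (@le_trans _ _ `|P k.+1 - P k|); last exact: ler_normB.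
  by case: (bit n k); rewrite ?normr1 ?normr0 ?mul1r ?mul0r.
rewrite big_split /= mulr_natl mulr2n; apply: lerD.
  by rewrite [X in _ <= X]big_ord_recl /= lerDr.
by rewrite [X in _ <= X]big_ord_recr /= lerDl.
Qed.

(** In contrast with the terms of its definition, which bring in [N] for every
    digit, the functional weighs [P k] by [O (2 ^ k)] only: by doubling, induction
    on the number of digits applies. The slack [- 4] pays for the last point of an
    odd configuration at each step. *)
Lemma binary_energy_le P N L : (N < 2 ^ L)%N ->
  `|binary_energy P N| <= \sum_(k < L.+1) (5 * 2 ^+ k - 4) * `|P k|.
Proof.
elim: L P N => [|L IH] P N NL.
  have -> : N = 0%N by move: NL; rewrite expn0; lia.
  rewrite binary_energy0 normr0 big_ord_recl big_ord0 addr0 expr0.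
  by rewrite mulr_ge0//; lra.
have e : N = ((N)./2.*2 + odd N)%N by rewrite addnC odd_double_half.
have hN : (N./2 < 2 ^ L)%N by move: NL; rewrite expnS; lia.
have key : `|binary_energy P N| <= 2 * `|binary_energy (P \o S) N./2| +
    2 * `|bit_sum (fun k => (P \o S) k.+1 - (P \o S) k) N./2| + `|P 0%N|.
  rewrite {1}e; case: (odd N); last first.
    rewrite addn0 binary_energy_double normrM ger0_norm// -addrA lerDl.
    by rewrite addr_ge0// mulr_ge0.
  rewrite addn1 binary_energyS binary_energy_double.
  have -> : N./2.*2 = (N./2.*2 + false)%N by rewrite addn0.
  rewrite bit_sum_double mul0r add0r bit_sum_shift.
  apply: le_trans (ler_normD _ _) _; rewrite lerD2r.
  apply: le_trans (ler_normD _ _) _.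
  by rewrite !normrM (ger0_norm (ler0n R 2)).
apply: le_trans key _.
rewrite big_ord_recl expr0 mulr1 addrC lerD//; first by rewrite ler_peMl//; lra.
have h1 := IH (P \o S) _ hN.
have h2 := bit_sum_le (P \o S) hN.
apply: (@le_trans _ _ (2 * (\sum_(k < L.+1) (5 * 2 ^+ k - 4) * `|(P \o S) k|) +
  4 * \sum_(k < L.+1) `|(P \o S) k|)); first by lra.
rewrite !mulr_sumr -big_split /= ler_sum// => k _.
rewrite /bump /= exprS; have := normr_ge0 (P k.+1); rewrite add1n; nra.
Qed.

End BinaryEnergy.

(** * Limits of real sequences *)

Section Sequences.
Context {R : realType}.
Implicit Types (u e b : nat -> R).

Lemma cvg_to0_near u : (forall eps, 0 < eps -> \forall k \near \oo, `|u k| <= eps) ->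
  u @ \oo --> (0 : R).
Proof.
move=> h; apply/cvgrPdist_le => eps /h; apply: filterS => k.
by rewrite sub0r normrN.
Qed.

Lemma near_le_of_cvg0 u eps : u @ \oo --> (0 : R) -> 0 < eps ->
  \forall k \near \oo, `|u k| <= eps.
Proof.
move=> /cvgrPdist_le h e0; move: (h _ e0); apply: filterS => k.
by rewrite sub0r normrN.
Qed.

(** All but finitely many terms have a factor [`|e k|] below any threshold, and
    the exceptional ones are absorbed by [phi]. *)
Lemma weighted_sum_small e (rho A : R) (phi : nat -> R) (L : nat -> nat) :
  0 < rho -> 0 < A -> e @ \oo --> (0 : R) -> phi @ \oo --> +oo ->
  (\forall N \near \oo, \sum_(k < L N) rho ^+ k <= A * phi N) ->
  (fun N => (\sum_(k < L N) `|e k| * rho ^+ k) / phi N) @ \oo --> (0 : R).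
Proof.
move=> rho0 A0 e0 phioo hA; apply: cvg_to0_near => eps eps0.
(* Half of eps is spent on the terms with a small factor, half on the others. *)
pose d := eps / (2 * A).
have d0 : 0 < d by rewrite divr_gt0// mulr_gt0.
have [K _ hK] := near_le_of_cvg0 e0 d0.
pose C := \sum_(k < K) `|e k| * rho ^+ k.
have C0 : 0 <= C by apply: sumr_ge0 => k _; rewrite mulr_ge0// exprn_ge0// ltW.
have hphi : \forall N \near \oo, 2 * C / eps + 1 <= phi N.
  by move/cvgryPge : phioo; exact.
near=> N.
have phiN : 2 * C / eps + 1 <= phi N by near: N.
have phi0 : 0 < phi N.
  by apply: lt_le_trans phiN; rewrite ltr_wpDl// divr_ge0 ?mulr_ge0// ltW.
have main : \sum_(k < L N) `|e k| * rho ^+ k <= C + d * (A * phi N).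
  apply: (@le_trans _ _ (C + d * \sum_(k < L N) rho ^+ k)); last first.
    by rewrite lerD2l ler_wpM2l ?(ltW d0)//; near: N.
  rewrite /C -!(big_mkord xpredT (fun k => `|e k| * rho ^+ k)).
  rewrite -(big_mkord xpredT (fun k => rho ^+ k)) mulr_sumr.
  have [LK|KL] := leqP (L N) K.
    apply: ler_wpDr; first by apply: sumr_ge0 => k _; rewrite mulr_ge0 ?exprn_ge0// ltW.
    rewrite (big_cat_nat (n := L N) (p := K))//= lerDl.
    by apply: sumr_ge0 => k _; rewrite mulr_ge0// exprn_ge0// ltW.
  rewrite (big_cat_nat (n := K) (p := L N)) ?(ltnW KL)//= lerD2l.
  rewrite [X in _ <= X](big_cat_nat (n := K)) ?(ltnW KL)//=.
  apply: ler_wpDl; first by apply: sumr_ge0 => k _; rewrite mulr_ge0 ?exprn_ge0// ltW.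
  rewrite big_nat_cond [X in _ <= X]big_nat_cond ler_sum// => k.
  rewrite andbT => /andP[Kk _].
  by rewrite ler_wpM2r ?exprn_ge0 ?(ltW rho0)//; apply: hK.
rewrite normrM (ger0_norm (x := \sum_(k < _) _)); last first.
  by apply: sumr_ge0 => k _; rewrite mulr_ge0 ?exprn_ge0// ltW.
rewrite normfV gtr0_norm// ler_pdivrMr//; apply: le_trans main _.
have -> : d * (A * phi N) = eps / 2 * phi N by rewrite /d; field; rewrite gt_eqF.
have : 2 * C <= eps * phi N.
  by rewrite -ler_pdivrMl// mulrC; apply: le_trans phiN; rewrite lerDl.
lra.
Unshelve. all: by end_near. Qed.

(** A linear recursion with ratio less than one forgets its initial value. *)
Lemma cvg_contraction u e (q : R) : `|q| < 1 ->
  (forall k, u k.+1 = q * u k + e k) -> e @ \oo --> (0 : R) ->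
  u @ \oo --> (0 : R).
Proof.
move=> q1 hu he; apply: cvg_to0_near => eps eps0.
have q0 : 0 < 1 - `|q| by rewrite subr_gt0.
have d0 : 0 < eps / 2 * (1 - `|q|) by rewrite mulr_gt0// divr_gt0.
have [K _ hK] := near_le_of_cvg0 he d0.
have bnd n : `|u (n + K)%N| <= `|q| ^+ n * `|u K| + eps / 2.
  elim: n => [|n IH]; first by rewrite expr0 mul1r add0n lerDl divr_ge0// ltW.
  rewrite addSn hu; apply: le_trans (ler_normD _ _) _.
  have h1 := hK (n + K)%N (leq_addl _ _).
  apply: le_trans (lerD (lexx _) h1) _.
  rewrite normrM exprS.
  have := ler_wpM2l (normr_ge0 q) IH; lra.
have hg := @near_le_of_cvg0 _ (eps / 2) (cvg_geometric `|u K| (z := `|q|) _).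
have {hg} [|//|M _ hM] := hg; rewrite ?normr_id ?divr_gt0//.
exists (M + K)%N => // k /= hk.
have hk2 : (K <= k)%N by lia.
rewrite -(subnK hk2); apply: le_trans (bnd _) _.
have := hM (k - K)%N; rewrite /geometric /= normrM normr_id normrX normr_id.
have -> : (M <= k - K)%N by lia.
by rewrite mulrC => /(_ isT); lra.
Qed.

(** With a ratio [q > 1], a term exceeding the fixed level of the recursion would
    force growth at the rate [q ^ k], which the last hypothesis excludes. *)
Lemma cvg_expansion u e (q : R) : 1 < q ->
  (forall k, u k.+1 = q * u k + e k) -> e @ \oo --> (0 : R) ->
  (fun k => u k / q ^+ k) @ \oo --> (0 : R) ->
  u @ \oo --> (0 : R).
Proof.
move=> q1 hu he hq; apply: cvg_to0_near => eps eps0.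
have q0 : 0 < q - 1 by rewrite subr_gt0.
have qp : 0 < q by lra.
have d0 : 0 < eps * (q - 1) by rewrite mulr_gt0.
have [K _ hK] := near_le_of_cvg0 he d0.
exists K => // k /= Kk; rewrite leNgt; apply/negP => lt.
pose t := `|u k| - eps.
have t0 : 0 < t by rewrite subr_gt0.
have bnd n : q ^+ n * t <= `|u (n + k)%N| - eps.
  elim: n => [|n IH]; first by rewrite expr0 mul1r.
  rewrite addSn hu exprS.
  have h1 : `|e (n + k)%N| <= eps * (q - 1) by apply: hK => /=; lia.
  have h2 : `|q * u (n + k)%N| - `|e (n + k)%N| <= `|q * u (n + k)%N + e (n + k)%N|.
    by have := lerB_normD (q * u (n + k)%N) (e (n + k)%N).
  have h3 : `|q * u (n + k)%N| = q * `|u (n + k)%N| by rewrite normrM gtr0_norm.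
  have h4 := ler_wpM2l (ltW qp) IH; lra.
have d1 : 0 < t / q ^+ k / 2 by rewrite divr_gt0// divr_gt0// exprn_gt0.
have [M _ hM] := near_le_of_cvg0 hq d1.
have := hM (M + k)%N (leq_addr _ _); rewrite normrM normfV normrX (gtr0_norm qp).
rewrite ler_pdivrMr ?exprn_gt0// exprD.
have -> : t / q ^+ k / 2 * (q ^+ M * q ^+ k) = q ^+ M * t / 2.
  by field; rewrite expf_neq0// gt_eqF.
have := bnd M; have : 0 < q ^+ M * t by rewrite mulr_gt0// exprn_gt0.
lra.
Qed.

Lemma cvg_by_approximation u :
  (forall eps, 0 < eps -> exists2 b, cvg (b @ \oo) &
     \forall k \near \oo, `|u k - b k| <= eps) -> cvg (u @ \oo).
Proof.
move=> h; apply: cauchy_cvg; apply: cauchy_exP => eps eps0.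
have e3 : 0 < eps / 3 by rewrite divr_gt0.
have [b /cvg_ex[/= l bl] hb] := h _ e3.
exists l; near=> k; rewrite /ball /=.
have h1 : `|u k - b k| <= eps / 3 by near: k.
have h2 : `|l - b k| <= eps / 3.
  by near: k; move/cvgrPdist_le : bl; exact.
rewrite (_ : l - u k = (l - b k) - (u k - b k)); last by ring.
apply: le_lt_trans (ler_normB _ _) _; lra.
Unshelve. all: by end_near. Qed.

Lemma cvg_of_geometric_steps u (C q : R) : 0 <= q -> q < 1 ->
  (forall k, `|u k.+1 - u k| <= C * q ^+ k) -> cvg (u @ \oo).
Proof.
move=> q0 q1 hu.
have hs : cvgn (series (fun k => u k.+1 - u k)).
  apply: normed_cvg; apply: (@series_le_cvg _ _ (geometric C q)).
  - by move=> n; rewrite normr_ge0.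
  - by move=> n; apply: le_trans (normr_ge0 _) (hu n).
  - by move=> n; exact: hu.
  - by apply: is_cvg_geometric_series; rewrite ger0_norm.
have -> : u = (fun n => u 0%N + series (fun k => u k.+1 - u k) n).
  apply/funext => n; rewrite /series /=.
  by rewrite telescope_sumr// addrC subrK.
by apply: is_cvgD => //; exact: is_cvg_cst.
Qed.

(** Cesaro means of the increments. *)
Lemma cvg_slope u (l : R) : (fun k => u k.+1 - u k) @ \oo --> l ->
  (fun k => u k / k%:R) @ \oo --> l.
Proof.
move=> hu; have := @cesaro _ _ _ hu.
rewrite /arithmetic_mean => hc.
rewrite -(cvg_shiftS (fun k : nat => u k / k%:R)).
rewrite (_ : mk_sequence _ = (fun n : nat => u 0%N / n.+1%:R +
   n.+1%:R^-1 * series (fun k => u k.+1 - u k) n.+1)); last first.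
  by apply/funext => n; rewrite /mk_sequence /series /= telescope_sumr//; ring.
rewrite -[l]add0r; apply: cvgD => //.
rewrite -[0](mulr0 (u 0%N)); apply: cvgM; [exact: cvg_cst|exact: cvg_harmonic].
Qed.

End Sequences.

(** * Bounds for the sine *)

Section Trigonometry.
Context {R : realType}.
Implicit Types (x y t : R).

Lemma sin_mean_value t : 0 < t -> exists2 c, 0 < c < t & sin t = t * cos c.
Proof.
move=> t0; have [|c ct] := @MVT R (@sin R) (@cos R) 0 t t0.
- by apply: continuous_subspaceT; exact: continuous_sin.
- by rewrite sin0 !subr0 mulrC => e; exists c => //; move: ct; rewrite in_itv.
Qed.

Lemma sin_le_id t : 0 <= t -> sin t <= t.
Proof.
rewrite le_eqVlt => /predU1P[<-|t0]; first by rewrite sin0.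
have [c _ ->] := sin_mean_value t0; have := cos_le1 c; nra.
Qed.

Lemma cos_antitone x y : 0 <= x -> x <= y -> y <= pi -> cos y <= cos x.
Proof.
move=> x0 xy yp; rewrite leNgt; apply/negP.
rewrite ltr_cos ?in_itv /= ?x0 ?(le_trans x0 xy) ?(le_trans xy yp)//.
by rewrite ltNge xy.
Qed.

Lemma sin_monotone x y : 0 <= x -> x <= y -> y <= pi / 2 -> sin x <= sin y.
Proof.
move=> x0 xy yp; have pi0 := pi_gt0 R; rewrite leNgt; apply/negP.
rewrite ltr_sin ?in_itv /=; [by rewrite ltNge xy|by apply/andP; split; lra..].
Qed.

Lemma mul_cos_le_sin t : 0 <= t <= pi -> t * cos t <= sin t.
Proof.
move=> /andP[]; rewrite le_eqVlt => /predU1P[<- _|t0 tp].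
  by rewrite sin0 mul0r.
have [c /andP[c0 ct] ->] := sin_mean_value t0.
by rewrite ler_wpM2l ?(ltW t0)// cos_antitone// ltW.
Qed.

Lemma cos_piquarter_sqr : cos (pi / 4 : R) ^+ 2 = 2^-1.
Proof.
have := cos_mulr2n (pi / 4 : R).
rewrite (_ : pi / 4 *+ 2 = pi / 2 :> R); last by rewrite mulr2n; field.
rewrite cos_pihalf mulr2n; lra.
Qed.

(** Write [sin t = 2 * sin (t / 2) * cos (t / 2)]: both factors are controlled by
    [cos (pi / 4)]. *)
Lemma half_le_sin t : 0 <= t <= pi / 2 -> t / 2 <= sin t.
Proof.
move=> /andP[t0 tp]; have pi0 := pi_gt0 R.
have e : t = (t / 2) *+ 2 by rewrite mulr2n; field.
rewrite [in sin t]e sin_mulr2n [X in _ <= X]mulr2n.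
have h1 : t / 2 * cos (t / 2) <= sin (t / 2).
  by apply: mul_cos_le_sin; apply/andP; split; lra.
have h2 : cos (pi / 4) <= cos (t / 2) by apply: cos_antitone; lra.
have h3 : 0 <= cos (pi / 4 : R) by apply: cos_ge0_pihalf; apply/andP; split; lra.
have h4 := cos_piquarter_sqr.
have h5 : 2^-1 <= cos (t / 2) ^+ 2 by rewrite -[X in X <= _]h4 ler_sqr ?nnegrE//; lra.
have h6 : cos (t / 2) * (t / 2 * cos (t / 2)) <= cos (t / 2) * sin (t / 2).
  by rewrite ler_wpM2l//; lra.
have h7 : t / 2 * 2^-1 <= t / 2 * cos (t / 2) ^+ 2 by rewrite ler_wpM2l//; lra.
move: h6 h7; rewrite expr2; lra.
Qed.

Lemma sin_gt0_half t : 0 < t <= pi / 2 -> 0 < sin t.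
Proof.
move=> /andP[t0 tp]; have p0 := pi_gt0 R.
by apply: sin_gt0_pi; apply/andP; split; lra.
Qed.

Lemma powR_le_neg x y (p : R) : 0 < x -> x <= y -> p <= 0 -> y `^ p <= x `^ p.
Proof.
move=> x0 xy p0; rewrite -[p]opprK !(powRN _ (- p)).
have y0 := lt_le_trans x0 xy.
by rewrite lef_pV2 ?posrE ?powR_gt0// ge0_ler_powR ?nnegrE ?oppr_ge0 ?(ltW x0) ?(ltW y0).
Qed.

Lemma powR_le_pos x y (p : R) : 0 <= x -> x <= y -> 0 <= p -> x `^ p <= y `^ p.
Proof.
by move=> x0 xy p0; rewrite ge0_ler_powR ?nnegrE// (le_trans x0).
Qed.

Lemma continuous_powR (p x : R) : 0 < x -> {for x, continuous (@powR R ^~ p)}.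
Proof.
move=> x0; apply: differentiable_continuous.
by apply/derivable1_diffP; apply: ex_derive; exact: is_derive1_powR.
Qed.

Lemma expr_powR (a p : R) k : 0 < a -> (a ^+ k) `^ p = (a `^ p) ^+ k.
Proof.
move=> a0; elim: k => [|k IH]; first by rewrite !expr0 powR1.
by rewrite !exprS powRM ?exprn_ge0 ?ltW// IH.
Qed.

(** The mesh of the grid of the [2 ^ k]-th roots of unity, in the half-angle
    variable that makes the chord between two points [2 * sin x]. *)
Definition mesh k : R := pi / 2 ^+ k.

Lemma mesh_gt0 k : 0 < mesh k.
Proof. by rewrite divr_gt0 ?pi_gt0// exprn_gt0. Qed.

Lemma meshS k : mesh k.+1 = mesh k / 2.
Proof. by rewrite /mesh exprS; field; rewrite expf_neq0. Qed.

Lemma mesh_half k : (2 ^ k)%:R * mesh k.+1 = pi / 2.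
Proof. by rewrite /mesh natrX exprS; field; rewrite expf_neq0. Qed.

Lemma mesh_cvg0 : mesh @ \oo --> (0 : R).
Proof.
rewrite (_ : mesh = geometric pi (2^-1)).
  by apply: cvg_geometric; rewrite ger0_norm ?invr_ge0// invf_lt1// ltr1n.
by apply/funext => k; rewrite /mesh /= exprVn.
Qed.

Lemma cvg_sin_mesh (y : R) : 0 < y ->
  (fun k => 2 ^+ k * sin (y * mesh k)) @ \oo --> y * pi.
Proof.
move=> y0; have pi0 := pi_gt0 R.
have ym : (fun k => y * mesh k) @ \oo --> (0 : R).
  by rewrite -[0](mulr0 y); apply: cvgM; [exact: cvg_cst|exact: mesh_cvg0].
apply: (@squeeze_cvgr _ _ _ _ (fun k => y * pi * cos (y * mesh k)) (fun=> y * pi)).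
- near=> k.
  have m0 := mesh_gt0 k.
  have e : y * pi = 2 ^+ k * (y * mesh k).
    by rewrite /mesh; field; rewrite expf_neq0.
  have ym0 : 0 <= y * mesh k by rewrite mulr_ge0// ltW.
  have ymp : `|y * mesh k| <= pi by near: k; apply: near_le_of_cvg0.
  move: ymp; rewrite ger0_norm// => ymp.
  have k2 : 0 <= 2 ^+ k :> R by rewrite exprn_ge0.
  rewrite e -mulrA ler_wpM2l//=; last by apply: mul_cos_le_sin; rewrite ym0.
  by rewrite ler_wpM2l// sin_le_id.
- rewrite -[y * pi in X in _ --> X]mulr1; apply: cvgM; first exact: cvg_cst.
  rewrite -(@cos0 R); apply: continuous_cvg => //; exact: continuous_cos.
- exact: cvg_cst.
Unshelve. all: by end_near. Qed.

End Trigonometry.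

(** * Trapezoidal sums on a grid *)

Section GridSums.
Context {R : realType}.
Implicit Types (f : R -> R) (h : R) (n : nat).

Definition grid_sum f h n : R := \sum_(1 <= j < n) f (j%:R * h).

Definition midpoint_sum f h n : R := \sum_(j < n) f ((j%:R + 2^-1) * h).

Lemma grid_sum_refine f h n : (0 < n)%N ->
  grid_sum f (h / 2) n.*2 = midpoint_sum f h n + grid_sum f h n.
Proof.
case: n => // n _; elim: n => [|n IH].
  rewrite /grid_sum /midpoint_sum big_nat1 big_ord1 big_geq// addr0.
  by congr f; rewrite add0r mul1r mulrC.
rewrite doubleS /grid_sum big_nat_recr//= big_nat_recr//=.
rewrite -/(grid_sum f (h / 2) n.+1.*2) IH {2}/midpoint_sum big_ord_recr /= -/(midpoint_sum f h n.+1).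
rewrite [in RHS]big_nat_recr//= -/(grid_sum f h n.+1).
have -> : n.+1.*2%:R * (h / 2) = n.+1%:R * h by rewrite -muln2 natrM; field.
have -> : n.+1.*2.+1%:R * (h / 2) = (n.+1%:R + 2^-1) * h.
  by rewrite -natr1 -muln2 natrM; field.
by ring.
Qed.

Lemma grid_sum_fold f h n : (0 < n)%N ->
  (forall x, f ((2 * n)%:R * h - x) = f x) ->
  grid_sum f h (2 * n) = 2 * grid_sum f h n + f (n%:R * h).
Proof.
move=> n0 fsym; rewrite /grid_sum (big_cat_nat (n := n))/=; try lia.
rewrite [X in _ + X](big_ltn_cond) ; last by lia.
rewrite /=.
suff -> : \sum_(n.+1 <= j < 2 * n) f (j%:R * h) = \sum_(1 <= j < n) f (j%:R * h).
  by ring.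
rewrite big_nat_rev /= -{1}[n.+1]add1n big_addn /=.
have -> : (2 * n - n = n)%N by lia.
rewrite big_nat_cond [RHS]big_nat_cond; apply: eq_bigr => j.
rewrite andbT => /andP[j1 jn]; rewrite -[RHS]fsym; congr f.
have -> : (n.+1 + 2 * n - (j + n).+1 = 2 * n - j)%N by lia.
by rewrite natrB; [ring|lia].
Qed.

Lemma midpoint_sum_fold f h n :
  (forall x, f ((2 * n)%:R * h - x) = f x) ->
  midpoint_sum f h (2 * n) = 2 * midpoint_sum f h n.
Proof.
move=> fsym; rewrite /midpoint_sum mul2n -addnn big_split_ord /=.
suff -> : \sum_(i < n) f (((n + i)%N%:R + 2^-1) * h) =
  \sum_(i < n) f ((i%:R + 2^-1) * h) by ring.
rewrite (reindex_inj rev_ord_inj) /=; apply: eq_bigr => j _.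
rewrite -[RHS]fsym; congr f; have jn := ltn_ord j.
have -> : (n + (n - j.+1) = 2 * n - j.+1)%N by lia.
by rewrite natrB; [rewrite -natr1; field|lia].
Qed.

(** The defect of the trapezoidal rule on [[j * h, (j + 1) * h]]. *)
Definition trapezoid_defect f h (j : nat) : R :=
  f ((j%:R + 2^-1) * h) - (f (j%:R * h) + f (j.+1%:R * h)) / 2.

(** The first interval is set apart, since [f] may be singular at [0]. *)
Lemma grid_sum_step f h n : (0 < n)%N ->
  midpoint_sum f h n - grid_sum f h n - f (n%:R * h) / 2 =
  f (h / 2) - f h / 2 + \sum_(1 <= j < n) trapezoid_defect f h j.
Proof.
case: n => // n _; elim: n => [|n IH].
  rewrite /grid_sum /midpoint_sum big_ord1 big_geq// big_geq// !addr0 subr0 add0r.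
  by rewrite mul1r mulrC.
rewrite /grid_sum /midpoint_sum big_ord_recr big_nat_recr// [in RHS]big_nat_recr//=.
rewrite -/(midpoint_sum f h n.+1) -/(grid_sum f h n.+1).
move: IH; rewrite /trapezoid_defect.
set a := midpoint_sum _ _ _; set b := grid_sum _ _ _; set c := \sum_(_ <= _ < _) _.
lra.
Qed.

(** Stated with a sign [c], so that the bound telescopes for increasing and for
    decreasing functions alike. *)
Lemma trapezoid_defect_monotone f h j (c : R) :
  c * f (j%:R * h) <= c * f ((j%:R + 2^-1) * h) ->
  c * f ((j%:R + 2^-1) * h) <= c * f (j.+1%:R * h) -> `|c| = 1 ->
  `|trapezoid_defect f h j| <= c * (f (j.+1%:R * h) - f (j%:R * h)) / 2.
Proof.
move=> h1 h2 c1; rewrite /trapezoid_defect.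
have : c = 1 \/ c = -1.
  have [c0|c0] := leP 0 c; [left|right]; move: c1.
    by rewrite ger0_norm.
  by rewrite ltr0_norm//; lra.
move: h1 h2; set x := f _; set y := f _; set z := f _ => h1 h2.
by case=> e; rewrite e in h1 h2 *; rewrite ler_norml; apply/andP; split; lra.
Qed.

(** The mean value theorem on both halves of the interval turns the defect into
    a difference of two values of the monotone derivative. *)
Lemma trapezoid_defect_derive f (df : R -> R) h j (c : R) : 0 < h ->
  (forall x, j%:R * h <= x <= j.+1%:R * h -> is_derive x 1 f (df x)) ->
  (forall x y, j%:R * h <= x -> x <= y -> y <= j.+1%:R * h ->
     c * df y <= c * df x) -> `|c| = 1 ->
  `|trapezoid_defect f h j| <= h / 4 * (c * (df (j%:R * h) - df (j.+1%:R * h))).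
Proof.
move=> h0; rewrite /trapezoid_defect.
set a := j%:R * h; set b := j.+1%:R * h; set m := (j%:R + 2^-1) * h.
move=> fd dfm c1.
have am : m - a = h / 2 by rewrite /m /a; ring.
have mb : b - m = h / 2 by rewrite /b /m -natr1; field.
clearbody a b m.
have fc x y : a <= x -> y <= b -> {within `[x, y], continuous f}.
  move=> ax yb; apply: derivable_within_continuous => z.
  rewrite in_itv /= => /andP[xz zy]; apply: ex_derive; apply: fd.
  by apply/andP; split; lra.
have [|||x hx ex] := @MVT _ f df a m.
- by lra.
- by move=> x; rewrite in_itv /= => /andP[? ?]; apply: fd; apply/andP; split; lra.
- by apply: fc; lra.
have [|||y hy ey] := @MVT _ f df m b.
- by lra.
- by move=> y; rewrite in_itv /= => /andP[? ?]; apply: fd; apply/andP; split; lra.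
- by apply: fc; lra.
move: hx hy; rewrite !in_itv /= => /andP[ax xm] /andP[my yb].
have h1 : c * df x <= c * df a by apply: dfm; lra.
have h2 : c * df y <= c * df x by apply: dfm; lra.
have h3 : c * df b <= c * df y by apply: dfm; lra.
have -> : f m - (f a + f b) / 2 = h / 4 * (df x - df y).
  by move: ex ey; rewrite am mb; lra.
rewrite normrM gtr0_norm; last by lra.
rewrite ler_wpM2l//; first by lra.
have -> : `|df x - df y| = `|c * (df x - df y)| by rewrite normrM c1 mul1r.
by rewrite ger0_norm; lra.
Qed.

End GridSums.

(** * Power sums of the sine *)

Section SinePowerSums.
Context {R : realType}.
Implicit Types (p x : R) (k j n : nat).

Definition sin_power_sum p k : R :=
  grid_sum (fun x => sin x `^ p) (mesh k) (2 ^ k).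

Lemma two_mesh_half k : (2 * 2 ^ k)%:R * mesh k.+1 = pi :> R.
Proof. by rewrite natrM -mulrA mesh_half; field. Qed.

Lemma sin_reflect p k x :
  sin ((2 * 2 ^ k)%:R * mesh k.+1 - x) `^ p = sin x `^ p.
Proof. by rewrite two_mesh_half sinB sinpi cospi mul0r mulN1r sub0r opprK. Qed.

Lemma sin_power_sum_fold p k : sin_power_sum p k.+1 =
  2 * grid_sum (fun x => sin x `^ p) (mesh k.+1) (2 ^ k) + 1.
Proof.
rewrite /sin_power_sum expnS grid_sum_fold ?expn_gt0//; last exact: sin_reflect.
by rewrite mesh_half sin_pihalf powR1.
Qed.

Lemma sin_power_sum_step p k :
  let f x := sin x `^ p in let h := mesh k.+1 in
  sin_power_sum p k.+2 - 2 * sin_power_sum p k.+1 =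
  2 * (f (h / 2) - f h / 2 + \sum_(1 <= j < 2 ^ k) trapezoid_defect f h j).
Proof.
move=> f h; rewrite -grid_sum_step ?expn_gt0// /sin_power_sum.
have e0 : (2 ^ k.+2 = (2 * 2 ^ k).*2)%N by rewrite !expnS; lia.
rewrite [mesh k.+2]meshS e0 grid_sum_refine ?muln_gt0 ?expn_gt0//.
rewrite (midpoint_sum_fold (n := 2 ^ k)); last exact: sin_reflect.
rewrite expnS grid_sum_fold ?expn_gt0//; last exact: sin_reflect.
by rewrite /f /h; field.
Qed.

Lemma grid_point_bounds k j : (1 <= j <= 2 ^ k)%N ->
  mesh k.+1 <= (j%:R * mesh k.+1 : R) <= pi / 2.
Proof.
move=> /andP[j1 jk]; have m0 := mesh_gt0 (R := R) k.+1.
rewrite -(mesh_half k) ler_pM2r// ler_nat jk andbT.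
by rewrite ler_peMl ?(ltW m0)// ler1n.
Qed.

(** The sign [c] records the direction of the variation, so that positive and
    negative exponents are treated together. *)
Lemma sin_powR_monotone p : exists2 c : R, `|c| = 1 &
  forall x y, 0 < x -> x <= y -> y <= pi / 2 ->
    c * (sin x `^ p) <= c * (sin y `^ p).
Proof.
have [p0|p0] := leP 0 p.
  exists 1; rewrite ?normr1// => x y x0 xy yp; rewrite !mul1r.
  apply: powR_le_pos => //; last by apply: sin_monotone; lra.
  by apply/ltW/sin_gt0_half; apply/andP; split; lra.
exists (-1); rewrite ?normrN1// => x y x0 xy yp; rewrite !mulN1r lerN2.
apply: powR_le_neg; last by rewrite ltW.
  by apply/sin_gt0_half; apply/andP; split; lra.
by apply: sin_monotone; lra.
Qed.

(** Monotonicity makes the bounds on the defects telescope. *)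
Lemma sum_defect_le p k :
  \sum_(1 <= j < 2 ^ k) `|trapezoid_defect (fun x => sin x `^ p) (mesh k.+1) j|
  <= `|1 - sin (mesh k.+1) `^ p| / 2.
Proof.
have [c c1 cm] := sin_powR_monotone p.
set f := fun x => sin x `^ p; set h := mesh k.+1.
have h0 : 0 < h by apply: mesh_gt0.
apply: (@le_trans _ _ (\sum_(1 <= j < 2 ^ k) (c / 2 * (f (j.+1%:R * h) - f (j%:R * h))))).
  rewrite big_nat_cond [X in _ <= X]big_nat_cond ler_sum// => j.
  rewrite andbT => /andP[j1 jk].
  have -> : c / 2 * (f (j.+1%:R * h) - f (j%:R * h)) =
    c * (f (j.+1%:R * h) - f (j%:R * h)) / 2 by ring.
  have /andP[b1 b2] : h <= j%:R * h <= pi / 2.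
    by apply: grid_point_bounds; rewrite j1 ltnW.
  have /andP[b3 b4] : h <= j.+1%:R * h <= pi / 2.
    by apply: grid_point_bounds; lia.
  rewrite -natr1 in b3 b4.
have e : j.+1%:R = j%:R + 1 :> R by rewrite -natr1.
by apply: trapezoid_defect_monotone => //; apply: cm; rewrite ?e; lra.
rewrite -mulr_sumr.
rewrite (telescope_sumr (fun j => f (j%:R * h))) ?expn_gt0//.
rewrite mul1r mesh_half {1}/f sin_pihalf powR1.
apply: le_trans (ler_norm _) _; rewrite !normrM c1 mul1r.
by rewrite (ger0_norm (x := 2^-1)) ?invr_ge0// mulrC.
Qed.

Lemma sin_power_mesh_le p k : p <= 0 ->
  sin (mesh k.+1) `^ p <= (pi / 4) `^ p * (2 `^ (- p)) ^+ k.
Proof.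
move=> p0; have m0 := mesh_gt0 (R := R) k.+1.
have pi0 := pi_gt0 R.
have k0 : 0 < 2 ^+ k :> R by rewrite exprn_gt0.
have mp : mesh k.+1 <= pi / 2 :> R.
  by rewrite -(mesh_half k) ler_peMl ?(ltW m0)// ler1n expn_gt0.
apply: (@le_trans _ _ ((mesh k.+1 / 2) `^ p)).
  apply: powR_le_neg => //; first by rewrite divr_gt0.
  by apply: half_le_sin; rewrite mp ltW.
have -> : mesh k.+1 / 2 = pi / 4 * (2 ^+ k)^-1 :> R.
  by rewrite /mesh exprS; field; rewrite gt_eqF.
rewrite powRM; [|lra|by rewrite invr_ge0 ltW].
by rewrite -(powR_inv1 (ltW k0)) -powRrM mulN1r expr_powR.
Qed.

(** The growth rate of [sin (mesh k) `^ p]; it stays below that of [2 ^ k]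
    exactly when [sin `^ p] is integrable. *)
Definition growth p : R := Num.max 1 (2 `^ (- p)).

Lemma growth_ge1 p : 1 <= growth p.
Proof. by rewrite le_max lexx. Qed.

Lemma growth_lt2 p : -1 < p -> growth p < 2.
Proof.
move=> p1; rewrite gt_max ltr1n /= -[X in _ < X]powRr1// /powR pnatr_eq0 /=.
by rewrite ltr_expR ltr_pM2r ?ln_gt0 ?ltr1n//; lra.
Qed.

Lemma sin_power_mesh_bound p : exists2 A : R, 1 <= A &
  forall k, sin (mesh k.+1) `^ p <= A * growth p ^+ k.
Proof.
pose A := Num.max 1 ((pi / 4) `^ p : R).
have q1 := growth_ge1 p.
have A1 : 1 <= A by rewrite le_max lexx.
exists A => // k.
have [p0|p0] := leP 0 p.
  apply: (@le_trans _ _ (1 * 1)); last first.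
    by apply: ler_pM => //; apply: exprn_ege1.
  have e1 : 1 * 1 = 1 `^ p :> R by rewrite powR1 mulr1.
  rewrite e1; apply: powR_le_pos => //.
    have /andP[_ h] := @grid_point_bounds k 1 (expn_gt0 2 k).
    apply/ltW/sin_gt0_half; rewrite mesh_gt0 /=; move: h; lra.
apply: (le_trans (sin_power_mesh_le k (ltW p0))).
apply: ler_pM; rewrite ?powR_ge0 ?exprn_ge0 ?powR_ge0// ?le_max ?lexx ?orbT//.
by rewrite lerXn2r ?nnegrE ?powR_ge0 ?(le_trans ler01 q1)// le_max lexx orbT.
Qed.

(** First-order control of the refinement of the grid, valid for every exponent:
    the boundary terms at [mesh (k + 1)] dominate. *)
Lemma sin_power_sum_step_le p : exists2 C : R, 0 <= C & forall k,
  `|sin_power_sum p k.+2 - 2 * sin_power_sum p k.+1| <= C * growth p ^+ k.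
Proof.
have [A A1 key] := sin_power_mesh_bound p.
set q := growth p in key *.
have q1 : 1 <= q := growth_ge1 p.
have q0 : 0 <= q by apply: le_trans q1.
have A0 : 0 <= A by apply: le_trans A1.
exists (2 * (A * q + A + A)).
  by rewrite mulr_ge0// !addr_ge0// mulr_ge0.
move=> k; rewrite sin_power_sum_step normrM (gtr0_norm (x := 2))// -[X in _ <= X]mulrA ler_pM2l//.
apply: le_trans (ler_normD _ _) _.
have h1 := sum_defect_le p k; have h2 := key k; have h3 := key k.+1.
have h4 : `|\sum_(1 <= j < 2 ^ k) trapezoid_defect (fun x => sin x `^ p) (mesh k.+1) j|
   <= `|1 - sin (mesh k.+1) `^ p| / 2.
  by apply: le_trans h1; apply: ler_norm_sum.
have h5 : `|1 - sin (mesh k.+1) `^ p| <= A * q ^+ k.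
  have := powR_ge0 (sin (mesh k.+1)) p.
  have : 1 <= A * q ^+ k.
    by rewrite -[X in X <= _](mulr1 1); apply: ler_pM => //; apply: exprn_ege1.
  by rewrite ler_norml => *; apply/andP; split; lra.
rewrite -meshS.
have h6 : `|sin (mesh k.+2) `^ p - sin (mesh k.+1) `^ p / 2| <=
   A * q ^+ k.+1 + A * q ^+ k / 2.
  have := powR_ge0 (sin (mesh k.+1)) p; have := powR_ge0 (sin (mesh k.+2)) p.
  by rewrite ler_norml => *; apply/andP; split; lra.
have h7 : 0 <= A * q ^+ k by rewrite mulr_ge0 ?exprn_ge0.
move: h4 h6; rewrite exprS; lra.
Qed.

(** Refining the grid changes the mean by a geometric sequence of ratio
    [growth p / 2]. *)
Lemma is_cvg_sin_power_mean p : -1 < p ->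
  cvg ((fun k => sin_power_sum p k / 2 ^+ k) @ \oo).
Proof.
move=> p1; have [C C0 hC] := sin_power_sum_step_le p.
set q := growth p in hC.
have q1 : 1 <= q := growth_ge1 p.
have q2 : q < 2 := growth_lt2 p1.
have h : cvg ((fun k => sin_power_sum p k.+1 / 2 ^+ k.+1) @ \oo).
  apply: (@cvg_of_geometric_steps _ _ (C / 4) (q / 2)); [lra|lra|] => k.
  have -> : sin_power_sum p k.+2 / 2 ^+ k.+2 - sin_power_sum p k.+1 / 2 ^+ k.+1 =
    (sin_power_sum p k.+2 - 2 * sin_power_sum p k.+1) / 4 / 2 ^+ k.
    by rewrite !exprS; field; rewrite expf_neq0.
  rewrite expr_div_n !normrM !normfV (gtr0_norm (x := 2 ^+ k)) ?exprn_gt0//.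
  rewrite (gtr0_norm (x := 4))// mulrA ler_pM2r ?invr_gt0 ?exprn_gt0//.
  by have := hC k; lra.
move/cvg_ex : h => [l hl]; apply/cvg_ex; exists l.
by rewrite -(cvg_shiftS (fun k : nat => sin_power_sum p k / 2 ^+ k)).
Qed.

End SinePowerSums.

(** * Second-order asymptotics of the power sums *)

Section SinePowerAsymptotics.
Context {R : realType}.
Implicit Types (p x y : R) (k j n : nat).

Lemma cvg_powR_pinfty (a : R) : 0 < a -> (fun n : nat => n%:R `^ a : R) @ \oo --> +oo.
Proof.
move=> a0; apply/cvgryPge => A; near=> n.
have A1 : 0 <= Num.max A 0 by rewrite le_max lexx orbT.
have hn : Num.max A 0 `^ a^-1 <= n%:R by near: n; exact: nbhs_infty_ger.
apply: (@le_trans _ _ (Num.max A 0)); first by rewrite le_max lexx.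
have := powR_le_pos (powR_ge0 _ _) hn (ltW a0).
by rewrite -powRrM mulVf ?gt_eqF// powRr1.
Unshelve. all: by end_near. Qed.

Lemma cvg_sin_power_mesh p y : 0 < y ->
  (fun k => sin (y * mesh k) `^ p * (2 `^ p) ^+ k) @ \oo --> (y * pi) `^ p.
Proof.
move=> y0; have h := cvg_sin_mesh (R := R) y0.
have ypi : 0 < y * pi :> R by rewrite mulr_gt0// pi_gt0.
have h1 : (fun k => (2 ^+ k * sin (y * mesh k)) `^ p) @ \oo --> (y * pi) `^ p.
  have := @continuous_cvg _ _ _ _ _ _ (fun x => x `^ p) _ (continuous_powR (p := p) ypi) h.
  exact.
apply: cvg_trans h1; apply: near_eq_cvg; near=> k.
have s0 : 0 < 2 ^+ k * sin (y * mesh k) by near: k; exact: (cvgr_gt (y * pi)).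
rewrite powRM ?exprn_ge0//; last by move: s0; rewrite pmulr_rgt0 ?exprn_gt0// => /ltW.
by rewrite expr_powR// mulrC.
Unshelve. all: by end_near. Qed.

Lemma is_derive_sin_power p x : 0 < sin x ->
  is_derive x 1 (fun x => sin x `^ p) (p * sin x `^ (p - 1) * cos x).
Proof.
move=> s0; have h := is_derive1_powR p s0.
exact: (is_derive1_comp (f := fun y => y `^ p) (g := sin)).
Qed.

Lemma sin_power_derivative_monotone p : p <= 1 -> exists2 c : R, `|c| = 1 & c * p = `|p| /\
  forall x y, 0 < x -> x <= y -> y <= pi / 2 ->
  c * (p * sin y `^ (p - 1) * cos y) <= c * (p * sin x `^ (p - 1) * cos x).
Proof.
move=> p1; have [c c1 cp] : exists2 c : R, `|c| = 1 & c * p = `|p|.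
  have [p0|p0] := leP 0 p; [exists 1|exists (-1)]; rewrite ?normrN1 ?normr1//.
    by rewrite mul1r ger0_norm.
  by rewrite mulN1r ltr0_norm.
exists c => //; split=> // x y x0 xy yp; rewrite !mulrA cp -!mulrA ler_wpM2l//.
have sx : 0 < sin x by apply: sin_gt0_half; apply/andP; split; lra.
have pi0 := pi_gt0 R.
apply: ler_pM; rewrite ?powR_ge0//.
- by apply: cos_ge0_pihalf; apply/andP; split; lra.
- by apply: powR_le_neg => //; [apply: sin_monotone; lra|lra].
- by apply: cos_antitone; lra.
Qed.

(** For [p <= 1] the derivative of [sin `^ p] is monotone on the quarter circle,
    so the second-order bounds telescope down to its value at the point [J]. *)
Lemma sum_defect_tail p k J : p <= 1 -> (0 < J <= 2 ^ k)%N ->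
  \sum_(J <= j < 2 ^ k) `|trapezoid_defect (fun x => sin x `^ p) (mesh k.+1) j|
  <= mesh k.+1 / 4 * (`|p| * (J%:R * mesh k.+1 / 2) `^ (p - 1)).
Proof.
move=> p1 /andP[J0 Jk]; have [c c1 [cp cm]] := sin_power_derivative_monotone p1.
set f := fun x => sin x `^ p; set h := mesh k.+1.
have h0 : 0 < h by apply: mesh_gt0.
have pi0 := pi_gt0 R.
pose df x := p * sin x `^ (p - 1) * cos x.
apply: (@le_trans _ _ (\sum_(J <= j < 2 ^ k)
   ((- (h / 4 * c)) * (df (j.+1%:R * h) - df (j%:R * h))))).
  rewrite big_nat_cond [X in _ <= X]big_nat_cond ler_sum// => j.
  rewrite andbT => /andP[j1 jk].
  have -> : - (h / 4 * c) * (df (j.+1%:R * h) - df (j%:R * h)) =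
    h / 4 * (c * (df (j%:R * h) - df (j.+1%:R * h))) by ring.
  have /andP[b1 b2] : h <= j%:R * h <= pi / 2.
    by apply: grid_point_bounds; lia.
  have /andP[b3 b4] : h <= j.+1%:R * h <= pi / 2.
    by apply: grid_point_bounds; lia.
  apply: trapezoid_defect_derive => //.
    move=> x /andP[xj jx]; apply: is_derive_sin_power.
    by apply: sin_gt0_half; apply/andP; split; lra.
  by move=> x y jx xy yj; apply: cm; lra.
rewrite -mulr_sumr (telescope_sumr (fun j => df (j%:R * h)))//.
have /andP[b1 b2] : h <= J%:R * h <= pi / 2.
  by apply: grid_point_bounds; lia.
rewrite mesh_half.
have -> : - (h / 4 * c) * (df (pi / 2) - df (J%:R * h)) =
  h / 4 * (c * p * (sin (J%:R * h) `^ (p - 1) * cos (J%:R * h))).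
  by rewrite /df cos_pihalf; ring.
apply: ler_wpM2l; first lra.
rewrite cp ler_wpM2l//.
have s0 : 0 < sin (J%:R * h) by apply: sin_gt0_half; apply/andP; split; lra.
apply: (@le_trans _ _ (sin (J%:R * h) `^ (p - 1))).
  by rewrite ler_piMr ?powR_ge0// cos_le1.
apply: powR_le_neg; [lra| |lra].
by apply: half_le_sin; apply/andP; split; lra.
Qed.

(** After multiplication by [2 ^ (k p)] each term of the refinement step has a
    limit, and the telescoping bound on the tail makes the passage to the limit
    uniform in the number of terms. *)
Lemma is_cvg_sin_power_step p : p < 1 ->
  cvg ((fun k => (sin_power_sum p k.+1 - 2 * sin_power_sum p k) * (2 `^ p) ^+ k) @ \oo).
Proof.
move=> p1; set q := 2 `^ p.
have pi0 := pi_gt0 R.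
have q0 : 0 < q by rewrite powR_gt0.
suff [l hl] : exists l : R,
  (fun k => (sin_power_sum p k.+2 - 2 * sin_power_sum p k.+1) * q ^+ k.+1)
     @ \oo --> l.
  apply/cvg_ex; exists l.
  by rewrite -(cvg_shiftS (fun k => (sin_power_sum p k.+1 - 2 * sin_power_sum p k) * q ^+ k)).
apply/cvg_ex; apply: cvg_by_approximation => eps eps0.
(* C * J ^ (p - 1) bounds the rescaled tail from J on. *)
pose C := `|p| * (pi / 2) `^ p.
have C0 : 0 <= C by rewrite mulr_ge0 ?powR_ge0.
have [J J0 hJ] : exists2 J, (0 < J)%N & C * J%:R `^ (p - 1) <= eps.
  have := cvg_powR_pinfty (a := 1 - p); rewrite subr_gt0 => /(_ p1)/cvgryPge.
  move=> /(_ (C / eps + 1))[M _ hM]; exists M.+1 => //.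
  have := hM M.+1 (leqnSn M) => hM1.
  have e1 : C / eps <= M.+1%:R `^ (1 - p) by move: hM1; lra.
  have P0 : 0 < M.+1%:R `^ (1 - p) :> R by rewrite powR_gt0// ltr0n.
  rewrite (_ : p - 1 = - (1 - p)); last by ring.
  by rewrite powRN ler_pdivrMr// mulrC -ler_pdivrMr.
set f := fun x => sin x `^ p.
exists (fun k => 2 * (f (mesh k.+1 / 2) - f (mesh k.+1) / 2 +
   \sum_(1 <= j < J) trapezoid_defect f (mesh k.+1) j) * q ^+ k.+1).
  have lim1 y : 0 < y -> exists l : R, (fun k => f (y * mesh k.+1) * q ^+ k.+1) @ \oo --> l.
    move=> y0; exists ((y * pi) `^ p).
    have := @cvg_sin_power_mesh p y y0.
    by rewrite -(cvg_shiftS (fun k => sin (y * mesh k) `^ p * _)).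
  have [l1 h1] := lim1 2^-1 (ltac:(by [])).
  have [l2 h2] := lim1 1 ltr01.
  have lim3 : exists l : R, (fun k => \sum_(1 <= j < J)
      trapezoid_defect f (mesh k.+1) j * q ^+ k.+1) @ \oo --> l.
    elim: J {J0 hJ} => [|J [l3 IH]].
      exists 0; rewrite (_ : (fun k => _) = fun=> 0); first exact: cvg_cst.
      by apply/funext => k; rewrite big_geq.
    case: J IH => [|J] IH.
      exists 0; rewrite (_ : (fun k => _) = fun=> 0); first exact: cvg_cst.
      by apply/funext => k; rewrite big_geq.
    have [a ha] := lim1 (J.+1%:R + 2^-1) (ltac:(by rewrite ltr_wpDl)).
    have [b hb] := lim1 J.+1%:R (ltac:(by rewrite ltr0n)).
    have [d hd] := lim1 J.+2%:R (ltac:(by rewrite ltr0n)).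
    exists (l3 + (a - (b + d) / 2)).
    rewrite (_ : (fun k => _) = (fun k =>
      (\sum_(1 <= j < J.+1) trapezoid_defect f (mesh k.+1) j * q ^+ k.+1) +
      (f ((J.+1%:R + 2^-1) * mesh k.+1) * q ^+ k.+1 -
      (f (J.+1%:R * mesh k.+1) * q ^+ k.+1 + f (J.+2%:R * mesh k.+1) * q ^+ k.+1) / 2))).
      apply: cvgD => //; apply: cvgB => //; apply: cvgM; last exact: cvg_cst.
      exact: cvgD.
    apply/funext => k; rewrite big_nat_recr//=; congr (_ + _).
    by rewrite /trapezoid_defect; ring.
  have [l3 h3] := lim3.
  apply/cvg_ex; exists (2 * (l1 - l2 / 2 + l3)).
  rewrite (_ : (fun k => _) = (fun k => 2 * (f (2^-1 * mesh k.+1) * q ^+ k.+1 -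
     (f (1 * mesh k.+1) * q ^+ k.+1) / 2 +
     \sum_(1 <= j < J) trapezoid_defect f (mesh k.+1) j * q ^+ k.+1))).
    apply: cvgM; first exact: cvg_cst.
    apply: cvgD => //; apply: cvgB => //; apply: cvgM => //; exact: cvg_cst.
  apply/funext => k; rewrite -mulr_suml mul1r [2^-1 * _]mulrC; ring.
exists J => // k /= Jk.
have Jk2 : (J <= 2 ^ k)%N by apply: leq_trans Jk (ltnW (ltn_expl _ _)).
rewrite sin_power_sum_step -/f (big_cat_nat (n := J) (p := 2 ^ k))//=.
set A := \sum_(1 <= j < J) _; set B := \sum_(J <= j < _) _.
rewrite [X in `|X|](_ : _ = 2 * B * q ^+ k.+1); last by rewrite /f; ring.
pose h : R := mesh k.+1; have h0 : 0 < h by apply: mesh_gt0.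
have hB : `|B| <= h / 4 * (`|p| * (J%:R * h / 2) `^ (p - 1)).
  apply: le_trans (ler_norm_sum _ _ _) _.
  by apply: sum_defect_tail; rewrite ?J0// ltW.
apply: le_trans hJ.
have -> : C * J%:R `^ (p - 1) =
  2 * (h / 4 * (`|p| * (J%:R * h / 2) `^ (p - 1))) * q ^+ k.+1.
  have e : (pi / 2) `^ p = (h / 2) * (h / 2) `^ (p - 1) * q ^+ k.+1.
    rewrite -[X in X * _ * _](powRr1 (a := h / 2)); last by lra.
    rewrite -powRD; last by apply/implyP => _; rewrite gt_eqF// divr_gt0.
    rewrite (_ : 1 + (p - 1) = p); last by ring.
    rewrite -expr_powR// -powRM ?exprn_ge0//; last by lra.
    by congr (_ `^ p); rewrite /h /mesh; field; rewrite expf_neq0.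
  rewrite /C e -[J%:R * h / 2]mulrA (@powRM _ J%:R (h / 2)) ?ler0n//; last by lra.
  by field.
rewrite !normrM (gtr0_norm (x := 2))// (gtr0_norm (x := q ^+ _)) ?exprn_gt0//.
by rewrite ler_pM2r ?exprn_gt0// ler_pM2l.
Qed.

End SinePowerAsymptotics.

(** * Moments of the sine *)

Section SineMoments.
Context {R : realType}.
Implicit Types (p x y : R) (k j n : nat).

Definition sine_moment p : R := lim ((fun k => sin_power_sum p k / 2 ^+ k) @ \oo).

Lemma cvg_sine_moment p : -1 < p ->
  (fun k => sin_power_sum p k / 2 ^+ k) @ \oo --> sine_moment p.
Proof. by move=> p1; exact: is_cvg_sin_power_mean. Qed.

Lemma sine_moment_antitone p r : -1 < p -> p <= r -> sine_moment r <= sine_moment p.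
Proof.
move=> p1 pr; have r1 : -1 < r by apply: lt_le_trans pr.
apply: (ler_cvg_to (cvg_sine_moment r1) (cvg_sine_moment p1)).
near=> k; rewrite ler_pM2r ?invr_gt0 ?exprn_gt0// /sin_power_sum /grid_sum.
rewrite big_nat_cond [X in _ <= X]big_nat_cond ler_sum// => j.
rewrite andbT => /andP[j1 jk].
apply: ger_powR => //; rewrite sin_le1 andbT; apply: sin_gt0_pi.
have m0 := mesh_gt0 (R := R) k.
rewrite mulr_gt0 ?ltr0n//=.
have -> : pi = (2 ^ k)%:R * mesh k :> R.
  by rewrite /mesh natrX; field; rewrite expf_neq0.
by rewrite ltr_pM2r// ltr_nat.
Unshelve. all: by end_near. Qed.

Lemma sine_moment0 : sine_moment 0 = 1.
Proof.
apply/cvg_lim => //.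
rewrite (_ : (fun k => _) = (fun k => 1 - geometric 1 (2^-1 : R) k)).
  rewrite -[X in _ --> X]subr0; apply: cvgB; first exact: cvg_cst.
  by apply: cvg_geometric; rewrite ger0_norm ?invr_ge0// invf_lt1// ltr1n.
apply/funext => k; rewrite /sin_power_sum /grid_sum.
under eq_bigr do rewrite powRr0.
rewrite sumr_const_nat natrB ?expn_gt0// natrX /= mul1r exprVn.
by field; rewrite expf_neq0.
Qed.

(** Multiplied by [2 * sin (h / 2)] the sum telescopes (Lagrange's identity). *)
Lemma sin_grid_sum (h : R) n : sin (h / 2) != 0 -> (0 < n)%N ->
  grid_sum sin h n =
  (cos (h / 2) - cos ((n%:R - 2^-1) * h)) / (2 * sin (h / 2)).
Proof.
move=> s0; case: n => // n _; elim: n => [|n IH].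
  rewrite /grid_sum big_geq// (_ : (1 - 2^-1) * h = h / 2); last by field.
  by rewrite subrr mul0r.
rewrite /grid_sum big_nat_recr//= -/(grid_sum sin h n.+1) IH.
have -> : (n.+1%:R - 2^-1) * h = n.+1%:R * h - h / 2 by ring.
have -> : (n.+2%:R - 2^-1) * h = n.+1%:R * h + h / 2.
  by rewrite -[n.+2%:R]natr1; field.
by rewrite !cosB cosD; field.
Qed.

Lemma sin_mesh_gt0 k : 0 < sin (mesh k.+1 : R).
Proof.
apply: sin_gt0_half; rewrite mesh_gt0 /=.
by have /andP[_] := @grid_point_bounds R k 1 (expn_gt0 2 k); rewrite mul1r.
Qed.

Lemma sin_power_sum1 k :
  sin_power_sum 1 k.+1 = cos (mesh k.+2) / sin (mesh k.+2) :> R.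
Proof.
rewrite /sin_power_sum.
have -> : grid_sum (fun x => sin x `^ 1) (mesh k.+1) (2 ^ k.+1) =
  grid_sum sin (mesh k.+1 : R) (2 ^ k.+1).
  rewrite /grid_sum big_nat_cond [RHS]big_nat_cond; apply: eq_bigr => j.
  rewrite andbT => /andP[j1 jk]; rewrite powRr1//; apply: sin_ge0_pi.
  have m0 := mesh_gt0 (R := R) k.+1.
  rewrite mulr_ge0 ?(ltW m0)//=.
  have -> : pi = (2 ^ k.+1)%:R * mesh k.+1 :> R.
    by rewrite /mesh natrX; field; rewrite expf_neq0.
  by rewrite ler_pM2r// ler_nat ltnW.
have s0 := sin_mesh_gt0 k.+1.
rewrite sin_grid_sum ?expn_gt0//; last by rewrite -meshS gt_eqF.
rewrite -meshS.
have -> : ((2 ^ k.+1)%:R - 2^-1) * mesh k.+1 = pi - mesh k.+2 :> R.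
  by rewrite /mesh natrX [2 ^+ k.+2]exprS; field; rewrite expf_neq0.
rewrite cosB cospi sinpi mul0r addr0 mulN1r opprK.
by field; rewrite gt_eqF.
Qed.

Lemma cvg_cos_mesh : (fun k => cos (mesh k.+2)) @ \oo --> (1 : R).
Proof.
rewrite -(@cos0 R).
apply: (@continuous_cvg _ _ _ _ _ (fun k => mesh k.+2) cos 0); first exact: continuous_cos.
have := mesh_cvg0 (R := R).
by rewrite -(cvg_shiftS mesh) -(cvg_shiftS [sequence mesh n.+1]_n).
Qed.

Lemma cvg_sin_mesh2 : (fun k => 2 ^+ k.+2 * sin (mesh k.+2)) @ \oo --> (pi : R).
Proof.
have := cvg_sin_mesh (R := R) ltr01.
rewrite -(cvg_shiftS (fun k => 2 ^+ k * sin (1 * mesh k))).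
rewrite -(cvg_shiftS [sequence 2 ^+ n.+1 * sin (1 * mesh n.+1)]_n) mul1r.
apply: cvg_trans; apply: near_eq_cvg; apply: nearW => k.
by rewrite /mk_sequence mul1r.
Qed.

Lemma sine_moment1 : sine_moment 1 = 2 / pi.
Proof.
have pi0 := pi_gt0 R.
apply/cvg_lim => //.
rewrite -(cvg_shiftS (fun k => sin_power_sum 1 k / 2 ^+ k)).
rewrite (_ : mk_sequence _ = (fun k => 2 * cos (mesh k.+2) *
   (2 ^+ k.+2 * sin (mesh k.+2))^-1)); last first.
  apply/funext => k; rewrite /mk_sequence sin_power_sum1 [2 ^+ k.+2]exprS.
  by field; rewrite expf_neq0//= gt_eqF// sin_mesh_gt0.
rewrite -[2 / pi]/(2 * pi^-1) -[X in X * _](mulr1 2).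
apply: cvgM.
  by apply: cvgM; [exact: cvg_cst|exact: cvg_cos_mesh].
by apply: cvgV; [rewrite gt_eqF|exact: cvg_sin_mesh2].
Qed.

Lemma sin_powR_between (r a x b : R) : 0 < a -> a <= x -> x <= b -> b <= pi / 2 ->
  `|sin a `^ r - sin x `^ r| <= `|sin b `^ r - sin a `^ r|.
Proof.
move=> a0 ax xb bp; have [c c1 cm] := sin_powR_monotone r.
have m1 := cm a x a0 ax (le_trans xb bp).
have m2 := cm x b (lt_le_trans a0 ax) xb bp.
have E u : `|u| = `|c * u| by rewrite normrM c1 mul1r.
rewrite E [X in _ <= X]E !mulrBr; move: m1 m2; clear.
set u := c * _; set v := c * _; set w := c * _ => m1 m2.
by rewrite ler0_norm ?ger0_norm; lra.
Qed.

Lemma sin_powR_variation (r : R) k :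
  \sum_(1 <= j < 2 ^ k) `|sin (j.+1%:R * mesh k.+1) `^ r - sin (j%:R * mesh k.+1) `^ r|
  <= `|1 - sin (mesh k.+1) `^ r|.
Proof.
have [c c1 cm] := sin_powR_monotone r.
have E u : `|u| = `|c * u| by rewrite normrM c1 mul1r.
apply: (@le_trans _ _ (\sum_(1 <= j < 2 ^ k) (c * (sin (j.+1%:R * mesh k.+1) `^ r)
   - c * (sin (j%:R * mesh k.+1) `^ r)))).
  rewrite big_nat_cond [X in _ <= X]big_nat_cond ler_sum// => j.
  rewrite andbT => /andP[j1 jk].
  have /andP[b1 b2] := @grid_point_bounds R k j ltac:(lia).
  have /andP[b3 b4] := @grid_point_bounds R k j.+1 ltac:(lia).
  have m0 := mesh_gt0 (R := R) k.+1.
  have m1 : c * (sin (j%:R * mesh k.+1) `^ r) <= c * (sin (j.+1%:R * mesh k.+1) `^ r).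
    by apply: cm; rewrite ?ler_pM2r ?ler_nat// (lt_le_trans m0).
  by rewrite E mulrBr ger0_norm// subr_ge0.
rewrite (telescope_sumr (fun j => c * (sin (j%:R * mesh k.+1) `^ r))) ?expn_gt0//.
rewrite mul1r mesh_half sin_pihalf powR1 -mulrBr.
by apply: le_trans (ler_norm _) _; rewrite normrM c1 mul1r.
Qed.

Definition sine_parts p x : R := sin x `^ (p + 1) * cos x.

Definition sine_parts' p x : R := (p + 1) * sin x `^ p - (p + 2) * sin x `^ (p + 2).

Lemma is_derive_sine_parts p x : 0 < x < pi ->
  is_derive x 1 (sine_parts p) (sine_parts' p x).
Proof.
move=> xp; have sx := sin_gt0_pi xp.
have h1 := is_derive_sin_power (p + 1) sx.
have h2 := is_derive_cos x.
apply: (is_derive_eq (is_deriveM h1 h2)); rewrite /sine_parts' /GRing.scale /=.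
have -> : p + 1 - 1 = p by ring.
have -> : sin x `^ (p + 1) = sin x `^ p * sin x.
  by rewrite powRD ?powRr1 ?(ltW sx)//; apply/implyP => _; rewrite gt_eqF.
have -> : sin x `^ (p + 2) = sin x `^ p * (1 - cos x ^+ 2).
  rewrite -sin2cos2 powRD ?(gt_eqF sx) ?implybT//.
  by rewrite -powR_mulrn// ltW.
have : sin x `^ p * sin x * - sin x = - sin x `^ p * (1 - cos x ^+ 2).
  by rewrite -sin2cos2; ring.
move=> ->; ring.
Qed.

Lemma sine_parts_step p (a b : R) : -1 < p -> 0 < a -> a < b -> b <= pi / 2 ->
  `|(b - a) * sine_parts' p a - (sine_parts p b - sine_parts p a)| <=
  (b - a) * ((p + 1) * `|sin b `^ p - sin a `^ p| +
             (p + 2) * `|sin b `^ (p + 2) - sin a `^ (p + 2)|).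
Proof.
move=> p1 a0 ab bp; have pi0 := pi_gt0 R.
have [|||x xab ->] := @MVT_segment _ (sine_parts p) (sine_parts' p) a b.
- exact: ltW.
- move=> x; rewrite in_itv /= => /andP[? ?]; apply: is_derive_sine_parts.
  by apply/andP; split; lra.
- apply: derivable_within_continuous => x.
  rewrite in_itv /= => /andP[? ?]; apply: ex_derive; apply: is_derive_sine_parts.
  by apply/andP; split; lra.
move: xab; rewrite in_itv /= => /andP[ax xb].
have b0 : 0 < b - a by lra.
rewrite mulrC -mulrBl normrM (gtr0_norm b0) mulrC ler_pM2l// /sine_parts'.
have h1 := sin_powR_between p a0 ax xb bp.
have h2 := sin_powR_between (p + 2) a0 ax xb bp.
rewrite (_ : _ - _ = (p + 1) * (sin a `^ p - sin x `^ p) -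
  (p + 2) * (sin a `^ (p + 2) - sin x `^ (p + 2))); last by ring.
apply: le_trans (ler_normB _ _) _; rewrite !normrM.
have n1 : 0 < p + 1 by lra. have n2 : 0 < p + 2 by lra.
by rewrite (gtr0_norm n1) (gtr0_norm n2); apply: lerD; rewrite ler_pM2l.
Qed.

(** The sum of [sine_parts'] times the mesh differs from the telescoping sum of
    the increments of [sine_parts] by the variations of the two powers. *)
Lemma sine_parts_sum_le p k : -1 < p ->
  `|\sum_(1 <= j < 2 ^ k) sine_parts' p (j%:R * mesh k.+1)| <=
  sin (mesh k.+1) `^ p + ((p + 1) * `|1 - sin (mesh k.+1) `^ p| + (p + 2) * `|1 - sin (mesh k.+1) `^ (p + 2)|).
Proof.
move=> p1; have h0 := mesh_gt0 (R := R) k.+1; set h := mesh k.+1 in h0 *.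
have hs : 0 < sin h := sin_mesh_gt0 k.
rewrite -(ler_pM2l h0) -[X in X * `|_|](gtr0_norm h0) -normrM mulrDr.
have gh : `|sine_parts p h| <= h * sin h `^ p.
  rewrite /sine_parts normrM; apply: (@le_trans _ _ (sin h `^ (p + 1) * 1)).
    by rewrite ger0_norm ?powR_ge0// ler_wpM2l ?powR_ge0// cos_max.
  rewrite mulr1 powRD ?powRr1 ?(ltW hs)//; last by apply/implyP => _; rewrite gt_eqF.
  by rewrite mulrC ler_wpM2r ?powR_ge0// sin_le_id// ltW.
have e : \sum_(1 <= j < 2 ^ k) (sine_parts p (j.+1%:R * h) - sine_parts p (j%:R * h))
    = - sine_parts p h.
  rewrite (telescope_sumr (fun j => sine_parts p (j%:R * h))) ?expn_gt0//.
  by rewrite mul1r mesh_half {1}/sine_parts cos_pihalf mulr0 sub0r.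
have -> : h * (\sum_(1 <= j < 2 ^ k) sine_parts' p (j%:R * h)) =
   \sum_(1 <= j < 2 ^ k) (h * sine_parts' p (j%:R * h) -
   (sine_parts p (j.+1%:R * h) - sine_parts p (j%:R * h))) - sine_parts p h.
  by rewrite [in RHS]sumrB e -mulr_sumr opprK addrK.
apply: le_trans (ler_normB _ _) _; rewrite addrC lerD//.
apply: le_trans (ler_norm_sum _ _ _) _.
apply: (@le_trans _ _ (\sum_(1 <= j < 2 ^ k)
   h * ((p + 1) * `|sin (j.+1%:R * h) `^ p - sin (j%:R * h) `^ p| +
     (p + 2) * `|sin (j.+1%:R * h) `^ (p + 2) - sin (j%:R * h) `^ (p + 2)|))).
  rewrite big_nat_cond [X in _ <= X]big_nat_cond ler_sum// => j.
  rewrite andbT => /andP[j1 jk].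
  have /andP[b1 b2] := @grid_point_bounds R k j ltac:(lia).
  have /andP[b3 b4] := @grid_point_bounds R k j.+1 ltac:(lia).
  have := @sine_parts_step p (j%:R * h) (j.+1%:R * h) p1.
  rewrite (_ : j.+1%:R * h - j%:R * h = h); last by rewrite -natr1; ring.
  by apply; rewrite ?ltr_pM2r ?ltr_nat// (lt_le_trans h0).
rewrite -mulr_sumr ler_pM2l// big_split -!mulr_sumr /=.
have n1 : 0 < p + 1 by lra. have n2 : 0 < p + 2 by lra.
by apply: lerD; rewrite ler_pM2l// sin_powR_variation.
Qed.

(** Discrete integration by parts: [(p + 1) sin^p - (p + 2) sin^(p + 2)] is the
    derivative of [sin^(p + 1) cos], which vanishes at both ends of the quarter
    circle, and the monotonicity of the two powers controls the difference
    between the sum of the derivative over the grid and the telescoping sum. *)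
Lemma sine_moment_recursion p : -1 < p ->
  (p + 1) * sine_moment p = (p + 2) * sine_moment (p + 2).
Proof.
move=> p1; have p2 : -1 < p + 2 by lra.
apply/eqP; rewrite -subr_eq0; apply/eqP.
have hl : (fun k => (p + 1) * (sin_power_sum p k / 2 ^+ k) -
     (p + 2) * (sin_power_sum (p + 2) k / 2 ^+ k)) @ \oo -->
     (p + 1) * sine_moment p - (p + 2) * sine_moment (p + 2).
  apply: cvgB; (apply: cvgM; first exact: cvg_cst); exact: cvg_sine_moment.
move: hl; rewrite -(cvg_shiftS (fun k => (p + 1) * _ - _)) => hl.
apply: (cvg_unique _ hl) => //.
have [A A1 hA] := sin_power_mesh_bound p.
have q2 := growth_lt2 p1; have q1 := growth_ge1 p.
set q := growth p in hA q1 q2.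
have A2 : 0 <= (p + 1) * A by rewrite mulr_ge0//; lra.
(* D * q ^ k bounds the sum of the derivative over the grid. *)
pose D : R := 1 + (p + 1) + (p + 2) + (p + 1) * A + A.
have D1 : 1 <= D by rewrite /D; lra.
apply: cvg_to0_near => eps eps0.
have hg : geometric (D * 4) (q / 2) @ \oo --> (0 : R).
  by apply: cvg_geometric; rewrite ger0_norm; lra.
have := near_le_of_cvg0 hg eps0; apply: filterS => k hk.
apply: le_trans hk; rewrite /geometric /= [X in _ <= X]ger0_norm; last first.
  by rewrite mulr_ge0// ?exprn_ge0//; lra.
have t2 : 0 < 2 ^+ k.+1 :> R by rewrite exprn_gt0.
have q1k : 1 <= q ^+ k by apply: exprn_ege1.
have hs := sin_mesh_gt0 k.
have S := sine_parts_sum_le k p1; move: S => /=; set S := \sum_(_ <= _ < _) _ => hS.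
have E : (p + 1) * (sin_power_sum p k.+1 / 2 ^+ k.+1) -
   (p + 2) * (sin_power_sum (p + 2) k.+1 / 2 ^+ k.+1) = (2 * S - 1) / 2 ^+ k.+1.
  rewrite !sin_power_sum_fold.
  have -> : S = (p + 1) * grid_sum (fun x => sin x `^ p) (mesh k.+1) (2 ^ k) -
    (p + 2) * grid_sum (fun x => sin x `^ (p + 2)) (mesh k.+1) (2 ^ k).
    by rewrite /S /grid_sum !mulr_sumr -sumrB.
  by ring.
rewrite E.
have tot : `|S| <= D * q ^+ k.
  apply: le_trans hS _.
  have fh0 := powR_ge0 (sin (mesh k.+1)) p.
  have fh := hA k.
  have fh2 := powR_ge0 (sin (mesh k.+1)) (p + 2).
  have fh3 : sin (mesh k.+1) `^ (p + 2) <= 1.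
    rewrite -[X in _ <= X](powRr0 (sin (mesh k.+1))).
    by apply: ger_powR; rewrite ?hs ?sin_le1//; lra.
  move: fh0 fh fh2 fh3; set x := sin _ `^ p; set y := sin _ `^ _ => fh0 fh fh2 fh3.
  have n1 : `|1 - x| <= 1 + x by rewrite ler_norml; apply/andP; split; lra.
  have n2 : `|1 - y| <= 1 by rewrite ler_norml; apply/andP; split; lra.
  have pp : 0 <= p + 1 by lra. have pp2 : 0 <= p + 2 by lra.
  have pp3 : 0 <= 1 + (p + 1) + (p + 2) by lra.
  have n3 := ler_wpM2l pp n1.
  have n4 := ler_wpM2l pp2 n2.
  have n5 := ler_wpM2l pp fh.
  have n6 := ler_wpM2l pp3 q1k.
  move: n3 n4 n5 n6 fh q1k; rewrite /D; set Q := q ^+ k; clear; lra.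
rewrite normrM normfV (gtr0_norm t2) ler_pdivrMr//.
apply: le_trans (ler_normB _ _) _; rewrite normr1 normrM (gtr0_norm (x := 2))//.
have -> : D * 4 * (q / 2) ^+ k * 2 ^+ k.+1 = 8 * (D * q ^+ k).
  by rewrite expr_div_n exprS; field; rewrite expf_neq0.
have : 1 <= D * q ^+ k by rewrite -[X in X <= _](mulr1 1); apply: ler_pM.
move: tot; clear; lra.
Qed.

End SineMoments.

(** * The Gamma function *)

Section GammaFunction.
Context {R : realType}.
Implicit Types (x t : R) (n : nat).

Local Notation mu := (@lebesgue_measure R).

Definition gamma_integrand x t : R := t `^ (x - 1) * expR (- t).

(** Compact windows exhausting the half-line, on which the integrand is
    continuous whatever the exponent. *)
Definition gamma_window n : set R := `[n.+2%:R^-1, n.+2%:R].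

Definition gamma_part x n : R :=
  \int[@lebesgue_measure R]_(t in gamma_window n) gamma_integrand x t.

Lemma gamma_window_gt0 n t : gamma_window n t -> 0 < t.
Proof.
by rewrite /gamma_window /= in_itv /= => /andP[+ _]; apply: lt_le_trans.
Qed.

Lemma gamma_window_bounds n : n.+2%:R^-1 < n.+2%:R :> R.
Proof.
by rewrite (@lt_trans _ _ 1)// ?invf_lt1 ?ltr1n// ltr0n.
Qed.

Lemma is_derive_gamma_integrand x t : 0 < t ->
  is_derive t 1 (fun t => - (t `^ x * expR (- t)))
    (gamma_integrand (x + 1) t - x * gamma_integrand x t).
Proof.
move=> t0; have h1 := is_derive1_powR x t0.
have h2 : is_derive t 1 (fun t : R => expR (- t)) (- expR (- t)).
  have := is_derive1_comp (is_derive_expR (- t)) (is_deriveN (is_derive_id t 1)).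
  by rewrite mulrN1.
apply: (is_derive_eq (is_deriveN (is_deriveM h1 h2))).
by rewrite /gamma_integrand /GRing.scale /= addrK; ring.
Qed.

Lemma continuous_gamma_integrand x t : 0 < t -> {for t, continuous (gamma_integrand x)}.
Proof.
move=> t0; have h := is_derive_gamma_integrand (x - 1) t0.
have hc : {for t, continuous (fun t => - (t `^ (x - 1) * expR (- t)))}.
  by apply: differentiable_continuous; apply/derivable1_diffP; apply: ex_derive; exact: h.
have -> : gamma_integrand x = (fun t => - - (t `^ (x - 1) * expR (- t))).
  by apply/funext => u; rewrite opprK.
exact: (cvgN hc).
Qed.

Lemma gamma_integrand_ge0 x t : 0 <= gamma_integrand x t.
Proof. by rewrite mulr_ge0 ?powR_ge0 ?expR_ge0. Qed.

Lemma continuous_within_window (f : R -> R) n :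
  (forall t, 0 < t -> {for t, continuous f}) ->
  {within gamma_window n, continuous f}.
Proof.
move=> fc; apply: continuous_in_subspaceT => t.
by rewrite inE => /gamma_window_gt0; exact: fc.
Qed.

Lemma integrable_gamma_window (f : R -> R) n :
  (forall t, 0 < t -> {for t, continuous f}) ->
  mu.-integrable (gamma_window n) (EFin \o f).
Proof.
move=> fc; apply: continuous_compact_integrable; first exact: segment_compact.
exact: continuous_within_window.
Qed.

Lemma integrable_gamma_part x n :
  mu.-integrable (gamma_window n) (EFin \o gamma_integrand x).
Proof.
by apply: integrable_gamma_window => t; exact: continuous_gamma_integrand.
Qed.

Lemma measurable_gamma_window n :
  measurable (gamma_window n : set (measurableTypeR R)).
Proof. exact: measurable_itv. Qed.

(** Integration by parts, by means of the antiderivative [- t `^ x * expR (- t)]. *)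
Lemma gamma_part_rec x n :
  gamma_part (x + 1) n - x * gamma_part x n =
  (n.+2%:R^-1) `^ x * expR (- n.+2%:R^-1) - n.+2%:R `^ x * expR (- n.+2%:R).
Proof.
have iG := integrable_gamma_part.
have mw := measurable_gamma_window.
pose F t : R := - (t `^ x * expR (- t)).
have FE t : 0 < t -> is_derive t 1 F
    (gamma_integrand (x + 1) t - x * gamma_integrand x t).
  exact: is_derive_gamma_integrand.
have Fc t : 0 < t -> {for t, continuous F}.
  move=> t0; apply: differentiable_continuous; apply/derivable1_diffP.
  by apply: ex_derive; exact: FE.
have n0 : 0 < n.+2%:R^-1 :> R by rewrite invr_gt0 ltr0n.
have iZ : mu.-integrable (gamma_window n) (EFin \o (fun t => x * gamma_integrand x t)).
  apply: integrable_gamma_window => t t0.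
  by apply: cvgM; [exact: cvg_cst|exact: continuous_gamma_integrand].
rewrite /gamma_part -(RintegralZl _ (mw n) (iG x n)) -(RintegralB (mw n) (iG _ n) iZ).
rewrite /Rintegral /gamma_window (@continuous_FTC2 _ _ F).
- by rewrite /= /F opprK addrC.
- exact: gamma_window_bounds.
- apply: continuous_within_window => t t0.
  apply: cvgB; first exact: continuous_gamma_integrand.
  by apply: cvgM; [exact: cvg_cst|exact: continuous_gamma_integrand].
- split.
  + move=> t; rewrite in_itv /= => /andP[t1 _]; apply: ex_derive; apply: FE.
    exact: lt_trans t1.
  + by apply: cvg_at_right_filter; exact: Fc.
  + by apply: cvg_at_left_filter; apply: Fc; rewrite ltr0n.
- move=> t; rewrite in_itv /= => /andP[t1 _]; rewrite derive1E.
  by have h := FE t (lt_trans n0 t1); rewrite derive_val.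
Qed.

Lemma le_gamma_part (f g : R -> R) n :
  (forall t, 0 < t -> {for t, continuous f}) ->
  (forall t, 0 < t -> {for t, continuous g}) ->
  (forall t, 0 < t -> f t <= g t) ->
  \int[mu]_(t in gamma_window n) f t <= \int[mu]_(t in gamma_window n) g t.
Proof.
move=> fc gc fg; apply: le_Rintegral; first exact: measurable_gamma_window.
- exact: integrable_gamma_window.
- exact: integrable_gamma_window.
- by move=> t /gamma_window_gt0; exact: fg.
Qed.

Lemma gamma_part_lin (a b x y : R) n :
  \int[mu]_(t in gamma_window n) (a * gamma_integrand x t + b * gamma_integrand y t)
  = a * gamma_part x n + b * gamma_part y n.
Proof.
have mw := measurable_gamma_window n.
have iZ c z : mu.-integrable (gamma_window n) (EFin \o (fun t => c * gamma_integrand z t)).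
  apply: integrable_gamma_window => t t0.
  by apply: cvgM; [exact: cvg_cst|exact: continuous_gamma_integrand].
rewrite (RintegralD mw (iZ a x) (iZ b y)).
by rewrite !(RintegralZl _ mw (integrable_gamma_part _ n)).
Qed.

Lemma gamma_part_le_lin (a b c x y z : R) n :
  (forall t, 0 < t -> c * t `^ (z - 1) <= a * t `^ (x - 1) + b * t `^ (y - 1)) ->
  c * gamma_part z n <= a * gamma_part x n + b * gamma_part y n.
Proof.
move=> h; have -> : c * gamma_part z n = c * gamma_part z n + 0 * gamma_part z n.
  by rewrite mul0r addr0.
rewrite -!gamma_part_lin; apply: le_gamma_part.
- move=> t t0; apply: cvgD; apply: cvgM; try exact: cvg_cst;
    exact: continuous_gamma_integrand.
- move=> t t0; apply: cvgD; apply: cvgM; try exact: cvg_cst;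
    exact: continuous_gamma_integrand.
- move=> t t0; rewrite mul0r addr0 /gamma_integrand.
  have := ler_wpM2r (expR_ge0 (- t)) (h t t0); lra.
Qed.

Lemma powR_expRN_le1 x t : 0 <= x <= 1 -> 0 < t -> t `^ x * expR (- t) <= 1.
Proof.
move=> /andP[x0 x1] t0; rewrite expRN ler_pdivrMr ?expR_gt0// mul1r.
apply: le_trans (expR_ge1Dx t).
have [t1|t1] := leP t 1.
  have : t `^ x <= 1 by rewrite -[X in _ <= X](powRr0 t); apply: ger_powR => //; rewrite t0.
  lra.
have : t `^ x <= t by rewrite -[X in _ <= X]powRr1 ?ler_powR// ltW.
lra.
Qed.

Definition gamma_bounded x := exists B, forall n, gamma_part x n <= B.

Lemma gamma_bounded1 : gamma_bounded 1.
Proof.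
exists 1 => n; have := gamma_part_rec 0 n.
rewrite add0r mul0r subr0 => ->; rewrite !powRr0 !mul1r.
have h : expR (- n.+2%:R^-1) <= 1 :> R by rewrite -[X in _ <= X]expR0 ler_expR oppr_le0 invr_ge0.
have := expR_ge0 (- n.+2%:R : R); lra.
Qed.

Lemma gamma_boundedS x : 0 < x -> gamma_bounded x -> gamma_bounded (x + 1).
Proof.
move=> x0 [B hB]; exists (x * B + 1) => n.
have := gamma_part_rec x n; have := ler_wpM2l (ltW x0) (hB n).
have : (n.+2%:R^-1) `^ x * expR (- n.+2%:R^-1) <= 1 :> R.
  rewrite -[X in _ <= X](mulr1 1); apply: ler_pM; rewrite ?powR_ge0 ?expR_ge0//.
    rewrite -[X in _ <= X](powRr0 (n.+2%:R^-1)); apply: ger_powR; last exact: ltW.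
    by rewrite invr_gt0 ltr0n invf_le1 ?ler1n.
have : 0 <= n.+2%:R `^ x * expR (- n.+2%:R) :> R by rewrite mulr_ge0 ?powR_ge0 ?expR_ge0.
lra.
Qed.

(** Near [0] the recursion is read backwards: [t `^ x <= 1 + t] bounds the value
    at [x + 1] by those at [1] and [2]. *)
Lemma gamma_bounded_le1 x : 0 < x <= 1 -> gamma_bounded x.
Proof.
move=> /andP[x0 x1]; have [B1 h1] := gamma_bounded1.
have [B2 h2] := gamma_boundedS ltr01 gamma_bounded1.
exists ((B1 + B2 + 1) / x) => n; rewrite ler_pdivlMr//.
have h3 : 1 * gamma_part (x + 1) n <= 1 * gamma_part 1 n + 1 * gamma_part (1 + 1) n.
  apply: gamma_part_le_lin => t t0; rewrite subrr powRr0 !addrK !mul1r powRr1 ?(ltW t0)//.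
  have [t1|t1] := leP t 1.
    have : t `^ x <= 1 by rewrite -[X in _ <= X](powRr0 t); apply: ger_powR; rewrite ?t0// ltW.
    lra.
  have : t `^ x <= t by rewrite -[X in _ <= X]powRr1 ?ler_powR// ltW.
  lra.
have h4 : n.+2%:R `^ x * expR (- n.+2%:R) <= 1 :> R.
  by apply: powR_expRN_le1; rewrite ?ltr0n// x1 ltW.
have h5 : 0 <= (n.+2%:R^-1) `^ x * expR (- n.+2%:R^-1) :> R.
  by rewrite mulr_ge0 ?powR_ge0 ?expR_ge0.
move: h3 h4 h5 (gamma_part_rec x n) (h1 n) (h2 n); rewrite !mul1r.
move: (_ `^ x * expR _) (_ `^ x * expR _) (gamma_part _ n) (gamma_part _ n).
move: (gamma_part _ n) (gamma_part _ n); clear => *; lra.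
Qed.

Lemma gamma_bounded_gt0 x : 0 < x -> gamma_bounded x.
Proof.
move=> x0; have [n hn] : exists n : nat, x <= n.+1%:R.
  have [n _ h] := nbhs_infty_ger x; exists n.
  by apply: le_trans (h n (leqnn n)) _; rewrite ler_nat.
elim: n x x0 hn => [|n IH] x x0 hn.
  by apply: gamma_bounded_le1; rewrite x0.
have [x1|x1] := leP x 1; first by apply: gamma_bounded_le1; rewrite x0.
rewrite -(subrK 1 x); apply: gamma_boundedS; first by rewrite subr_gt0.
by apply: IH; rewrite ?subr_gt0// lerBlDr natr1.
Qed.

Lemma bigcup_gamma_window : \bigcup_n gamma_window n = `]0, +oo[%classic.
Proof.
apply/seteqP; split => t.
  by move=> [n _ /gamma_window_gt0 t0] /=; rewrite in_itv /= andbT.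
rewrite /= in_itv /= andbT => t0.
have [n1 _ h1] := nbhs_infty_ger t; have [n2 _ h2] := nbhs_infty_ger t^-1.
exists (maxn n1 n2) => //; rewrite /gamma_window /= in_itv /=; apply/andP; split.
  rewrite -[t]invrK lef_pV2 ?posrE ?invr_gt0 ?ltr0n//; apply: h2.
  by rewrite /=; lia.
by apply: h1; rewrite /=; lia.
Qed.

(** Monotone convergence over the windows. *)
Lemma cvg_gamma_part x : 0 < x -> gamma_part x @ \oo --> Gamma x.
Proof.
move=> x0; have [B hB] := gamma_bounded_gt0 x0.
have eE n : (\int[mu]_(t in gamma_window n) (gamma_integrand x t)%:E)%E = (gamma_part x n)%:E.
  rewrite /gamma_part /Rintegral fineK//.
  apply: integrable_fin_num; first exact: measurable_gamma_window.
  exact: integrable_gamma_part.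
have hc : (gamma_part x n)%:E @[n --> \oo] -->
    (\int[mu]_(t in `]0%R, +oo[) (gamma_integrand x t)%:E)%E.
  under eq_fun do rewrite -eE.
  rewrite -bigcup_gamma_window; apply: ge0_nondecreasing_set_cvg_integral.
  - move=> n m nm; rewrite subsetEset => t; rewrite /gamma_window /= !in_itv /=.
    move=> /andP[t1 t2]; apply/andP; split.
      by apply: le_trans t1; rewrite lef_pV2 ?posrE ?ltr0n// ler_nat.
    by apply: (le_trans t2); rewrite ler_nat.
  - exact: measurable_gamma_window.
  - by move=> n; apply: (measurable_int mu (integrable_gamma_part x n)).
  - by move=> n t _; rewrite lee_fin gamma_integrand_ge0.
have fn : (\int[mu]_(t in `]0%R, +oo[) (gamma_integrand x t)%:E)%E \is a fin_num.
  rewrite ge0_fin_numE; last first.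
    by apply: integral_ge0 => t _; rewrite lee_fin gamma_integrand_ge0.
  apply: (@le_lt_trans _ _ B%:E); last exact: ltry.
  rewrite -(cvg_lim _ hc)//; apply: lime_le; first by apply/cvg_ex; eexists; exact: hc.
  by apply: nearW => n; rewrite lee_fin.
rewrite -(fineK fn) in hc.
exact: (fine_cvg hc).
Qed.

Lemma cvg_powR_expRN x : (fun n : nat => n.+2%:R `^ x * expR (- n.+2%:R) : R) @ \oo --> (0 : R).
Proof.
have [m _ hm] := nbhs_infty_ger x.
have {}hm : x <= m%:R := hm m (leqnn m).
apply: (@squeeze_cvgr _ _ _ _ (fun=> 0) (fun n => m.+1`!%:R * n.+1%:R^-1)).
- near=> n; rewrite mulr_ge0 ?powR_ge0 ?expR_ge0//=.
  have t0 : 0 < n.+2%:R :> R by rewrite ltr0n.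
  have h1 : n.+2%:R `^ x <= n.+2%:R ^+ m :> R.
    by rewrite -(powR_mulrn _ (ltW t0)) ler_powR// ler1n.
  have h2 := expR_ge1Dxn m (ltW t0).
  have f0 : 0 < m.+1`!%:R :> R by rewrite ltr0n fact_gt0.
  have h3 : n.+2%:R ^+ m.+1 / m.+1`!%:R <= expR n.+2%:R :> R by move: h2; lra.
  rewrite expRN ler_pdivrMr ?expR_gt0//; apply: le_trans h1 _.
  have h4 : n.+2%:R ^+ m * n.+1%:R <= n.+2%:R ^+ m.+1 :> R.
    by rewrite exprSr ler_wpM2l ?exprn_ge0 ?ltW// ltr_nat.
  have n0 : 0 < n.+1%:R :> R by rewrite ltr0n.
  rewrite mulrAC ler_pdivlMr//; apply: le_trans h4 _.
  by rewrite mulrC -ler_pdivrMr.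
- exact: cvg_cst.
- rewrite -[X in _ --> X](mulr0 (m.+1`!%:R)).
  by apply: cvgM; [exact: cvg_cst|exact: cvg_harmonic].
Unshelve. all: by end_near. Qed.

Lemma cvg_powR_inv x : 0 < x ->
  (fun n : nat => (n.+2%:R^-1) `^ x * expR (- n.+2%:R^-1) : R) @ \oo --> (0 : R).
Proof.
move=> x0; apply: cvg_to0_near => eps eps0.
have := cvg_powR_pinfty x0 => /cvgryPge/(_ eps^-1) [N _ hN].
exists N => // n /= Nn.
have h1 := hN n.+2 (leq_trans Nn (ltnW (ltnW (ltnSn _)))).
have p0 : 0 < n.+2%:R `^ x :> R by rewrite powR_gt0// ltr0n.
rewrite ger0_norm ?mulr_ge0 ?powR_ge0 ?expR_ge0//.
apply: (@le_trans _ _ ((n.+2%:R^-1) `^ x * 1)).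
  by rewrite ler_wpM2l ?powR_ge0// -[X in _ <= X]expR0 ler_expR oppr_le0 invr_ge0.
rewrite mulr1 -powR_inv1// -powRrM mulN1r powRN -[eps]invrK.
by rewrite lef_pV2 ?posrE ?invr_gt0.
Qed.

Lemma Gamma_rec x : 0 < x -> Gamma (x + 1) = x * Gamma x.
Proof.
move=> x0; apply/eqP; rewrite -subr_eq0; apply/eqP.
have h1 : (fun n => gamma_part (x + 1) n - x * gamma_part x n) @ \oo -->
   Gamma (x + 1) - x * Gamma x.
  apply: cvgB; first by apply: cvg_gamma_part; rewrite addr_gt0.
  by apply: cvgM; [exact: cvg_cst|exact: cvg_gamma_part].
have e : (fun n => gamma_part (x + 1) n - x * gamma_part x n) =
  (fun n => (n.+2%:R^-1) `^ x * expR (- n.+2%:R^-1) - n.+2%:R `^ x * expR (- n.+2%:R)).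
  by apply/funext => n; rewrite gamma_part_rec.
have h2 := cvgB (cvg_powR_inv x0) (cvg_powR_expRN x).
rewrite e in h1; rewrite subr0 in h2.
by apply: (cvg_unique _ h1) => //; exact: h2.
Qed.

Lemma Gamma_gt0 x : 0 < x -> 0 < Gamma x.
Proof.
move=> x0; pose c : R := Num.min 1 (2 `^ (x - 1)) * expR (- 2).
have m0 : 0 < Num.min 1 (2 `^ (x - 1)) :> R by rewrite lt_min ltr01 powR_gt0.
have c0 : 0 < c by rewrite mulr_gt0// expR_gt0.
apply: (@lt_le_trans _ _ c) => //.
have h : (fun n => c) @ \oo --> c by exact: cvg_cst.
apply: (ler_cvg_to h (cvg_gamma_part x0)); apply: nearW => n.
have mw := measurable_gamma_window.
have e1 : \int[mu]_(t in `[1%R, 2%R]) c = c.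
  rewrite Rintegral_cst ?measurable_itv//= lebesgue_measure_itv /= lte_fin ltr1n /=.
  by rewrite (_ : 1 + 1 - 1 = 1 :> R) ?mulr1//; ring.
have sub : `[1%R : R, 2%R]%classic `<=` gamma_window n.
  move=> t; rewrite /gamma_window /= !in_itv /= => /andP[t1 t2]; apply/andP; split.
    by apply: le_trans t1; rewrite invf_le1 ?ler1n// ltr0n.
  by apply: (le_trans t2); rewrite ler_nat.
have i1 : mu.-integrable `[1%R, 2%R] (EFin \o gamma_integrand x).
  exact: integrableS (integrable_gamma_part x n).
rewrite -{1}e1; apply: (@le_trans _ _ (\int[mu]_(t in `[1%R, 2%R]) gamma_integrand x t)).
  apply: le_Rintegral => //.
    apply: continuous_compact_integrable; first exact: segment_compact.
    by apply: continuous_subspaceT => t; exact: cvg_cst.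
  move=> t; rewrite /= in_itv /= => /andP[t1 t2]; rewrite /c /gamma_integrand.
  apply: ler_pM; rewrite ?(ltW m0) ?expR_ge0 ?ler_expR ?lerN2//.
  have t0 : 0 < t by apply: lt_le_trans t1.
  have [x1|x1] := leP 0 (x - 1).
    apply: (@le_trans _ _ 1); first by rewrite ge_min lexx.
    by rewrite -[X in X <= _](powRr0 t) ler_powR.
  apply: (@le_trans _ _ (2 `^ (x - 1))); first by rewrite ge_min lexx orbT.
  by apply: powR_le_neg => //; exact: ltW.
rewrite /gamma_part /Rintegral fine_le//.
- by apply: integrable_fin_num.
- by apply: integrable_fin_num => //; exact: integrable_gamma_part.
- apply: ge0_subset_integral => //.
    by apply: (measurable_int mu (integrable_gamma_part x n)).
  by move=> t _; rewrite lee_fin gamma_integrand_ge0.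
Qed.

(** Integrating [2 sqrt t <= l + t / l]: the special case of log-convexity that
    locates [Gamma (x + 1 / 2)] between its neighbours. *)
Lemma Gamma_half_le x (l : R) : 0 < x -> 0 < l ->
  2 * Gamma (x + 2^-1) <= l * Gamma x + l^-1 * Gamma (x + 1).
Proof.
move=> x0 l0.
have h1 : (fun n => 2 * gamma_part (x + 2^-1) n) @ \oo --> 2 * Gamma (x + 2^-1).
  apply: cvgM; first exact: cvg_cst.
  by apply: cvg_gamma_part; rewrite addr_gt0.
have h2 : (fun n => l * gamma_part x n + l^-1 * gamma_part (x + 1) n) @ \oo -->
   l * Gamma x + l^-1 * Gamma (x + 1).
  apply: cvgD; (apply: cvgM; first exact: cvg_cst).
    exact: cvg_gamma_part.
  by apply: cvg_gamma_part; rewrite addr_gt0.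
apply: (ler_cvg_to h1 h2); apply: nearW => n.
apply: gamma_part_le_lin => t t0.
have u0 : 0 < t `^ 2^-1 by rewrite powR_gt0.
have e1 : t `^ (x + 2^-1 - 1) = t `^ (x - 1) * t `^ 2^-1.
  rewrite -powRD; last by apply/implyP => _; rewrite gt_eqF.
  by congr (_ `^ _); ring.
have e2 : t `^ (x + 1 - 1) = t `^ (x - 1) * (t `^ 2^-1) ^+ 2.
  rewrite -powR_mulrn ?ltW// -powRrM mulVf// powRr1 ?ltW//.
  by rewrite mulrC mulr_powRB1 ?addrK// ltW.
rewrite e1 e2; set u := t `^ 2^-1; set v := t `^ (x - 1).
have v0 : 0 <= v by apply: powR_ge0.
have k : 2 * u <= l + l^-1 * u ^+ 2.
  have : 0 <= l^-1 * (u - l) ^+ 2 by rewrite mulr_ge0 ?invr_ge0 ?sqr_ge0// ltW.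
  have -> : l^-1 * (u - l) ^+ 2 = l^-1 * u ^+ 2 - 2 * u + l by field; rewrite gt_eqF.
  lra.
have := ler_wpM2l v0 k; lra.
Qed.

End GammaFunction.

(** * The energy of the uniform measure *)

Section CircleEnergy.
Context {R : realType}.
Implicit Types (p x : R) (n : nat).
Local Opaque Gamma sine_moment.

Lemma archimedean_le0 (a b : R) (N : nat) :
  (forall n, (N <= n)%N -> a * n%:R <= b) -> a <= 0.
Proof.
move=> h; rewrite leNgt; apply/negP => a0.
have [m _ hm] := nbhs_infty_ger (b / a + 1).
have h1 := h (maxn N m) (leq_maxl _ _).
have h2 : b / a + 1 <= (maxn N m)%:R by apply: hm => /=; rewrite leq_maxr.
have := ler_wpM2l (ltW a0) h2; rewrite mulrDr mulrCA mulfV ?gt_eqF// mulr1.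
lra.
Qed.

Lemma sine_moment_ge0 p : -1 < p -> 0 <= sine_moment p.
Proof.
move=> p1; have h : (fun n : nat => 0 : R) @ \oo --> (0 : R) by exact: cvg_cst.
apply: (ler_cvg_to h (cvg_sine_moment p1)); apply: nearW => k.
rewrite divr_ge0 ?exprn_ge0// /sin_power_sum /grid_sum.
by apply: sumr_ge0 => j _; exact: powR_ge0.
Qed.

(** By the recursion this product has period one, and the monotonicity of
    [sine_moment] then makes it constant. *)
Definition moment_product p : R := (p + 1) * (sine_moment p * sine_moment (p + 1)).

Lemma moment_product_shift p n : -1 < p ->
  moment_product (p + n%:R) = moment_product p.
Proof.
move=> p1; elim: n => [|n IH]; first by rewrite addr0.
have pn : -1 < p + n%:R by rewrite ltr_wpDr.
rewrite -IH -natr1 addrA /moment_product.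
set q := p + n%:R in pn *.
have := sine_moment_recursion pn.
rewrite (_ : q + 1 + 1 = q + 2); last by ring.
by move=> e; rewrite mulrCA -e; ring.
Qed.

Lemma moment_product_nat n : moment_product n%:R = 2 / pi.
Proof.
have -> : n%:R = 0 + n%:R :> R by rewrite add0r.
rewrite moment_product_shift ?ltrN10// /moment_product add0r.
by rewrite sine_moment0 sine_moment1 !mul1r.
Qed.

(** The product at [q] is squeezed between its values at two consecutive
    integers, up to the ratio of the factors [q + 1]. *)
Lemma moment_product_bounds (q : R) n : n%:R <= q <= n.+1%:R ->
  moment_product q * n.+1%:R <= (2 / pi) * n.+2%:R /\
  (2 / pi) * n.+1%:R <= moment_product q * n.+2%:R.
Proof.
move=> /andP[nq qn].
have n0 : 0 <= n%:R :> R by [].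
have N1 : n.+1%:R = n%:R + 1 :> R by rewrite natr1.
have N2 : n.+2%:R = n.+1%:R + 1 :> R by rewrite natr1.
have q1 : 0 <= q + 1 by lra.
have q2 : q + 1 <= n.+2%:R by lra.
have q3 : n.+1%:R <= q + 1 by lra.
have p0 : -1 < n%:R :> R by lra.
have p1 : -1 < n.+1%:R :> R by lra.
have p2 : -1 < n.+2%:R :> R by lra.
have p3 : -1 < q by lra.
have p4 : -1 < q + 1 by lra.
have q4 : q + 1 <= n.+1%:R + 1 by lra.
have m1 := sine_moment_antitone p0 nq.
have m2 : sine_moment (q + 1) <= sine_moment n.+1%:R.
  by apply: sine_moment_antitone => //; rewrite N1.
have m3 := sine_moment_antitone p3 qn.
have m4 : sine_moment n.+2%:R <= sine_moment (q + 1).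
  by apply: sine_moment_antitone => //; rewrite N2.
have z1 := sine_moment_ge0 p3.
have z2 := sine_moment_ge0 p4.
have z3 := sine_moment_ge0 p1.
have z4 := sine_moment_ge0 p2.
have e1 := moment_product_nat n; have e2 := moment_product_nat n.+1.
rewrite /moment_product -N1 -N2 in e1 e2 *.
have s1 := ler_pM z1 z2 m1 m2; have s2 := ler_pM z3 z4 m3 m4.
have t1 := ler_pM q1 (mulr_ge0 z1 z2) q2 s1.
have t2 := ler_pM (ler0n R n.+1) (mulr_ge0 z3 z4) q3 s2.
have t3 := ler_wpM2r (ler0n R n.+1) t1.
have t4 := ler_wpM2r (ler0n R n.+2) t2.
move: e1 e2 t3 t4; clear.
set a := _ * sine_moment (q + 1); set b := _ * sine_moment _; set c := _ * sine_moment _.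
move=> <- e2 t3 t4; split; first by move: t3; clear; lra.
by rewrite -e2; move: t4; clear; lra.
Qed.

Lemma moment_product_cst p : -1 < p -> moment_product p = 2 / pi.
Proof.
move=> p1; have pi0 := pi_gt0 R; set h := moment_product p.
have t0 : 0 < 2 / pi :> R by rewrite divr_gt0.
have bounds k : (1 <= k)%N -> exists2 n, (k <= n.+1)%N &
    h * n.+1%:R <= (2 / pi) * n.+2%:R /\ (2 / pi) * n.+1%:R <= h * n.+2%:R.
  move=> k1; pose q := p + k%:R.
  have k1R : 1 <= k%:R :> R by rewrite ler1n.
  have q0 : 0 <= q by rewrite /q; lra.
  have /andP[nq qn] := truncn_itv q0; set n := Num.truncn q in nq qn.
  exists n.
    by rewrite -ltnS -(ltr_nat R) -[n.+2%:R]natr1; move: qn; rewrite /q; lra.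
  rewrite /h -(moment_product_shift k p1); apply: moment_product_bounds.
  by rewrite nq ltW.
apply/eqP; rewrite eq_le; apply/andP; split.
- rewrite -subr_le0; apply: (@archimedean_le0 _ (2 / pi) 1) => k k1.
  have [n kn [h1 _]] := bounds k k1.
  have [hle|hgt] := leP (h - 2 / pi) 0.
    apply: (@le_trans _ _ 0); last exact: ltW.
    by rewrite mulr_le0_ge0.
  apply: (@le_trans _ _ ((h - 2 / pi) * n.+1%:R)).
    by rewrite ler_wpM2l ?(ltW hgt)// ler_nat.
  by move: h1; rewrite -[n.+2%:R]natr1; lra.
- rewrite -subr_le0; apply: (@archimedean_le0 _ h 1) => k k1.
  have [n kn [_ h1]] := bounds k k1.
  have h0 : 0 <= h.
    rewrite /h /moment_product; rewrite !mulr_ge0 ?sine_moment_ge0//; lra.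
  have [hle|hgt] := leP (2 / pi - h) 0.
    apply: (@le_trans _ _ 0) => //.
    by rewrite mulr_le0_ge0.
  apply: (@le_trans _ _ ((2 / pi - h) * n.+1%:R)).
    by rewrite ler_wpM2l ?(ltW hgt)// ler_nat.
  by move: h1; rewrite -[n.+2%:R]natr1; lra.
Qed.

Lemma Gamma_half_sqr_le x : 0 < x -> Gamma (x + 2^-1) ^+ 2 <= x * Gamma x ^+ 2.
Proof.
move=> x0; have r0 : 0 < Num.sqrt x by rewrite sqrtr_gt0.
have y0 : 0 < x + 2^-1 by rewrite addr_gt0.
have := Gamma_half_le x0 r0; rewrite (Gamma_rec x0).
move: (Gamma_gt0 x0) (Gamma_gt0 y0).
have e : x = Num.sqrt x ^+ 2 by rewrite sqr_sqrtr// ltW.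
move: (Gamma x) (Gamma (x + 2^-1)) => a b a0 b0.
have -> : (Num.sqrt x)^-1 * (x * a) = Num.sqrt x * a.
  by rewrite [X in _ * (X * _)]e; field; rewrite gt_eqF.
move=> h; rewrite [X in _ <= X * _]e -exprMn ler_sqr ?nnegrE ?(ltW b0)//; first by lra.
by rewrite mulr_ge0 ?ltW.
Qed.

Lemma Gamma_half_sqr_ge x : 0 < x ->
  x ^+ 2 * Gamma x ^+ 2 <= (x + 2^-1) * Gamma (x + 2^-1) ^+ 2.
Proof.
move=> x0; have y0 : 0 < x + 2^-1 by rewrite addr_gt0.
have := Gamma_half_sqr_le y0.
rewrite (_ : x + 2^-1 + 2^-1 = x + 1); last by field.
by rewrite (Gamma_rec x0) exprMn.
Qed.

(** Quotient of the two functions that solve the recursion of the moments. *)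
Definition moment_ratio p : R :=
  sine_moment p * Gamma (p / 2 + 1) / Gamma ((p + 1) / 2).

Lemma Gamma_moment_gt0 p : -1 < p ->
  0 < Gamma (p / 2 + 1) /\ 0 < Gamma ((p + 1) / 2).
Proof. by move=> p1; split; apply: Gamma_gt0; lra. Qed.

Lemma moment_ratio_step q : -1 < q -> moment_ratio (q + 2) = moment_ratio q.
Proof.
move=> q1.
have x1 : 0 < q / 2 + 1 by lra.
have x2 : 0 < (q + 1) / 2 by lra.
have x3 : q + 1 != 0 by rewrite gt_eqF//; lra.
have x4 : q + 2 != 0 by rewrite gt_eqF//; lra.
have [G1 G2] := Gamma_moment_gt0 q1.
rewrite /moment_ratio.
have -> : (q + 2) / 2 + 1 = (q / 2 + 1) + 1 by field.
have -> : (q + 2 + 1) / 2 = (q + 1) / 2 + 1 by field.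
rewrite (Gamma_rec x1) (Gamma_rec x2).
have := sine_moment_recursion q1; move: G1 G2 x3 x4; clear.
move: (Gamma _) (Gamma _) (sine_moment q) (sine_moment (q + 2)) => A B m m' A0 B0 x3 x4 e.
have -> : m' = (q + 1) * m / (q + 2) by rewrite e; field.
by field; rewrite x4 gt_eqF//= x3.
Qed.

Lemma moment_ratio_shift p n : -1 < p ->
  moment_ratio (p + (2 * n)%:R) = moment_ratio p.
Proof.
move=> p1; elim: n => [|n IH]; first by rewrite muln0 addr0.
by rewrite -IH mulnS natrD addrCA addrC moment_ratio_step ?ltr_wpDr.
Qed.

Fact moment_ratio_arith (q m A B P : R) : 0 < q + 1 -> 0 <= q + 2 ->
  0 <= A -> 0 < B -> 2 <= P * ((q + 1) * m) -> P * (q * m) <= 2 ->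
  A <= (q + 1) / 2 * B -> ((q + 1) / 2) ^+ 2 * B <= (q / 2 + 1) * A ->
  P * (m * A / B) * q <= q + 1 /\ q + 1 <= P * (m * A / B) * (q + 2).
Proof.
move=> q1 q2 A0 B0 a1 a2 g1 g2; split.
  rewrite (_ : P * _ * q = (P * (q * m)) * A / B); last by ring.
  rewrite ler_pdivrMr//.
  have := ler_wpM2r A0 a2; move: g1; clear; lra.
rewrite (_ : P * _ * (q + 2) = (P * m * (q + 2)) * A / B); last by ring.
rewrite ler_pdivlMr// -(ler_pM2l q1).
have h1 := ler_wpM2r (mulr_ge0 q2 A0) a1.
by move: g2 h1; clear; lra.
Qed.

(** Consecutive moments have product [2 / (pi * (q + 1))] and are ordered, which
    locates the square of each; [Gamma_half_sqr_le] and [Gamma_half_sqr_ge] do the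
    same for the Gamma values. *)
Lemma moment_ratio_bounds q : 0 < q ->
  pi * moment_ratio q ^+ 2 * q <= q + 1 /\
  q + 1 <= pi * moment_ratio q ^+ 2 * (q + 2).
Proof.
move=> q0; have pi0 := pi_gt0 R; have q1 : -1 < q by lra.
have q2 : -1 < q - 1 by lra.
have q3 : 0 < q + 1 by lra.
have q4 : q <= q + 1 by lra.
have q5 : q - 1 <= q by lra.
have q6 : 0 <= q + 2 by lra.
have x0 : 0 < (q + 1) / 2 by lra.
have g1 := Gamma_half_sqr_le x0; have g2 := Gamma_half_sqr_ge x0.
rewrite (_ : (q + 1) / 2 + 2^-1 = q / 2 + 1) in g1 g2; last by field.
have m0 := sine_moment_ge0 q1.
have ma := sine_moment_antitone q1 q4.
have mb := sine_moment_antitone q2 q5.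
have e1 := moment_product_cst q1; have e2 := moment_product_cst q2.
rewrite /moment_product in e1 e2; rewrite !subrK in e2.
have e3 : 2 = pi * (2 / pi) :> R by rewrite mulrCA mulfV ?mulr1// gt_eqF.
have a1 : 2 <= pi * ((q + 1) * sine_moment q ^+ 2).
  rewrite [X in X <= _]e3 -e1 (ler_pM2l pi0) (ler_pM2l q3).
  by rewrite expr2 ler_wpM2l.
have a2 : pi * (q * sine_moment q ^+ 2) <= 2.
  rewrite [X in _ <= X]e3 -e2 (ler_pM2l pi0) (ler_pM2l q0).
  by rewrite expr2 ler_wpM2r.
have [_ G2] := Gamma_moment_gt0 q1.
have Gx := exprn_gt0 2 G2.
rewrite /moment_ratio expr_div_n exprMn.
exact: (moment_ratio_arith q3 q6 (sqr_ge0 _) Gx a1 a2 g1 g2).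
Qed.

Lemma sqr_moment_ratio p : -1 < p -> pi * moment_ratio p ^+ 2 = 1.
Proof.
move=> p1; have y0 : 0 <= pi * moment_ratio p ^+ 2.
  by rewrite mulr_ge0 ?sqr_ge0 ?pi_ge0.
have bounds n : (1 <= n)%N ->
    pi * moment_ratio p ^+ 2 * (p + 2 * n%:R) <= p + 2 * n%:R + 1 /\
    p + 2 * n%:R + 1 <= pi * moment_ratio p ^+ 2 * (p + 2 * n%:R + 2).
  move=> n1; have n1R : 1 <= n%:R :> R by rewrite ler1n.
  have q0 : 0 < p + (2 * n)%:R by rewrite natrM; lra.
  by have := moment_ratio_bounds q0; rewrite moment_ratio_shift// natrM.
move: y0 bounds; set y := pi * _ => y0 bounds.
have k1 := ler_norm (- (y * p)); have k2 := ler_norm p.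
have k3 := ler_norm (y * p); have k4 := ler_norm (- p); rewrite !normrN in k1 k4.
have k5 := normr_ge0 p; have k6 := normr_ge0 (y * p).
apply/eqP; rewrite eq_le; apply/andP; split.
  rewrite -subr_le0; apply: (@archimedean_le0 _ (1 + `|y * p| + `|p|) 1) => n n1.
  have [h _] := bounds _ n1.
  by move: k1 k2 k5 k6 h; clear; lra.
rewrite -subr_le0; apply: (@archimedean_le0 _ (`|y * p| + `|p| + 2 * y) 1) => n n1.
have [_ h] := bounds _ n1.
by move: y0 k3 k4 k5 k6 h; clear; lra.
Qed.

(** The ratio has period two, and its square tends to [pi^-1] along the period. *)
Lemma sine_moment_Gamma p : -1 < p ->
  sine_moment p = (Num.sqrt pi)^-1 * (Gamma ((p + 1) / 2) / Gamma (p / 2 + 1)).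
Proof.
move=> p1; have pi0 := pi_gt0 R.
have [G1 G2] := Gamma_moment_gt0 p1.
have r0 : 0 <= moment_ratio p.
  have m0 := sine_moment_ge0 p1.
  by apply: divr_ge0; [apply: mulr_ge0; [exact: m0|exact: ltW G1]|exact: ltW G2].
have <- : moment_ratio p = (Num.sqrt pi)^-1.
  apply/eqP; rewrite -(eqrXn2 (n := 2)) ?invr_ge0 ?sqrtr_ge0//.
  rewrite exprVn sqr_sqrtr ?(ltW pi0)//; apply/eqP.
  by apply: (mulfI (x := pi)); rewrite ?gt_eqF// sqr_moment_ratio// mulfV// gt_eqF.
rewrite /moment_ratio; move: G1 G2; clear.
move: (Gamma _) (Gamma _) => A B A0 B0.
by field; rewrite !gt_eqF.
Qed.

Lemma circle_energy_sine_moment (s : R) : s < 1 ->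
  circle_energy s = 2 `^ (- s) * sine_moment (- s).
Proof.
move=> s1; have s2 : -1 < - s by rewrite ltrN2.
have e1 : (1 - s) / 2 = (- s + 1) / 2 by rewrite addrC.
have e2 : 1 - s / 2 = - s / 2 + 1 by rewrite addrC mulNr.
by rewrite (sine_moment_Gamma s2) /circle_energy e1 e2 -[LHS]mulrA.
Qed.

End CircleEnergy.

(** * The kernel in the half-angle variable *)

Section Kernel.
Context {R : realType}.
Implicit Types (s x y t r : R) (k j n m : nat).

Definition riesz_radial s r : R := if s == 0 then - ln r else r `^ (- s).

(** Two points with arguments [2 * x] and [2 * y] are at distance
    [2 * `|sin (x - y)|]; this is the kernel in terms of [x - y]. *)
Definition chord_kernel s x : R := riesz_radial s (2 * `|sin x|).

(** Greedy points maximize the sums of the kernel when [s < 0]; with this sign they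
    minimize in all cases. *)
Definition repulsion s x : R :=
  if 0 <= s then chord_kernel s x else - chord_kernel s x.

Definition signed_radial s r : R :=
  if 0 <= s then riesz_radial s r else - riesz_radial s r.

Lemma repulsionE s x : repulsion s x = signed_radial s (2 * `|sin x|).
Proof. by []. Qed.

Lemma repulsionDpi s x : repulsion s (x + pi) = repulsion s x.
Proof. by rewrite !repulsionE sinDpi normrN. Qed.

Lemma repulsionN s x : repulsion s (- x) = repulsion s x.
Proof. by rewrite !repulsionE sinN normrN. Qed.

Lemma signed_radial_decreasing s r r' : (0 <= s -> 0 < r) -> 0 <= r -> r < r' ->
  signed_radial s r' < signed_radial s r.
Proof.
move=> rs r0 rr'; have r'0 := le_lt_trans r0 rr'.
rewrite /signed_radial /riesz_radial; case: (ltgtP s 0) rs => [s0 _|s0 rs|s0 rs].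
- by rewrite ltrN2 gt0_ltr_powR ?nnegrE ?oppr_gt0// ltW.
- have rp := rs isT; rewrite !powRN ltf_pV2 ?posrE ?powR_gt0//.
  by rewrite gt0_ltr_powR ?nnegrE// ltW.
- have rp := rs isT; by rewrite ltrN2 ltr_ln ?posrE.
Qed.

Lemma ler_sqr_mean (a b : R) : a * b <= ((a + b) / 2) ^+ 2.
Proof.
rewrite -subr_ge0 (_ : _ - _ = ((a - b) / 2) ^+ 2) ?sqr_ge0//; by field.
Qed.

(** For [s < 0] this is the concavity of [r `^ (- s)], whose exponent is at most
    one; for [0 <= s] it follows from the inequality of the arithmetic and
    geometric means. *)
Lemma signed_radial_convex s a b : -1 <= s ->
  (0 <= s -> 0 < a /\ 0 < b) -> 0 <= a -> 0 <= b ->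
  2 * signed_radial s ((a + b) / 2) <= signed_radial s a + signed_radial s b.
Proof.
move=> s1 ab a0 b0; set c := (a + b) / 2.
have c0 : 0 <= c by rewrite divr_ge0// addr_ge0.
rewrite /signed_radial /riesz_radial; case: (ltgtP s 0) ab => [s0 _|s0 ab|s0 ab].
- rewrite -opprD mulrN lerN2.
  have p0 : 0 < - s by rewrite oppr_gt0.
  have np : - s != 0 by rewrite gt_eqF.
  have q1 : 1 <= (- s)^-1 by rewrite -[X in X <= _]invr1 lef_pV2 ?posrE//; lra.
  set A := a `^ (- s); set B := b `^ (- s).
  have A0 : 0 <= A by apply: powR_ge0.
  have B0 : 0 <= B by apply: powR_ge0.
  have key : ((A + B) / 2) `^ (- s)^-1 <= c.
    have h0 : 0 <= 2^-1 :> R by rewrite invr_ge0.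
    have h1 : 2^-1 <= 1 :> R by lra.
    have mem z : 0 <= z -> (z : R) \in (`[0, +oo[%classic : set R).
      by move=> z0; rewrite inE /= in_itv /= z0.
    have h := @convex_powR R _ q1 (Itv01 h0 h1) A B (mem _ A0) (mem _ B0).
    rewrite convRE [X in X `^ _ <= _]convRE /= /unstable.onem in h.
    have eA : A `^ (- s)^-1 = a by rewrite -powRrM mulfV// powRr1.
    have eB : B `^ (- s)^-1 = b by rewrite -powRrM mulfV// powRr1.
    have e2 : 1 - 2^-1 = 2^-1 :> R by field.
    rewrite eA eB e2 in h.
    by rewrite /c -!(mulrC 2^-1) !mulrDr.
  have := powR_le_pos (powR_ge0 _ _) key (ltW p0).
  rewrite -powRrM mulVf// powRr1; last by rewrite divr_ge0// addr_ge0.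
  lra.
- have [a1 b1] := ab isT.
  have c1 : 0 < c by rewrite divr_gt0// addr_gt0.
  pose f r : R := r `^ (- (s / 2)).
  have fE r : r `^ (- s) = f r ^+ 2.
    rewrite /f -powR_mulrn ?powR_ge0// -powRrM; congr (_ `^ _); by field.
  have h1 : f c ^+ 2 <= f a * f b.
    rewrite -fE -powRM//.
    have -> : c `^ (- s) = (c ^+ 2) `^ (- (s / 2)).
      by rewrite -powR_mulrn// -powRrM; congr (_ `^ _); field.
    apply: powR_le_neg; [by rewrite mulr_gt0|exact: ler_sqr_mean|].
    by rewrite oppr_le0 divr_ge0// ltW.
  have h2 : 2 * (f a * f b) <= f a ^+ 2 + f b ^+ 2.
    have := sqr_ge0 (f a - f b); rewrite sqrrB -mulr_natl; lra.
  rewrite !fE; lra.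
- have [a1 b1] := ab isT.
  have c1 : 0 < c by rewrite divr_gt0// addr_gt0.
  rewrite -opprD mulrN lerN2 -lnM ?posrE// mulr_natl -lnXn//.
  by rewrite ler_ln ?posrE; [exact: ler_sqr_mean|exact: mulr_gt0|exact: exprn_gt0].
Qed.

(** The mean of [sin x] and [sin y] is strictly below the sine of the mean, and the
    radial kernel is decreasing and convex. *)
Lemma repulsion_convex s x y : -1 <= s -> x != y ->
  0 <= x <= pi -> 0 <= y <= pi -> (0 <= s -> 0 < sin x /\ 0 < sin y) ->
  2 * repulsion s ((x + y) / 2) < repulsion s x + repulsion s y.
Proof.
move=> s1; wlog xy : x y / x < y.
  move=> H nxy hx hy hs; move: (nxy); rewrite neq_lt => /orP[lt|lt]; first exact: H.
  rewrite addrC [X in _ < X]addrC; apply: H => //; first by rewrite eq_sym.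
  by move=> /hs[].
move=> _ /andP[x0 xp] /andP[y0 yp] hs.
have sx : 0 <= sin x by rewrite sin_ge0_pi ?x0.
have sy : 0 <= sin y by rewrite sin_ge0_pi ?y0.
set m := (x + y) / 2.
have sm : 0 < sin m by rewrite sin_gt0_pi// /m; apply/andP; split; lra.
have e : sin x + sin y = 2 * (sin m * cos ((y - x) / 2)).
  have -> : sin x = sin (m - (y - x) / 2) by congr sin; rewrite /m; field.
  have -> : sin y = sin (m + (y - x) / 2) by congr sin; rewrite /m; field.
  by rewrite sinB sinD; ring.
have cl : cos ((y - x) / 2) < 1.
  by rewrite -[X in _ < X](@cos0 R) ltr_cos ?in_itv /=; [lra|apply/andP; split; lra..].
have lt : (2 * sin x + 2 * sin y) / 2 < 2 * sin m.
  have : sin m * cos ((y - x) / 2) < sin m by rewrite gtr_pMr.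
  by move: e; lra.
rewrite !repulsionE !ger0_norm ?(ltW sm)//.
apply: (@lt_le_trans _ _ (2 * signed_radial s ((2 * sin x + 2 * sin y) / 2))).
  rewrite ltr_pM2l//; apply: signed_radial_decreasing => //.
    by move=> /hs[? ?]; lra.
  lra.
apply: signed_radial_convex; rewrite ?mulr_ge0//.
by move=> /hs[? ?]; split; lra.
Qed.

End Kernel.

(** * Potential of the roots of unity *)

Section RootPotential.
Context {R : realType}.
Implicit Types (s x y t r : R) (k j n m : nat).

Definition root_potential s k t : R :=
  \sum_(j < 2 ^ k) repulsion s (t + j%:R * mesh k).

Lemma full_mesh k : (2 ^ k)%:R * mesh k = pi :> R.
Proof. by rewrite /mesh natrX; field; rewrite expf_neq0. Qed.

Lemma root_potentialD s k t : root_potential s k (t + mesh k) = root_potential s k t.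
Proof.
rewrite /root_potential; have : (0 < 2 ^ k)%N by rewrite expn_gt0.
have := full_mesh k; case: (2 ^ k)%N => // n e _.
rewrite big_ord_recr [RHS]big_ord_recl /= addrC; congr (_ + _).
  rewrite mul0r addr0 -(repulsionDpi s t) -e -natr1.
  by congr repulsion; ring.
by apply: eq_bigr => j _; rewrite /bump /= add1n -natr1; congr repulsion; ring.
Qed.

Lemma root_potentialDn s k t n :
  root_potential s k (t + n%:R * mesh k) = root_potential s k t.
Proof.
elim: n => [|n IH]; first by rewrite mul0r addr0.
by rewrite -natr1 mulrDl mul1r addrA root_potentialD.
Qed.

Lemma root_potential_reflect s k t :
  root_potential s k (mesh k - t) = root_potential s k t.
Proof.
rewrite /root_potential (reindex_inj rev_ord_inj) /=.
apply: eq_bigr => j _; have jk := ltn_ord j.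
rewrite -[RHS]repulsionN -[RHS]repulsionDpi -(full_mesh k) natrB// -natr1.
by congr repulsion; ring.
Qed.

Lemma root_potentialS s k t :
  root_potential s k.+1 t = root_potential s k t + root_potential s k (t + mesh k.+1).
Proof.
have gen n (G : nat -> R) : \sum_(j < n.*2) G j = \sum_(j < n) G (2 * j)%N + \sum_(j < n) G (2 * j).+1.
  elim: n => [|n IH]; first by rewrite !big_ord0 addr0.
  by rewrite doubleS !big_ord_recr /= IH mul2n; ring.
rewrite /root_potential expnS mul2n (gen _ (fun j => repulsion s (t + j%:R * mesh k.+1))).
congr (_ + _); apply: eq_bigr => j _; congr repulsion; rewrite meshS.
  by rewrite natrM; field.
by rewrite -natr1 natrM; field.
Qed.

(** The period of the potential is [mesh k], and over one period the argument
    [2 ^ k * t] runs through half a turn, which changes only signs. *)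
Lemma mesh_reduction k t : exists2 t' : R, 0 <= t' < mesh k &
  [/\ forall s y, root_potential s k (y + t) = root_potential s k (y + t'),
      `|sin ((2 ^ k)%:R * t)| = `|sin ((2 ^ k)%:R * t')| &
      `|cos ((2 ^ k)%:R * t)| = `|cos ((2 ^ k)%:R * t')| ].
Proof.
have m0 := mesh_gt0 (R := R) k.
have shift u n : [/\ forall s y, root_potential s k (y + (u + n%:R * mesh k)) = root_potential s k (y + u),
      `|sin ((2 ^ k)%:R * (u + n%:R * mesh k))| = `|sin ((2 ^ k)%:R * u)| &
      `|cos ((2 ^ k)%:R * (u + n%:R * mesh k))| = `|cos ((2 ^ k)%:R * u)| ].
  split; first by move=> s y; rewrite addrA root_potentialDn.
    elim: n => [|n IH]; first by rewrite mul0r addr0.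
    rewrite -IH -natr1 mulrDl mul1r addrA [_ * (_ + mesh k)]mulrDr full_mesh.
    by rewrite sinDpi normrN.
  elim: n => [|n IH]; first by rewrite mul0r addr0.
  rewrite -IH -natr1 mulrDl mul1r addrA [_ * (_ + mesh k)]mulrDr full_mesh.
  by rewrite cosDpi normrN.
have [N tN] : exists N : nat, 0 <= t + N%:R * mesh k.
  have [N _ hN] := nbhs_infty_ger (- t / mesh k); exists N.
  have := hN N (leqnn N); rewrite ler_pdivrMr//; lra.
set u := t + _ in tN.
have q0 : 0 <= u / mesh k by rewrite divr_ge0// ltW.
have := truncn_itv q0; set n := Num.truncn _ => /andP[nq qn].
exists (u - n%:R * mesh k).
  move: nq qn; rewrite ler_pdivlMr// ltr_pdivrMr// -natr1 => nq qn.
  by apply/andP; split; lra.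
have [h1 h2 h3] := shift t N; have := shift (u - n%:R * mesh k) n.
rewrite subrK => -[g1 g2 g3]; split.
- by move=> s y; rewrite -h1 -g1.
- by rewrite -h2 -g2.
- by rewrite -h3 -g3.
Qed.

Lemma cos_mesh_reduced k t : 0 <= t < mesh k -> cos ((2 ^ k)%:R * t) = 0 ->
  t = mesh k.+1 :> R.
Proof.
move=> /andP[t0 tm] c0; have pi0 := pi_gt0 R.
have n0 : 0 < (2 ^ k)%:R :> R by rewrite ltr0n expn_gt0.
apply: (mulfI (x := (2 ^ k)%:R)); first by rewrite gt_eqF.
rewrite mesh_half; apply: cos_inj; rewrite ?in_itv /=.
- by rewrite mulr_ge0 ?(ltW n0)//= -(full_mesh k) ler_pM2l// ltW.
- by apply/andP; split; lra.
- by rewrite c0 cos_pihalf.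
Qed.

(** A translation that swaps roots and midpoints acts on the potential as the
    translation by half a mesh. *)
Lemma root_potential_midshift s k d y : cos ((2 ^ k)%:R * d) = 0 ->
  root_potential s k (y + d) = root_potential s k (y + mesh k.+1).
Proof.
move=> c0; have [d' hd' [h1 _ h2]] := mesh_reduction k d.
rewrite h1; congr root_potential; congr (_ + _); apply: cos_mesh_reduced => //.
by apply/eqP; rewrite -normr_eq0 -h2 c0 normr0.
Qed.

(** Points [t + j h] and their mirror images [h - t + j h] are averaged into the
    midpoints, where strict convexity gives the unique minimum. *)
Lemma root_potential_min s k t : -1 <= s ->
  (0 <= s -> sin ((2 ^ k)%:R * t) != 0) ->
  root_potential s k (mesh k.+1) <= root_potential s k t /\
  (root_potential s k t = root_potential s k (mesh k.+1) -> cos ((2 ^ k)%:R * t) = 0).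
Proof.
move=> s1 st; have [u /andP[u0 um] [h1 h2 h3]] := mesh_reduction k t.
have E : root_potential s k t = root_potential s k u by have := h1 s 0; rewrite !add0r.
have su : 0 <= s -> 0 < u.
  move=> /st st'; rewrite lt_neqAle u0 andbT; apply/eqP => u00.
  by move: st'; rewrite -normr_eq0 h2 -u00 mulr0 sin0 normr0 eqxx.
have m0 := mesh_gt0 (R := R) k.
have [e|nu] := eqVneq u (mesh k.+1); rewrite E.
  rewrite e; split=> // _; apply/eqP.
  by rewrite -normr_eq0 h3 e mesh_half cos_pihalf normr0.
suff lt : root_potential s k (mesh k.+1) < root_potential s k u.
  by split; [exact: ltW|move=> e; rewrite e ltxx in lt].
rewrite -(ltr_pM2l (x := 2))//.
have -> : 2 * root_potential s k u =
  root_potential s k (mesh k - u) + root_potential s k u.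
  by rewrite root_potential_reflect; ring.
rewrite /root_potential mulr_sumr -big_split /=.
have k0 : (0 < 2 ^ k)%N by rewrite expn_gt0.
apply: ltr_sum; first by apply/hasP; exists (Ordinal k0); rewrite ?mem_index_enum.
move=> j _; have jk := ltn_ord j.
have jm : j%:R * mesh k + mesh k <= pi :> R.
  rewrite -(full_mesh k) -[X in _ + X]mul1r -mulrDl ler_pM2r// natr1 ler_nat.
  exact: jk.
have j0 : 0 <= j%:R * mesh k :> R by rewrite mulr_ge0// ltW.
have -> : mesh k.+1 + j%:R * mesh k =
   ((mesh k - u + j%:R * mesh k) + (u + j%:R * mesh k)) / 2 :> R.
  by rewrite meshS; field.
apply: repulsion_convex => //.
- move: nu; apply: contra_neq => e; rewrite meshS; lra.
- by apply/andP; split; lra.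
- by apply/andP; split; lra.
- move=> /su u1; split; apply: sin_gt0_pi; apply/andP; split; lra.
Qed.

End RootPotential.

(** * Structure of greedy configurations *)

Section GreedyStructure.
Context {R : realType}.
Implicit Types (s x y : R) (t : nat -> R) (k i n m : nat).

Definition potential s t n x : R := \sum_(i < n) repulsion s (x - t i).

Definition avoids t n x : Prop := forall i, (i < n)%N -> sin (x - t i) != 0.

Definition is_minimizer s t n x : Prop :=
  (0 <= s -> avoids t n x) /\
  forall y, avoids t n y -> potential s t n x <= potential s t n y.

Definition greedy_prefix s t n : Prop :=
  forall m, (1 <= m < n)%N -> is_minimizer s t m (t m).

Definition midpoint_potential s k : R := root_potential s k (mesh k.+1).

Definition shift_seq t n : nat -> R := fun i => t (n + i)%N.

Lemma potentialD s t n m x :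
  potential s t (n + m) x = potential s t n x + potential s (shift_seq t n) m x.
Proof. by rewrite /potential big_split_ord. Qed.

Lemma avoidsD t n m x :
  avoids t (n + m) x <-> avoids t n x /\ avoids (shift_seq t n) m x.
Proof.
split=> [h|[h1 h2] i inm].
  split=> i im; first by apply: h; rewrite ltn_addr.
  by apply: h; rewrite ltn_add2l.
have [/h1//|ni] := ltnP i n.
by have := h2 (i - n)%N; rewrite /shift_seq subnKC//; apply; rewrite ltn_subLR.
Qed.

Lemma greedy_prefix_le s t n m : (m <= n)%N -> greedy_prefix s t n ->
  greedy_prefix s t m.
Proof.
by move=> mn h i /andP[i1 im]; apply: h; rewrite i1 (leq_trans im).
Qed.

(** The first [2 ^ k] points form a coset of the group of roots of unity. It is
    enough to know this through their potential and their zero set, which do not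
    see the order of the points. *)
Definition root_configuration s k t : Prop :=
  (forall x, potential s t (2 ^ k) x = root_potential s k (x - t 0)) /\
  (forall x, avoids t (2 ^ k) x <-> sin ((2 ^ k)%:R * (x - t 0)) != 0).

(** The minimum of the potential of the first [m] points is prescribed by the
    binary digits of [m], and is attained only in the group of order [2 ^ k]
    through the first point. *)
Definition minimum_known s k t m : Prop :=
  let V := bit_sum (midpoint_potential s) m in
  (exists x, [/\ sin ((2 ^ k)%:R * (x - t 0%N)) = 0, avoids t m x &
     potential s t m x = V]) /\
  forall x, (0 <= s -> avoids t m x) ->
    V <= potential s t m x /\
    (potential s t m x = V -> sin ((2 ^ k)%:R * (x - t 0%N)) = 0).

Section Step.
Variables (s : R) (k : nat) (t : nat -> R).
Hypotheses (s1 : -1 <= s) (rc : root_configuration s k t).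

Let M : R := (2 ^ k)%:R.

Lemma cos_mesh_half : cos (M * mesh k.+1) = 0.
Proof. by rewrite /M mesh_half cos_pihalf. Qed.

Lemma root_configuration_min x : (0 <= s -> avoids t (2 ^ k) x) ->
  midpoint_potential s k <= potential s t (2 ^ k) x /\
  (potential s t (2 ^ k) x = midpoint_potential s k -> cos (M * (x - t 0%N)) = 0).
Proof.
by move=> av; rewrite rc.1; apply: root_potential_min => // s0; apply/rc.2/av.
Qed.

Lemma root_configuration_midpoint x : cos (M * (x - t 0%N)) = 0 ->
  avoids t (2 ^ k) x /\ potential s t (2 ^ k) x = midpoint_potential s k.
Proof.
move=> c0; split.
  apply/rc.2; apply/negP => /eqP /sin0cos1; rewrite -/M c0 normr0 => /esym/eqP.
  by rewrite oner_eq0.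
rewrite rc.1 /midpoint_potential -[x - t 0%N]add0r -[mesh k.+1]add0r.
exact: root_potential_midshift.
Qed.

(** The next greedy point is a midpoint by the equality case of the minimum. *)
Lemma root_configuration_next : is_minimizer s t (2 ^ k) (t (2 ^ k)) ->
  cos (M * (t (2 ^ k) - t 0%N)) = 0.
Proof.
move=> [av mn]; have [lb] := root_configuration_min av; apply.
apply/eqP; rewrite eq_le lb andbT.
have [|av' <-] := @root_configuration_midpoint (t 0%N + mesh k.+1).
  by rewrite addrAC subrr add0r cos_mesh_half.
exact: mn.
Qed.

Hypothesis next : cos (M * (t (2 ^ k) - t 0%N)) = 0.

Let c : nat -> R := shift_seq t (2 ^ k).

Lemma shift_seq0 : c 0%N = t (2 ^ k).
Proof. by rewrite /c /shift_seq addn0. Qed.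

Lemma sin_next_neq0 : sin (M * (t (2 ^ k) - t 0%N)) != 0.
Proof.
apply/negP => /eqP /sin0cos1; rewrite next normr0 => /esym/eqP.
by rewrite oner_eq0.
Qed.

Lemma coset_swap x : sin (M * (x - c 0%N)) = 0 <-> cos (M * (x - t 0%N)) = 0.
Proof.
have -> : M * (x - c 0%N) = M * (x - t 0%N) - M * (t (2 ^ k) - t 0%N).
  by rewrite shift_seq0; ring.
rewrite sinB next mulr0 sub0r; split=> [/eqP|->]; last by rewrite mul0r oppr0.
by rewrite oppr_eq0 mulf_eq0 (negPf sin_next_neq0) orbF => /eqP.
Qed.

(** The points after a full coset form a greedy sequence of their own: the tail
    has a minimizer inside the set of midpoints, where the coset potential is
    minimal too, so the next greedy point must reach both minima. *)
Lemma tail_greedy m : (m <= 2 ^ k)%N ->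
  (forall i, (1 <= i < 2 ^ k)%N -> greedy_prefix s c i -> minimum_known s k c i) ->
  greedy_prefix s t (2 ^ k + m) -> greedy_prefix s c m.
Proof.
move=> mk IH gt.
suff H i : (i <= m)%N -> greedy_prefix s c i by exact: H.
elim: i => [_ j|i IHi im]; first by rewrite ltn0 andbF.
have gi := IHi (ltnW im).
move=> j /andP[j1]; rewrite ltnS leq_eqVlt => /predU1P[ej|ji]; last first.
  by apply: gi; rewrite j1.
have i0 : (0 < i)%N by rewrite -ej.
rewrite {j j1}ej.
have [[x [x0 xav xV]] lb] := IH i ltac:(lia) gi.
have [av mn] := gt (2 ^ k + i)%N ltac:(by rewrite ltn_add2l im addn_gt0 expn_gt0).
have [xavt xpot] := root_configuration_midpoint ((coset_swap x).1 x0).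
have := mn x; rewrite !potentialD -/c xpot xV => /(_ ((avoidsD _ _ _ _).2 (conj xavt xav))).
have av1 : 0 <= s -> avoids t (2 ^ k) (c i) by move=> /av /avoidsD[].
have av2 : 0 <= s -> avoids c i (c i) by move=> /av /avoidsD[].
have [lb1 _] := root_configuration_min av1; have [lb2 _] := lb _ av2.
move=> le; split=> // y yav; have [lb3 _] := lb y (fun=> yav).
apply: le_trans lb3; move: le lb1; rewrite /c /shift_seq; lra.
Qed.

Lemma double_root_configuration : root_configuration s k c ->
  root_configuration s k.+1 t.
Proof.
move=> rc'; have e2 : (2 ^ k.+1 = 2 ^ k + 2 ^ k)%N by rewrite expnS; lia.
split=> x.
  rewrite e2 potentialD rc.1 rc'.1 root_potentialS; congr (_ + _).
  rewrite -/c shift_seq0 (_ : x - t (2 ^ k) = (x - t 0%N) - (t (2 ^ k) - t 0%N)); last by ring.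
  by apply: root_potential_midshift; rewrite mulrN cosN.
rewrite e2 avoidsD rc.2 rc'.2 -/M -/c.
have -> : (2 ^ k + 2 ^ k)%:R * (x - t 0%N) = (M * (x - t 0%N)) *+ 2.
  by rewrite natrD mulrDl mulr2n.
rewrite sin_mulr2n mulrn_eq0 /= mulf_eq0 negb_or.
split=> [[h1 h2]|/andP[h1 h2]].
  by rewrite h1 andbT; apply: contra h2 => /eqP h2; apply/eqP/coset_swap.
by split=> //; apply: contra h1 => /eqP h1; apply/eqP/coset_swap.
Qed.

(** The minimum of the sum is the sum of the minima, being attained jointly. *)
Lemma minimum_known_tail m : (0 < m < 2 ^ k)%N -> minimum_known s k c m ->
  minimum_known s k.+1 t (2 ^ k + m).
Proof.
move=> /andP[m0 mk] [[x [x0 xav xV]] lb].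
have dbl y : cos (M * (y - t 0%N)) = 0 -> sin ((2 ^ k.+1)%:R * (y - t 0%N)) = 0.
  move=> c0; have -> : (2 ^ k.+1)%:R * (y - t 0%N) = (M * (y - t 0%N)) *+ 2.
    by rewrite expnS natrM mulr2n /M; ring.
  by rewrite sin_mulr2n c0 mul0r mul0rn.
have V : bit_sum (midpoint_potential s) (2 ^ k + m) =
  midpoint_potential s k + bit_sum (midpoint_potential s) m by exact: bit_sum_top.
rewrite /minimum_known V.
split.
  have [xavt xpot] := root_configuration_midpoint ((coset_swap x).1 x0).
  exists x; split.
  - by apply: dbl; apply/coset_swap.
  - exact/avoidsD.
  - by rewrite potentialD xpot xV.
move=> y yav.
have av1 : 0 <= s -> avoids t (2 ^ k) y by move=> /yav /avoidsD[].
have av2 : 0 <= s -> avoids c m y by move=> /yav /avoidsD[].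
have [lb1 _] := root_configuration_min av1; have [lb2 eq2] := lb _ av2.
rewrite potentialD; split; first exact: lerD.
move=> e; apply: dbl; apply/coset_swap; apply: eq2.
by apply/eqP; rewrite eq_le lb2 andbT; move: e lb1; rewrite -/c; lra.
Qed.

End Step.

Lemma minimum_known_root s k t : -1 <= s -> root_configuration s k t ->
  minimum_known s k.+1 t (2 ^ k).
Proof.
move=> s1 rc.
have dbl y : cos ((2 ^ k)%:R * (y - t 0%N)) = 0 ->
    sin ((2 ^ k.+1)%:R * (y - t 0%N)) = 0.
  move=> c0; have -> : (2 ^ k.+1)%:R * (y - t 0%N) = ((2 ^ k)%:R * (y - t 0%N)) *+ 2.
    by rewrite expnS natrM mulr2n; ring.
  by rewrite sin_mulr2n c0 mul0r mul0rn.
have V : bit_sum (midpoint_potential s) (2 ^ k) = midpoint_potential s k.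
  by rewrite -[(2 ^ k)%N]addn0 bit_sum_top ?expn_gt0// bit_sum0 addr0.
rewrite /minimum_known V; split.
  have c0 : cos ((2 ^ k)%:R * (t 0%N + mesh k.+1 - t 0%N)) = 0.
    by rewrite addrAC subrr add0r mesh_half cos_pihalf.
  have [h1 h2] := root_configuration_midpoint rc c0.
  by exists (t 0%N + mesh k.+1); split => //; exact: dbl.
move=> x av; have [h1 h2] := root_configuration_min s1 rc av.
by split=> // /h2; exact: dbl.
Qed.

Lemma minimum_known_up s k t m : minimum_known s k t m -> minimum_known s k.+1 t m.
Proof.
have dbl y : sin ((2 ^ k)%:R * (y - t 0%N)) = 0 ->
    sin ((2 ^ k.+1)%:R * (y - t 0%N)) = 0.
  move=> c0; have -> : (2 ^ k.+1)%:R * (y - t 0%N) = ((2 ^ k)%:R * (y - t 0%N)) *+ 2.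
    by rewrite expnS natrM mulr2n; ring.
  by rewrite sin_mulr2n c0 mulr0 mul0rn.
move=> [[x [x0 xav xV]] lb]; split; first by exists x; split => //; exact: dbl.
by move=> y /lb[h1 h2]; split=> // /h2; exact: dbl.
Qed.

(** The binary structure of greedy configurations. When a point set splits into
    a group of roots and a shorter greedy tail contained in the midpoints of
    that group, both potentials are minimized at once, so that a minimizer of
    the sum minimizes both. *)
Lemma greedy_structure s k t : -1 <= s ->
  (greedy_prefix s t (2 ^ k) -> root_configuration s k t) /\
  (forall m, (0 < m < 2 ^ k)%N -> greedy_prefix s t m -> minimum_known s k t m).
Proof.
move=> s1; elim: k t => [|k IH] t.
  rewrite expn0; split; last by case.
  move=> _; split=> x.
    by rewrite /potential /root_potential expn0 !big_ord1 mul0r addr0.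
  split=> [|h i]; first by rewrite expn0 mul1r; apply.
  by rewrite expn0 ltnS leqn0 => /eqP ->; rewrite expn0 mul1r in h.
have e2 : (2 ^ k.+1 = 2 ^ k + 2 ^ k)%N by rewrite expnS; lia.
have k0 : (0 < 2 ^ k)%N by rewrite expn_gt0.
have rcE : greedy_prefix s t (2 ^ k) -> root_configuration s k t.
  exact: (IH t).1.
split.
  rewrite e2 => gt; have rc := rcE (greedy_prefix_le (leq_addr _ _) gt).
  have nx := root_configuration_next s1 rc (gt (2 ^ k)%N ltac:(lia)).
  apply: (double_root_configuration s1 rc nx); apply: (IH _).1.
  exact: (tail_greedy s1 rc nx (leqnn _) (IH _).2 gt).
move=> m /andP[m0 mk] gt; have [mlt|mge] := ltnP m (2 ^ k).
  by apply: minimum_known_up; apply: (IH t).2 => //; rewrite m0.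
have rc := rcE (greedy_prefix_le mge gt).
move: mge; rewrite leq_eqVlt => /predU1P[<-|mgt]; first exact: minimum_known_root.
pose m' := (m - 2 ^ k)%N; have em : m = (2 ^ k + m')%N by rewrite /m'; lia.
rewrite em in gt *.
have nx := root_configuration_next s1 rc (gt (2 ^ k)%N ltac:(lia)).
apply: (minimum_known_tail s1 rc nx); first lia.
apply: (IH _).2; first lia.
by apply: (tail_greedy s1 rc nx _ (IH _).2 gt); lia.
Qed.

Lemma greedy_potential s t n : -1 <= s -> (forall m, greedy_prefix s t m) ->
  (0 < n)%N ->
  potential s t n (t n) = bit_sum (midpoint_potential s) n.
Proof.
move=> s1 gt n0; have [_ H] := greedy_structure n t s1.
have [[x [_ xav xV]] lb] := H n ltac:(rewrite n0 /=; exact: ltn_expl) (gt n).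
have [av mn] := gt n.+1 n ltac:(by rewrite n0 /=).
by apply/eqP; rewrite eq_le -{1}xV mn//= (lb _ av).1.
Qed.

End GreedyStructure.

(** * Energy of greedy configurations *)

Section GreedyEnergy.
Context {R : realType}.
Implicit Types (s x y : R) (t : nat -> R) (i j k n m N : nat).

Definition circle_point x : R[i] := (cos (x *+ 2) +i* sin (x *+ 2))%C.

Lemma circle_point_unit x : unit_circle (circle_point x).
Proof.
rewrite /unit_circle /= cos2Dsin2 sqrtr1 //.
Qed.

Lemma unit_circleP (z : R[i]) : unit_circle z -> exists x, z = circle_point x.
Proof.
case: z => u v; rewrite /unit_circle /= => h.
have e : u ^+ 2 + v ^+ 2 = 1.
  by rewrite -[LHS]sqr_sqrtr ?addr_ge0 ?sqr_ge0// h expr1n.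
have u1 : -1 <= u <= 1.
  rewrite -ler_norml -(ler_pXn2r (n := 2)) ?nnegrE// expr1n real_normK ?num_real//.
  by rewrite -e lerDl sqr_ge0.
have ue : cos (acos u) = u by rewrite acosK// in_itv.
have ve : sin (acos u) = `|v|.
  by rewrite sin_acos// -sqrtr_sqr; congr Num.sqrt; rewrite -e; ring.
have half (x : R) : x / 2 *+ 2 = x by rewrite mulr2n; field.
have [v0|v0] := leP 0 v.
  by exists (acos u / 2); rewrite /circle_point half ue ve ger0_norm.
exists (- acos u / 2); rewrite /circle_point half cosN sinN ue ve.
by rewrite ltr0_norm// opprK.
Qed.

Lemma normc_circle_pointB x y :
  ComplexField.Normc.normc (circle_point x - circle_point y) = 2 * `|sin (x - y)|.
Proof.
have -> : 2 * `|sin (x - y)| = Num.sqrt ((2 * sin (x - y)) ^+ 2).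
  by rewrite sqrtr_sqr normrM ger0_norm.
rewrite /=; congr Num.sqrt.
rewrite !cos_mulr2n !sin_mulr2n sinB !mulr2n.
have := cos2Dsin2 x; have := cos2Dsin2 y.
set a := cos x; set b := sin x; set c := cos y; set d := sin y => h1 h2.
have -> : a ^+ 2 = 1 - b ^+ 2 by rewrite -h2 addrK.
have -> : c ^+ 2 = 1 - d ^+ 2 by rewrite -h1 addrK.
transitivity (4 * ((d ^+ 2 - b ^+ 2) ^+ 2 + a ^+ 2 * b ^+ 2 + c ^+ 2 * d ^+ 2
   - 2 * a * b * c * d)); first by ring.
rewrite (_ : (2 * _) ^+ 2 = 4 * (b ^+ 2 * c ^+ 2 + a ^+ 2 * d ^+ 2 - 2 * a * b * c * d));
  last by ring.
have -> : a ^+ 2 = 1 - b ^+ 2 by rewrite -h2 addrK.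
have -> : c ^+ 2 = 1 - d ^+ 2 by rewrite -h1 addrK.
by ring.
Qed.

Lemma circle_point_eq x y : (circle_point x == circle_point y) = (sin (x - y) == 0).
Proof.
rewrite -subr_eq0; have := normc_circle_pointB x y; set z := _ - _ => h.
apply/eqP/eqP => [z0|s0].
  by move: h; rewrite z0 ComplexField.Normc.normc0 => /esym/eqP;
     rewrite mulf_eq0 pnatr_eq0 /= normr_eq0 => /eqP.
by apply: ComplexField.Normc.eq0_normc; rewrite h s0 normr0 mulr0.
Qed.

Lemma riesz_kernel_circle_point s x y :
  riesz_kernel s (circle_point x) (circle_point y) =
  if (0 <= s) && (sin (x - y) == 0) then +oo%E else (chord_kernel s (x - y))%:E.
Proof.
rewrite /riesz_kernel circle_point_eq normc_circle_pointB /chord_kernel /riesz_radial.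
by case: ifP => // _; case: ifP.
Qed.

Definition pair_energy s t N : R :=
  2 * \sum_(n < N) \sum_(i < n) chord_kernel s (t n - t i).

Lemma chord_kernelN s x : chord_kernel s (- x) = chord_kernel s x.
Proof. by rewrite /chord_kernel sinN normrN. Qed.

Lemma pair_energyE s t N : pair_energy s t N =
  \sum_(i < N) \sum_(j < N | j != i) chord_kernel s (t i - t j).
Proof.
rewrite /pair_energy; elim: N => [|N IH]; first by rewrite !big_ord0 mulr0.
rewrite big_ord_recr mulrDr IH /= big_ord_recr /=.
have -> : \sum_(j < N.+1 | j != ord_max) chord_kernel s (t N - t j) =
  \sum_(i < N) chord_kernel s (t N - t i).
  rewrite big_mkcond big_ord_recr /= eqxx /= addr0; apply: eq_bigr => i _.
  by rewrite -val_eqE /= ltn_eqF.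
have -> : \sum_(i < N) \sum_(j < N.+1 | j != widen_ord (leqnSn N) i)
    chord_kernel s (t i - t j) =
  \sum_(i < N) (\sum_(j < N | j != i) chord_kernel s (t i - t j) +
    chord_kernel s (t N - t i)).
  apply: eq_bigr => i _; rewrite big_mkcond big_ord_recr /= -val_eqE /=.
  rewrite gtn_eqF//= -chord_kernelN opprB; congr (_ + _).
  by rewrite [RHS]big_mkcond; apply: eq_bigr => j _; rewrite -!val_eqE.
by rewrite big_split /=; ring.
Qed.

Definition points_distinct t N : Prop :=
  forall i j, (i < j < N)%N -> sin (t j - t i) != 0.

Lemma riesz_energy_finite s t N (b : nat -> R[i]) :
  (forall i, (i < N)%N -> b i = circle_point (t i)) ->
  (0 <= s -> points_distinct t N) ->
  riesz_energy s (greedy_section b N) = (pair_energy s t N)%:E.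
Proof.
move=> hb hd; rewrite pair_energyE -sumEFin; apply: eq_bigr => i _.
rewrite -sumEFin; apply: eq_bigr => j ji.
rewrite !tnth_mktuple !hb// riesz_kernel_circle_point; case: ifP => // /andP[s0].
move=> /eqP sij; exfalso; move: (hd s0).
case: (ltngtP i j) ji => [lt _|gt _|e]; last by rewrite (val_inj e) eqxx.
  by move=> /(_ i j); rewrite lt ltn_ord -[t j - t i]opprB sinN sij oppr0 eqxx => /(_ isT).
by move=> /(_ j i); rewrite gt ltn_ord sij eqxx => /(_ isT).
Qed.

Lemma riesz_energy_infinite s t N (b : nat -> R[i]) n m :
  (forall i, (i < N)%N -> b i = circle_point (t i)) -> 0 <= s ->
  (n < N)%N -> (m < N)%N -> n != m -> sin (t n - t m) = 0 ->
  riesz_energy s (greedy_section b N) = +oo%E.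
Proof.
move=> hb s0 nN mN nm snm.
have kE i j : (i < N)%N -> (j < N)%N -> riesz_kernel s (b i) (b j) != -oo%E.
  by move=> iN jN; rewrite !hb// riesz_kernel_circle_point; case: ifP.
apply/eqP; rewrite /riesz_energy esum_eqy; last first.
  move=> i _; rewrite esum_eqNy; apply/existsPn => j.
  rewrite !tnth_mktuple; apply/negP => /andP[_ /eqP e].
  by have := kE i j (ltn_ord i) (ltn_ord j); rewrite e eqxx.
apply/existsP; exists (Ordinal nN); rewrite /= esum_eqy; last first.
  by move=> j _; rewrite !tnth_mktuple; apply: kE => //=.
apply/existsP; exists (Ordinal mN); apply/andP; split.
  by rewrite unfold_in /= -val_eqE /= eq_sym.
by rewrite !tnth_mktuple /= !hb// riesz_kernel_circle_point s0 snm eqxx.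
Qed.

Definition extend {T : Type} (f : nat -> T) N (z : T) : nat -> T :=
  fun i => if (i < N)%N then f i else z.

Lemma rcons_greedy_section (a : nat -> R[i]) N z :
  [tuple of rcons (greedy_section a N) z] = greedy_section (extend a N z) N.+1.
Proof.
apply: eq_from_tnth => i; rewrite tnth_mktuple (tnth_nth 0) /= nth_rcons.
rewrite size_tuple card_ord /extend; case: ltnP => [iN|Ni].
  by rewrite -(tnth_nth 0 (greedy_section a N) (Ordinal iN)) tnth_mktuple.
by rewrite ifT// eqn_leq Ni andbT -ltnS.
Qed.

Lemma pair_energy_extend s t N y : pair_energy s (extend t N y) N.+1 =
  pair_energy s t N + 2 * \sum_(i < N) chord_kernel s (y - t i).
Proof.
rewrite /pair_energy big_ord_recr mulrDr /=; congr (2 * _ + 2 * _).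
  apply: eq_bigr => n _; apply: eq_bigr => i _; rewrite /extend ltn_ord.
  by rewrite (ltn_trans (ltn_ord i)).
by apply: eq_bigr => i _; rewrite /extend ltn_ord ltnn.
Qed.

Lemma repulsion_chord_kernel s t N y : potential s t N y =
  (if 0 <= s then 1 else -1) * \sum_(i < N) chord_kernel s (y - t i).
Proof.
rewrite /potential /repulsion; case: ifP => _; first by rewrite mul1r.
by rewrite mulN1r -sumrN.
Qed.

(** Adding a point adds twice its potential to the energy. For [0 <= s] a point
    that repeats an earlier one has infinite energy, and the comparison point
    given by [greedy_structure] shows that this is not minimal. *)
Lemma greedy_prefix_of_energy s (a : nat -> R[i]) t : -1 <= s ->
  (forall n, a n = circle_point (t n)) -> greedy_energy_sequence s a ->
  forall N, greedy_prefix s t N.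
Proof.
move=> s1 ae [_ ha]; elim=> [|N IH]; first by move=> m; rewrite ltn0 andbF.
move=> m /andP[m1]; rewrite ltnS leq_eqVlt => /predU1P[e|mN]; last first.
  by apply: IH; rewrite m1.
rewrite {m}e in m1 *.
have dN : 0 <= s -> points_distinct t N.
  move=> s0 i j /andP[ij jN].
  by apply: (IH j _).1 => //; rewrite jN (leq_ltn_trans _ ij).
have finE y : (0 <= s -> avoids t N y) ->
    riesz_energy s [tuple of rcons (greedy_section a N) (circle_point y)] =
    (pair_energy s t N + 2 * \sum_(i < N) chord_kernel s (y - t i))%:E.
  move=> yav; rewrite rcons_greedy_section -pair_energy_extend.
  apply: riesz_energy_finite => [i _|s0 i j /andP[ij]].
    by rewrite /extend; case: ifP.
  rewrite ltnS leq_eqVlt /extend => /predU1P[jN|jN].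
    by rewrite jN ltnn -jN ij; apply: yav; rewrite ?jN// -jN.
  by rewrite jN (ltn_trans ij jN); apply: dN => //; rewrite ij.
have [_ GS] := greedy_structure N t s1.
have [[x [_ xav _]] _] := GS N ltac:(rewrite m1 /=; exact: ltn_expl) IH.
have greedy y := ha N m1 (circle_point y) (circle_point_unit y).
have av : 0 <= s -> avoids t N (t N).
  move=> s0 i iN; apply/eqP => sN.
  have := greedy x; rewrite /= s0 finE// rcons_greedy_section.
  rewrite (@riesz_energy_infinite s (extend t N (t N)) N.+1 _ N i) ?ltnS ?leqnn//.
  - by move=> j _; rewrite /extend ae; case: ifP.
  - exact: ltnW.
  - by rewrite gtn_eqF.
  - by rewrite /extend ltnn iN.
split=> // y yav; have := greedy y; rewrite /= ae !finE// !repulsion_chord_kernel.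
by case: ifP => s0; rewrite lee_fin lerD2l ler_pM2l// ?mul1r// !mulN1r lerN2.
Qed.

(** Energy per point of the [2 ^ k]-th roots of unity. *)
Definition root_energy s k : R := grid_sum (chord_kernel s) (mesh k) (2 ^ k).

Lemma midpoint_potential_root_energy s k : midpoint_potential s k =
  (if 0 <= s then 1 else -1) * (root_energy s k.+1 - root_energy s k).
Proof.
rewrite /root_energy meshS expnS mul2n grid_sum_refine ?expn_gt0// addrK.
rewrite /midpoint_potential /root_potential /midpoint_sum /repulsion meshS.
rewrite mulr_sumr; apply: eq_bigr => j _.
rewrite (_ : mesh k / 2 + j%:R * mesh k = (j%:R + 2^-1) * mesh k); last by ring.
by case: ifP => _; rewrite ?mul1r ?mulN1r.
Qed.

Lemma greedy_energyE s (a : nat -> R[i]) N : -1 <= s ->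
  greedy_energy_sequence s a ->
  riesz_energy s (greedy_section a N) = (binary_energy (root_energy s) N)%:E.
Proof.
move=> s1 ha; have [au _] := ha.
have /choice[t ae] n : exists x, a n = circle_point x by apply: unit_circleP.
have gt := greedy_prefix_of_energy s1 ae ha.
have dN : 0 <= s -> points_distinct t N.
  move=> s0 i j /andP[ij jN].
  by apply: (gt N j _).1 => //; rewrite jN (leq_ltn_trans _ ij).
rewrite (riesz_energy_finite (t := t))//; congr (_%:E).
rewrite /pair_energy /binary_energy.
have -> : root_energy s 0 = 0 by rewrite /root_energy /grid_sum expn0 big_geq.
rewrite mulr0 addr0; congr (2 * _); apply: eq_bigr => n _.
have [n0|n0] := posnP n; first by rewrite n0 bit_sum0 big_ord0.
have := greedy_potential s1 gt n0; rewrite repulsion_chord_kernel.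
have -> : bit_sum (midpoint_potential s) n = (if 0 <= s then 1 else -1) *
   bit_sum (fun k => root_energy s k.+1 - root_energy s k) n.
  rewrite /bit_sum mulr_sumr; apply: eq_bigr => k _.
  by rewrite midpoint_potential_root_energy; ring.
by apply: mulfI; case: ifP; rewrite ?oppr_eq0 oner_eq0.
Qed.

End GreedyEnergy.

(** * Asymptotics of the energy of the roots of unity *)

Section RootEnergyAsymptotics.
Context {R : realType}.
Implicit Types (s : R) (k j n N : nat).

Lemma root_energy_sin s k : s != 0 ->
  root_energy s k = 2 `^ (- s) * sin_power_sum (- s) k.
Proof.
move=> s0; rewrite /root_energy /sin_power_sum /grid_sum mulr_sumr.
rewrite big_nat_cond [RHS]big_nat_cond; apply: eq_bigr => j.
rewrite andbT => /andP[j1 jk]; rewrite /chord_kernel /riesz_radial (negPf s0).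
have m0 := mesh_gt0 (R := R) k.
have sj : 0 <= sin (j%:R * mesh k : R).
  apply: sin_ge0_pi; rewrite mulr_ge0 ?(ltW m0)//=.
  by rewrite -(full_mesh k) ler_pM2r// ler_nat ltnW.
by rewrite powRM// ger0_norm.
Qed.

(** The product formula for the sine, by repeated duplication. *)
Lemma root_potential0 k (x : R) : sin ((2 ^ k)%:R * x) != 0 ->
  root_potential 0 k x = - ln (2 * `|sin ((2 ^ k)%:R * x)|).
Proof.
elim: k x => [|k IH] x.
  rewrite expn0 mul1r /root_potential expn0 big_ord1 mul0r addr0 => _.
  by rewrite repulsionE /signed_radial lexx /riesz_radial eqxx.
have -> : (2 ^ k.+1)%:R * x = ((2 ^ k)%:R * x) *+ 2.
  by rewrite expnS natrM mulr2n; ring.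
rewrite sin_mulr2n mulrn_eq0 /= mulf_eq0 negb_or => /andP[c0 s0].
have e : sin ((2 ^ k)%:R * (x + mesh k.+1)) = cos ((2 ^ k)%:R * x).
  by rewrite mulrDr mesh_half sinDpihalf.
rewrite root_potentialS IH// IH ?e// -opprD -lnM ?posrE ?mulr_gt0 ?normr_gt0//.
congr (- ln _); rewrite -[(_ * _) *+ 2]mulr_natl !normrM (ger0_norm (x := 2%:R))//.
by ring.
Qed.

Lemma root_energy0 k : root_energy 0 k.+1 - root_energy 0 k = - ln 2 :> R.
Proof.
have := midpoint_potential_root_energy (0 : R) k; rewrite lexx mul1r => <-.
rewrite /midpoint_potential root_potential0 mesh_half sin_pihalf ?oner_neq0//.
by rewrite normr1 mulr1.
Qed.

Let step s k : R := root_energy s k.+1 - 2 * root_energy s k.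

Lemma step_sin s k : s != 0 -> step s k =
  2 `^ (- s) * (sin_power_sum (- s) k.+1 - 2 * sin_power_sum (- s) k).
Proof. by move=> s0; rewrite /step !root_energy_sin//; ring. Qed.

(** The limiting exponent [p = 1], where the tail bound for the defects no longer
    decays, is covered by the closed form [cot y - 2 * cot (2 * y) = tan y]. *)
Lemma is_cvg_sin_power_step1 :
  cvg ((fun k => (sin_power_sum 1 k.+1 - 2 * sin_power_sum 1 k) * (2 : R) ^+ k) @ \oo).
Proof.
apply/cvg_ex; exists (4^-1 * (pi * 1^-1)).
rewrite -(cvg_shiftS (fun k => (sin_power_sum 1 k.+1 - 2 * sin_power_sum 1 k) * 2 ^+ k)).
have h : (fun k => 4^-1 * (2 ^+ k.+3 * sin (mesh k.+3) * (cos (mesh k.+3))^-1)) @ \oo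
    --> 4^-1 * (pi * 1^-1 : R).
  apply: cvgM; first exact: cvg_cst.
  apply: cvgM.
    have := cvg_sin_mesh2 (R := R).
    by rewrite -(cvg_shiftS (fun k => 2 ^+ k.+2 * sin (mesh k.+2))).
  apply: cvgV; first exact: oner_neq0.
  have := cvg_cos_mesh (R := R).
  by rewrite -(cvg_shiftS (fun k => cos (mesh k.+2))).
apply: cvg_trans h; apply: near_eq_cvg; apply: nearW => k; rewrite /mk_sequence.
rewrite !sin_power_sum1; set y : R := mesh k.+3.
have -> : mesh k.+2 = y *+ 2 :> R by rewrite /y [mesh k.+3]meshS mulr2n; field.
have s0 : 0 < sin y := sin_mesh_gt0 _.
have c0 : 0 < cos y.
  have m0 := mesh_gt0 (R := R) k.+3; have m1 := mesh_gt0 (R := R) k.+2.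
  have /andP[_] := @grid_point_bounds R k.+1 1 (expn_gt0 2 k.+1).
  rewrite mul1r => mp; apply: cos_gt0_pihalf.
  have yE : y = mesh k.+2 / 2 by rewrite /y [LHS]meshS.
  by move: m0 m1 mp; rewrite -/y yE; clear => *; apply/andP; split; lra.
have e1 : sin (y *+ 2) = 2 * (cos y * sin y) by rewrite sin_mulr2n mulr_natl.
have e2 : cos (y *+ 2) = 1 - 2 * sin y ^+ 2.
  by rewrite cos_mulr2n cos2sin2 -mulr_natl; ring.
have e3 : cos y / sin y = (1 - sin y ^+ 2) / (cos y * sin y).
  by rewrite -cos2sin2; field; rewrite !gt_eqF.
by rewrite e1 e2 e3 !exprS; field; rewrite !gt_eqF.
Qed.

Lemma is_cvg_step s : -1 <= s -> s != 0 -> cvg ((fun k => step s k * (2 `^ (- s)) ^+ k) @ \oo).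
Proof.
move=> s1 s0.
suff : cvg ((fun k => (sin_power_sum (- s) k.+1 - 2 * sin_power_sum (- s) k) * (2 `^ (- s)) ^+ k) @ \oo).
  move=> /cvg_ex[l hl]; apply/cvg_ex; exists (2 `^ (- s) * l).
  rewrite (_ : (fun k => _) = (fun k => 2 `^ (- s) * ((sin_power_sum (- s) k.+1 -
     2 * sin_power_sum (- s) k) * (2 `^ (- s)) ^+ k))).
    by apply: cvgM => //; exact: cvg_cst.
  by apply/funext => k; rewrite step_sin//; ring.
move: s1; rewrite le_eqVlt => /predU1P[<-|s1].
  rewrite opprK powRr1//; exact: is_cvg_sin_power_step1.
by apply: is_cvg_sin_power_step; lra.
Qed.

Lemma cvg_root_energy_mean s : s < 1 -> s != 0 ->
  (fun k => root_energy s k / 2 ^+ k) @ \oo --> circle_energy s.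
Proof.
move=> s1 s0; rewrite circle_energy_sine_moment//.
rewrite (_ : (fun k => _) = (fun k => 2 `^ (- s) * (sin_power_sum (- s) k / 2 ^+ k))).
  by apply: cvgM; [exact: cvg_cst|apply: cvg_sine_moment; rewrite ltrN2].
by apply/funext => k; rewrite root_energy_sin// mulrA.
Qed.

Lemma two_powR_neq1 s : s != 1 -> 1 - 2 * 2 `^ (- s) != 0.
Proof.
move=> s1; rewrite subr_eq0 eq_sym -[X in X * _](powRr1 (a := 2))//.
rewrite -powRD ?pnatr_eq0 ?implybT// powR_eq1 negb_or negb_or.
by rewrite pnatr_eq1 /= -leNgt ler0n subr_eq0 eq_sym.
Qed.

(** A linear recursion [w (k + 1) = 2 * w k + step] transfers the asymptotics of
    the steps to [w]: as a contraction for [s > 1], and for [s < 1] as an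
    expansion whose free solution is excluded by [w k = o (2 ^ k)]. *)
Lemma is_cvg_of_step s (w : nat -> R) : s != 1 ->
  cvg ((fun k => (w k.+1 - 2 * w k) * (2 `^ (- s)) ^+ k) @ \oo) ->
  (s < 1 -> (fun k => w k / 2 ^+ k) @ \oo --> (0 : R)) ->
  cvg ((fun k => w k * (2 `^ (- s)) ^+ k) @ \oo).
Proof.
move=> s1 /cvg_ex[/= c hc] hw; set q := 2 `^ (- s) in hc *.
have q0 : 0 < q by rewrite powR_gt0.
have d0 : 1 - 2 * q != 0 by apply: two_powR_neq1.
(* The fixed point of the recursion satisfied by w k * q ^ k. *)
pose l := q * c / (1 - 2 * q).
pose y k := w k * q ^+ k - l.
pose e k := q * ((w k.+1 - 2 * w k) * q ^+ k - c).
have ye k : y k.+1 = (2 * q) * y k + e k.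
  by rewrite /y /e /l exprS; field.
have he : e @ \oo --> (0 : R).
  rewrite -(mulr0 q) -(subrr c); apply: cvgM; first exact: cvg_cst.
  by apply: cvgB => //; exact: cvg_cst.
suff hy : y @ \oo --> (0 : R).
  apply/cvg_ex; exists (0 + l).
  rewrite (_ : (fun k => _) = (fun k => y k + l)).
    by apply: cvgD => //; exact: cvg_cst.
  by apply/funext => k; rewrite /y subrK.
case: (ltgtP s 1) s1 => // [slt _|sgt _].
  have q2 : 1 < 2 * q.
    rewrite -[X in X * _](powRr1 (a := 2))// -powRD ?pnatr_eq0 ?implybT//.
    rewrite /powR pnatr_eq0 /= expR_gt1 mulr_gt0 ?ln_gt0 ?ltr1n//; lra.
  apply: (cvg_expansion q2 ye he).
  have h1 : (fun k => w k / 2 ^+ k - l * ((2 * q)^-1) ^+ k) @ \oo --> (0 : R).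
    rewrite -(subr0 0); apply: cvgB; first exact: hw.
    apply: cvg_geometric; rewrite ger0_norm ?invr_ge0 ?mulr_ge0 ?(ltW q0)//.
    by rewrite invf_lt1// (lt_trans ltr01).
  rewrite (_ : (fun k => _) = (fun k => w k / 2 ^+ k - l * ((2 * q)^-1) ^+ k))//.
  apply/funext => k; rewrite /y exprVn exprMn mulrBl; congr (_ - _).
  by field; rewrite !expf_neq0// gt_eqF.
apply: (@cvg_contraction _ _ e (2 * q)) => //.
rewrite ger0_norm ?mulr_ge0 ?(ltW q0)//.
rewrite -[X in X * _](powRr1 (a := 2))// -powRD ?pnatr_eq0 ?implybT//.
by rewrite /powR pnatr_eq0 /= expR_lt1 pmulr_llt0 ?ln_gt0 ?ltr1n//; lra.
Qed.

Lemma is_cvg_root_energy_sub s : -1 <= s -> s < 1 -> s != 0 ->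
  cvg ((fun k => (root_energy s k - circle_energy s * 2 ^+ k) * (2 `^ (- s)) ^+ k) @ \oo).
Proof.
move=> s1 s2 s0; apply: is_cvg_of_step; first by rewrite lt_eqF.
  rewrite (_ : (fun k => _) = (fun k => step s k * (2 `^ (- s)) ^+ k)); first exact: is_cvg_step.
  by apply/funext => k; rewrite /step exprS; ring.
move=> _; rewrite (_ : (fun k => _) = (fun k => root_energy s k / 2 ^+ k - circle_energy s)).
  rewrite -(subrr (circle_energy s)); apply: cvgB; last exact: cvg_cst.
  exact: cvg_root_energy_mean.
by apply/funext => k; rewrite mulrBl mulfK// expf_neq0.
Qed.

Lemma is_cvg_root_energy s : 1 < s ->
  cvg ((fun k => root_energy s k * (2 `^ (- s)) ^+ k) @ \oo).
Proof.
move=> s1; apply: is_cvg_of_step; first by rewrite gt_eqF.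
  by apply: is_cvg_step; [lra|rewrite gt_eqF//; lra].
by move=> s2; have := lt_trans s1 s2; rewrite ltxx.
Qed.

(** Comparison of [1 / j] with the increments of the logarithm. *)
Lemma harmonic_bounds n :
  ln n.+1%:R <= \sum_(1 <= j < n.+1) (j%:R : R)^-1 /\
  \sum_(1 <= j < n.+2) (j%:R : R)^-1 <= 1 + ln n.+1%:R.
Proof.
elim: n => [|n [IH1 IH2]].
  by rewrite big_geq// big_nat1 ln1 invr1 addr0.
have n0 : 0 < n.+1%:R :> R by rewrite ltr0n.
have n1 : 0 < n.+2%:R :> R by rewrite ltr0n.
have e : n.+2%:R = n.+1%:R + 1 :> R by rewrite natr1.
split.
  rewrite big_nat_recr//=.
  have : ln (1 + n.+1%:R^-1) <= n.+1%:R^-1 :> R.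
    by apply: le_ln1Dx; rewrite (lt_trans _ (_ : 0 < _)) ?invr_gt0// ltrN10.
  have -> : ln n.+2%:R = ln n.+1%:R + ln (1 + n.+1%:R^-1) :> R.
    rewrite -lnM ?posrE ?addr_gt0 ?invr_gt0//; congr ln; rewrite e.
    by field; rewrite gt_eqF.
  by move=> h; exact: lerD IH1 h.
rewrite big_nat_recr//=; apply: le_trans (lerD IH2 (lexx _)) _.
have : ln (1 + - n.+2%:R^-1) <= - n.+2%:R^-1 :> R.
  by apply: le_ln1Dx; rewrite ltrN2 invf_lt1// ltr1n.
have q0 : 0 < 1 - n.+2%:R^-1 :> R by rewrite subr_gt0 invf_lt1// ltr1n.
have -> : ln n.+1%:R = ln n.+2%:R + ln (1 + - n.+2%:R^-1) :> R.
  rewrite -lnM ?posrE//; congr ln; rewrite mulrBr mulr1 mulfV ?gt_eqF//.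
  by rewrite e addrK.
by rewrite -subr_le0 opprK -!addrA lerD2l gerDl.
Qed.

Lemma inv_sin_bounds (x : R) : 0 < x <= pi / 2 ->
  x^-1 <= (sin x)^-1 <= x^-1 + 1.
Proof.
move=> /andP[x0 xp]; have pi0 := pi_gt0 R.
have s0 : 0 < sin x by apply: sin_gt0_half; rewrite x0.
have c0 : 0 <= cos x by apply: cos_ge0_pihalf; apply/andP; split; lra.
have h1 := sin_le_id (ltW x0).
have h2 : x * cos x <= sin x by apply: mul_cos_le_sin; apply/andP; split; lra.
have h3 := cos2Dsin2 x; have h4 := cos_le1 x; have h5 := sin_le1 x.
rewrite lef_pV2 ?posrE// h1 /=.
have h6 : 1 <= sin x + cos x.
  have := ler_wpM2l c0 h4; have := ler_wpM2l (ltW s0) h5.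
  by move: h3; rewrite !expr2; clear; lra.
rewrite -[X in X <= _]mul1r ler_pdivrMr// mulrDl mul1r.
have h7 : cos x <= x^-1 * sin x by rewrite ler_pdivlMl.
by move: h6 h7; clear; lra.
Qed.

Lemma root_energy1_bounds k :
  let a : R := root_energy 1 k.+1 / 2 ^+ k.+1 in let m : R := ln 2 / pi in
  k%:R * m <= a /\ a <= k%:R * m + 2.
Proof.
move=> a m; have pi0 := pi_gt0 R.
have k0 : 0 < 2 ^+ k :> R by rewrite exprn_gt0.
have k1 : 1 <= 2 ^+ k :> R by rewrite exprn_ege1// ler1n.
have h0 := mesh_gt0 (R := R) k.+1.
set h : R := mesh k.+1 in h0.
pose H : R := \sum_(1 <= j < 2 ^ k) (j%:R : R)^-1.
have [H1 H2] : k%:R * ln 2 <= H /\ H <= 1 + k%:R * ln 2.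
  have e : (2 ^ k = (2 ^ k).-1.+1)%N by rewrite prednK// expn_gt0.
  have [b1 b2] := harmonic_bounds (2 ^ k).-1; rewrite -e in b1 b2.
  have lk : ln (2 ^ k)%:R = k%:R * ln 2 :> R by rewrite natrX lnXn// mulr_natl.
  rewrite lk in b1 b2; split=> //; apply: le_trans b2.
  by rewrite big_nat_recr ?expn_gt0//= lerDl invr_ge0.
pose S : R := \sum_(1 <= j < 2 ^ k) (sin (j%:R * h))^-1.
have aE : a = (S + 2^-1) / 2 ^+ k.+1.
  rewrite /a root_energy_sin ?oner_neq0// sin_power_sum_fold powR_inv1//.
  have -> : grid_sum (fun x : R => sin x `^ (-1)) (mesh k.+1) (2 ^ k) = S.
    rewrite /grid_sum /S big_nat_cond [RHS]big_nat_cond; apply: eq_bigr => j.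
    rewrite andbT => /andP[j1 jk]; rewrite powR_inv1//.
    have /andP[b1 b2] := @grid_point_bounds R k j ltac:(lia).
    by apply/ltW/sin_gt0_half; rewrite b2 (lt_le_trans h0).
  by congr (_ / _); field.
have HS : H / h = \sum_(1 <= j < 2 ^ k) (j%:R * h)^-1.
  by rewrite /H mulr_suml; apply: eq_bigr => j _; rewrite [RHS]invfM.
have bnd j : (1 <= j < 2 ^ k)%N ->
    (j%:R * h)^-1 <= (sin (j%:R * h))^-1 <= (j%:R * h)^-1 + 1.
  move=> /andP[j1 jk]; have /andP[b1 b2] := @grid_point_bounds R k j ltac:(lia).
  by apply: inv_sin_bounds; rewrite b2 (lt_le_trans h0).
have S1 : H / h <= S.
  rewrite HS big_nat_cond [X in _ <= X]big_nat_cond ler_sum// => j.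
  by rewrite andbT => /bnd/andP[].
have S2 : S <= H / h + 2 ^+ k.
  apply: (@le_trans _ _ (\sum_(1 <= j < 2 ^ k) ((j%:R * h)^-1 + 1))).
    rewrite /S big_nat_cond [X in _ <= X]big_nat_cond ler_sum// => j.
    by rewrite andbT => /bnd/andP[].
  rewrite big_split /= HS lerD2l sumr_const_nat -natrX ler_nat; lia.
have hE : h * 2 ^+ k.+1 = pi by rewrite /h /mesh divfK// expf_neq0.
have t0 : 0 < 2 ^+ k.+1 :> R by rewrite exprn_gt0.
have tE : 2 ^+ k.+1 = 2 * 2 ^+ k :> R by rewrite exprS.
have HhE : H / h = H / pi * 2 ^+ k.+1 by rewrite -hE; field; rewrite !gt_eqF.
have m1 : k%:R * m <= H / pi by rewrite /m mulrA ler_pM2r ?invr_gt0.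
have m2 : H / pi <= k%:R * m + 1.
  have : H / pi <= (1 + k%:R * ln 2) / pi by rewrite ler_pM2r ?invr_gt0.
  rewrite mulrDl mul1r -mulrA -/m.
  have : pi^-1 <= 1 :> R by rewrite invf_le1// (le_trans _ (pi_ge2 R))// ler1n.
  clear; lra.
rewrite aE; split.
  rewrite ler_pdivlMr//; have := ler_wpM2r (ltW t0) m1; rewrite -HhE.
  by move: S1; clear; lra.
rewrite ler_pdivrMr//; have := ler_wpM2r (ltW t0) m2; rewrite -HhE.
move: S2 k1; rewrite tE; clear; lra.
Qed.

(** The limit exists by [is_cvg_step]; its value is the slope of
    [root_energy 1 k / 2 ^ k], given by the harmonic sums. *)
Lemma cvg_step1 : (fun k => step 1 k / 2 ^+ k.+1) @ \oo --> (ln 2 / pi : R).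
Proof.
have [/= c hc] : exists c : R, (fun k => step 1 k / 2 ^+ k.+1) @ \oo --> c.
  have /cvg_ex[/= c hc] := @is_cvg_step 1 (ltac:(lra)) (oner_neq0 R).
  exists (c / 2); rewrite (_ : (fun k => _) = (fun k => step 1 k * (2 `^ (-1)) ^+ k / 2)).
    by apply: cvgM => //; exact: cvg_cst.
  apply/funext => k; rewrite powR_inv1// exprVn exprS.
  by field; rewrite expf_neq0.
suff <- : c = ln 2 / pi by [].
pose a k : R := root_energy 1 k / 2 ^+ k.
have ha : (fun k => a k / k%:R) @ \oo --> c.
  apply: cvg_slope; rewrite (_ : (fun k => _) = (fun k => step 1 k / 2 ^+ k.+1))//.
  apply/funext => k; rewrite /a /step exprS.
  by field; rewrite expf_neq0.
have hb : (fun k => a k.+1 / k.+1%:R) @ \oo --> c.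
  by move: ha; rewrite -(cvg_shiftS (fun k => a k / k%:R)).
have hm : (fun k => a k.+1 / k.+1%:R) @ \oo --> (ln 2 / pi : R).
  have h0 (b : R) : (fun k : nat => ln 2 / pi + b * k.+1%:R^-1) @ \oo --> (ln 2 / pi : R).
    rewrite -[X in _ --> X]addr0; apply: cvgD; first exact: cvg_cst.
    rewrite -[X in _ --> X](mulr0 b); apply: cvgM; [exact: cvg_cst|exact: cvg_harmonic].
  apply: (squeeze_cvgr _ (h0 (- (ln 2 / pi))) (h0 (2 - ln 2 / pi))).
  apply: nearW => k; have [b1 b2] := root_energy1_bounds k.
  have n0 : 0 < k.+1%:R :> R by rewrite ltr0n.
  have e : k%:R = k.+1%:R - 1 :> R by rewrite -natr1 addrK.
  rewrite /a; apply/andP; split.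
    rewrite ler_pdivlMr// mulrDl divfK ?gt_eqF//; move: b1; rewrite e; clear; lra.
  rewrite ler_pdivrMr// mulrDl divfK ?gt_eqF//; move: b2; rewrite e; clear; lra.
by apply: (cvg_unique _ hb hm).
Qed.

End RootEnergyAsymptotics.

(** * The energy functional along doublings *)

Section DoublingLimit.
Context {R : realType}.
Implicit Types (s : R) (d w : nat -> R) (k N : nat).

Lemma cvg_ln_pinfty : (fun N : nat => ln N%:R : R) @ \oo --> +oo.
Proof.
apply/cvgryPge => A; near=> N.
have h : expR A <= N%:R by near: N; exact: nbhs_infty_ger.
by rewrite -ler_expR lnK// posrE (lt_le_trans (expR_gt0 A)).
Unshelve. all: by end_near. Qed.

(** One more than the number of binary digits of [N], as required by
    [binary_energy_le]. *)
Definition digits N : nat := (trunc_log 2 N).+2.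

Lemma binary_energy_digits s d N :
  `|binary_energy d N| <=
  5 * \sum_(k < digits N) `|d k * (2 `^ (- s)) ^+ k| * (2 `^ (1 + s)) ^+ k.
Proof.
have N2 : (N < 2 ^ (trunc_log 2 N).+1)%N by apply: trunc_log_ltn.
apply: le_trans (binary_energy_le d N2) _; rewrite mulr_sumr ler_sum// => k _.
rewrite normrM (gtr0_norm (x := _ ^+ k)) ?exprn_gt0 ?powR_gt0// -mulrA -exprMn.
rewrite -powRD ?pnatr_eq0 ?implybT// (_ : - s + (1 + s) = 1); last by ring.
rewrite powRr1// mulrCA mulrC ler_wpM2l//.
by rewrite -[X in _ <= X]mulrC; lra.
Qed.

Lemma sum_digits_powR s : -1 < s -> exists2 A : R, 0 < A &
  forall N, (0 < N)%N -> \sum_(k < digits N) (2 `^ (1 + s)) ^+ k <= A * N%:R `^ (1 + s).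
Proof.
move=> s1; set rho := 2 `^ (1 + s).
have r1 : 1 < rho.
  by rewrite /rho /powR pnatr_eq0 /= expR_gt1 mulr_gt0 ?ln_gt0 ?ltr1n//; lra.
have r0 : 0 < rho by lra.
exists (rho ^+ 2 / (rho - 1)); first by rewrite divr_gt0 ?exprn_gt0// subr_gt0.
move=> N N0; have := subrX1 rho (digits N).
set S := \sum_(_ < _) _ => e.
have -> : S = (rho ^+ (digits N) - 1) / (rho - 1).
  by rewrite e mulrC mulKf// gt_eqF// subr_gt0.
rewrite mulrAC ler_pM2r ?invr_gt0 ?subr_gt0//.
apply: (@le_trans _ _ (rho ^+ digits N)); first by rewrite gerBl.
rewrite /digits -addn2 addnC exprD ler_pM2l ?exprn_gt0//.
rewrite /rho -expr_powR// -natrX; apply: powR_le_pos => //; last by lra.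
by rewrite ler_nat; apply: trunc_logP.
Qed.

Lemma sum_digits_ln N : (2 <= N)%N ->
  \sum_(k < digits N) (2 `^ (1 + (-1)) : R) ^+ k <= 3 / ln 2 * ln N%:R.
Proof.
move=> N2; rewrite subrr powRr0; under eq_bigr do rewrite expr1n.
rewrite sumr_const card_ord /digits -addn2 natrD.
have l2 : 0 < ln 2 :> R by rewrite ln_gt0// ltr1n.
have N0 : 0 < N%:R :> R by rewrite ltr0n (leq_trans _ N2).
have h1 : ln 2 <= ln N%:R :> R by rewrite ler_ln ?posrE// ler_nat.
have h2 : (trunc_log 2 N)%:R * ln 2 <= ln N%:R :> R.
  rewrite mulr_natl -lnXn// ler_ln ?posrE ?exprn_gt0// -natrX ler_nat.
  by apply: trunc_logP; rewrite ?(leq_trans _ N2).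
rewrite mulrAC ler_pdivlMr// mulrDl; move: h1 h2; clear; lra.
Qed.

Lemma binary_energy_small s d (phi : nat -> R) (A : R) : 0 < A ->
  (fun k => d k * (2 `^ (- s)) ^+ k) @ \oo --> (0 : R) -> phi @ \oo --> +oo ->
  (\forall N \near \oo, \sum_(k < digits N) (2 `^ (1 + s)) ^+ k <= A * phi N) ->
  (fun N => binary_energy d N / phi N) @ \oo --> (0 : R).
Proof.
move=> A0 hd hphi hA.
have r0 : 0 < 2 `^ (1 + s) :> R by rewrite powR_gt0.
have h := weighted_sum_small r0 A0 hd hphi hA.
have h5 : (fun N => 5 * `|(\sum_(k < digits N) `|d k * (2 `^ (- s)) ^+ k| *
   (2 `^ (1 + s)) ^+ k) / phi N|) @ \oo --> (0 : R).
  rewrite -[X in _ --> X](mulr0 5); apply: cvgM; first exact: cvg_cst.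
  by rewrite -[X in _ --> X](normr0 R); apply: cvg_norm.
apply: cvg_to0_near => eps eps0; have := near_le_of_cvg0 h5 eps0.
apply: filterS => N; apply: le_trans.
rewrite [X in _ <= X]ger0_norm ?mulr_ge0// !normrM mulrA ler_wpM2r//.
apply: le_trans (binary_energy_digits s d N) _.
by rewrite ler_wpM2l// ler_norm.
Qed.

Lemma binary_energy_small_powR s d : -1 < s ->
  (fun k => d k * (2 `^ (- s)) ^+ k) @ \oo --> (0 : R) ->
  (fun N => binary_energy d N / N%:R `^ (1 + s)) @ \oo --> (0 : R).
Proof.
move=> s1 hd; have [A A0 hA] := sum_digits_powR s1.
apply: (binary_energy_small A0 hd).
  by apply: cvg_powR_pinfty; lra.
by exists 1%N => // N /= N1; apply: hA.
Qed.

Lemma binary_energy_small_ln d : (fun k => d k * (2 : R) ^+ k) @ \oo --> (0 : R) ->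
  (fun N => binary_energy d N / ln N%:R) @ \oo --> (0 : R).
Proof.
move=> hd; have l2 : 0 < ln 2 :> R by rewrite ln_gt0// ltr1n.
have A0 : 0 < 3 / ln 2 :> R by rewrite divr_gt0.
apply: (@binary_energy_small (-1) d (fun N => ln N%:R) _ A0).
- by rewrite opprK powRr1.
- exact: cvg_ln_pinfty.
- by exists 2%N => // N /= N2; exact: sum_digits_ln.
Qed.

Lemma binary_energy_bounded_ln d :
  cvg ((fun k => d k * (2 : R) ^+ k) @ \oo) ->
  exists2 C : R, 0 <= C & \forall N \near \oo, `|binary_energy d N| <= C * ln N%:R.
Proof.
move=> hd; have l2 : 0 < ln 2 :> R by rewrite ln_gt0// ltr1n.
have [B hB] : exists B : R, forall k, `|d k * 2 ^+ k| <= B.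
  have [M [_ hM]] := cvg_seq_bounded hd.
  by exists (M + 1) => k; apply: (hM (M + 1)) => //; rewrite ltrDl.
have B0 : 0 <= B by apply: le_trans (hB 0%N).
exists (5 * (B * (3 / ln 2))); first by rewrite !mulr_ge0 ?invr_ge0 ?(ltW l2).
exists 2%N => // N /= N2.
apply: le_trans (binary_energy_digits (-1) d N) _.
rewrite -mulrA ler_pM2l// -mulrA.
apply: (@le_trans _ _ (B * \sum_(k < digits N) (2 `^ (1 + -1)) ^+ k)).
  rewrite mulr_sumr ler_sum// => k _.
  by rewrite ler_wpM2r ?exprn_ge0 ?powR_ge0// opprK powRr1.
by rewrite ler_wpM2l// sum_digits_ln.
Qed.

Lemma binary_energy_doubling (c : R) w N :
  c * binary_energy w (2 * N) - binary_energy w N =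
  binary_energy (fun k => 2 * c * w k.+1 - w k) N.
Proof.
rewrite mul2n binary_energy_double mulrA [c * 2]mulrC.
have := @binary_energy_lin R (2 * c) (-1) (w \o S) w N.
rewrite mulN1r => <-; congr (binary_energy _ _).
by apply/funext => k /=; rewrite mulN1r.
Qed.

Lemma shift_difference_small s w :
  cvg ((fun k => w k * (2 `^ (- s)) ^+ k) @ \oo) ->
  (fun k => (2 `^ (- s) * w k.+1 - w k) * (2 `^ (- s)) ^+ k) @ \oo --> (0 : R).
Proof.
move=> /cvg_ex[/= l hl]; rewrite -(subrr l).
rewrite (_ : (fun k => _) = (fun k => w k.+1 * (2 `^ (- s)) ^+ k.+1 -
   w k * (2 `^ (- s)) ^+ k)).
  apply: cvgB => //; move: hl.
  by rewrite -(cvg_shiftS (fun k => w k * (2 `^ (- s)) ^+ k)).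
by apply/funext => k; rewrite exprS; ring.
Qed.

(** Doubling the number of points shifts the binary
    digits, so the difference is the energy functional of [2^(-s) w (k+1) - w k]. *)
Lemma doubling_limit_powR s w : -1 < s ->
  cvg ((fun k => w k * (2 `^ (- s)) ^+ k) @ \oo) ->
  (fun N => binary_energy w (2 * N) / (2 * N)%:R `^ (1 + s) -
            binary_energy w N / N%:R `^ (1 + s)) @ \oo --> (0 : R).
Proof.
move=> s1 hw; have h := binary_energy_small_powR s1 (shift_difference_small hw).
apply: cvg_trans h; apply: near_eq_cvg; apply: nearW => N.
have -> : (2 * N)%:R `^ (1 + s) = 2 * 2 `^ s * N%:R `^ (1 + s).
  rewrite natrM powRM//; congr (_ * _).
  by rewrite powRD ?powRr1// pnatr_eq0 implybT.
have q0 : 0 < 2 `^ s :> R by rewrite powR_gt0.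
have := binary_energy_doubling ((2 * 2 `^ s)^-1) w N.
rewrite powRN (_ : 2 * (2 * 2 `^ s)^-1 = (2 `^ s)^-1); last by field; rewrite gt_eqF.
move=> <-; set X := N%:R `^ _; set c := (2 * 2 `^ s)^-1.
have -> : (2 * 2 `^ s * X)^-1 = c * X^-1 by rewrite [LHS]invfM.
by ring.
Qed.

(** The logarithm does not scale under doubling; the change of the denominator
    costs [binary_energy w N * ln 2 / (ln N * ln (2 * N))], which is small because
    [binary_energy w N = O (ln N)]. *)
Lemma doubling_limit_ln w :
  cvg ((fun k => w k * (2 : R) ^+ k) @ \oo) ->
  (fun N => binary_energy w (2 * N) / ln (2 * N)%:R -
            binary_energy w N / ln N%:R) @ \oo --> (0 : R).
Proof.
move=> hw; have l2 : 0 < ln 2 :> R by rewrite ln_gt0// ltr1n.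
have hd : (fun k => (2 * w k.+1 - w k) * (2 : R) ^+ k) @ \oo --> (0 : R).
  have := @shift_difference_small (-1) w; rewrite opprK powRr1//; exact.
have h1 := binary_energy_small_ln hd.
have [C C0 h2] := binary_energy_bounded_ln hw.
apply: cvg_to0_near => eps eps0.
have e2 : 0 < eps / 2 by rewrite divr_gt0.
have h3 := near_le_of_cvg0 h1 e2.
have h4 : \forall N \near \oo, C * ln 2 * 2 / eps <= ln N%:R.
  by have /cvgryPge := cvg_ln_pinfty; exact.
near=> N.
have N2 : (2 <= N)%N by near: N; exact: nbhs_infty_ge.
have N0 : 0 < N%:R :> R by rewrite ltr0n (leq_trans _ N2).
have L0 : 0 < ln N%:R :> R by rewrite ln_gt0// ltr1n.
have b2 : `|binary_energy w N| <= C * ln N%:R by near: N.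
have b3 : `|binary_energy (fun k => 2 * w k.+1 - w k) N / ln N%:R| <= eps / 2 by near: N.
have b4 : C * ln 2 * 2 / eps <= ln N%:R by near: N.
have e : ln (2 * N)%:R = ln 2 + ln N%:R :> R by rewrite natrM lnM ?posrE.
have := binary_energy_doubling 1 w N; rewrite mul1r mulr1 => d.
rewrite e; move: d b2 b3 b4 L0 l2.
set E := binary_energy w N; set E2 := binary_energy w _; set D := binary_energy _ N.
set L := ln N%:R; set l := ln 2 => d b2 b3 b4 L0 l0.
have lL : 0 < l + L by rewrite addr_gt0.
have -> : E2 / (l + L) - E / L = D / (l + L) - (E * l) / (L * (l + L)).
  have -> : E2 = D + E by rewrite -d subrK.
  by field; rewrite !gt_eqF.
apply: le_trans (ler_normB _ _) _.
have p1 : `|D / (l + L)| <= eps / 2.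
  apply: le_trans b3; rewrite !normrM ler_wpM2l// !normfV !gtr0_norm//.
  by rewrite lef_pV2 ?posrE// lerDr ltW.
have p2 : `|(E * l) / (L * (l + L))| <= eps / 2.
  rewrite normrM normfV (gtr0_norm (mulr_gt0 L0 lL)) ler_pdivrMr ?mulr_gt0//.
  rewrite normrM (gtr0_norm l0).
  have b5 : C * l * 2 <= eps * L by rewrite -ler_pdivrMl// mulrC.
  have b6 : `|E| * l <= C * L * l by rewrite ler_wpM2r// ltW.
  apply: le_trans b6 _.
  have : C * l * L * 2 <= eps * L * L by have := ler_wpM2r (ltW L0) b5; lra.
  have : 0 <= eps * (L * l) by rewrite !mulr_ge0 ?ltW.
  by clear; lra.
by move: p1 p2; clear; lra.
Unshelve. all: by end_near. Qed.

End DoublingLimit.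

(** * Normalized energies *)

Section NormalizedEnergy.
Context {R : realType}.
Implicit Types (s : R) (a : nat -> R[i]) (k N : nat).

Lemma EFin_div (x y : R) : y != 0 -> (x%:E / y%:E)%E = (x / y)%:E.
Proof. by move=> y0; rewrite inver (negPf y0). Qed.

Lemma cvg_EFin_sub (f : nat -> R) (g : nat -> \bar R) :
  (forall N, (2 <= N)%N -> g N = (f N)%:E) ->
  (fun N => f (2 * N)%N - f N) @ \oo --> (0 : R) ->
  (g (2 * N)%N - g N)%E @[N --> \oo] --> 0%E.
Proof.
move=> gf hf.
have E : \forall N \near \oo, (g (2 * N)%N - g N)%E = (f (2 * N)%N - f N)%:E.
  by exists 2%N => // N /= N2; rewrite !gf//; lia.
apply: cvg_EFin; first by move: E; apply: filterS => N ->.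
apply: cvg_trans hf; apply: near_eq_cvg; move: E; apply: filterS => N /= ->.
by [].
Qed.

(** The term [N ^ 2] is the value of the functional on [2 ^ k]. *)
Lemma binary_energy_sub_expn (I : R) (P : nat -> R) N :
  binary_energy P N - N%:R ^+ 2 * I = binary_energy (fun k => P k - I * 2 ^+ k) N.
Proof.
have := @binary_energy_lin R 1 (- I) P (fun k => 2 ^+ k) N.
rewrite binary_energy_expn mul1r mulNr [N%:R ^+ 2 * I]mulrC => <-.
by congr (binary_energy _ _); apply/funext => k; rewrite mul1r mulNr.
Qed.

Section Cases.
Variables (s : R) (a : nat -> R[i]).
Hypotheses (hs : -1 <= s) (ha : greedy_energy_sequence s a).

Let E N := binary_energy (root_energy s) N.

Let energyE N : riesz_energy s (greedy_section a N) = (E N)%:E.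
Proof. exact: greedy_energyE. Qed.

Lemma normalized_energy_doubling_N1 : s = -1 ->
  (normalized_energy s a (2 * N)%N - normalized_energy s a N)%E @[N --> \oo] --> 0%E.
Proof.
move=> s1; pose w k : R := root_energy s k - circle_energy s * 2 ^+ k.
apply: (@cvg_EFin_sub (fun N => binary_energy w N / ln N%:R)).
  move=> N N2; rewrite /normalized_energy s1 eqxx -s1 energyE -EFinB.
  rewrite EFin_div ?binary_energy_sub_expn//.
  by rewrite gt_eqF// ln_gt0// ltr1n.
apply: doubling_limit_ln.
have l1 : s < 1 by rewrite s1 gtrN.
have l0 : s != 0 by rewrite s1 oppr_eq0 oner_neq0.
have e : 2 `^ (- s) = 2 :> R by rewrite s1 opprK powRr1.
by have := is_cvg_root_energy_sub hs l1 l0; rewrite e.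
Qed.

(** Here the increments of [root_energy] are exactly [- ln 2], and the difference
    is zero. *)
Lemma normalized_energy_doubling_0 : s = 0 ->
  (normalized_energy s a (2 * N)%N - normalized_energy s a N)%E @[N --> \oo] --> 0%E.
Proof.
move=> s0.
apply: (@cvg_EFin_sub (fun N => (E N + N%:R * ln N%:R) / N%:R)).
  move=> N N2; rewrite /normalized_energy energyE s0 eqxx.
  have -> : ((0 : R) == -1) = false by rewrite eq_sym oppr_eq0 oner_eq0.
  by rewrite -EFinD EFin_div// pnatr_eq0 -lt0n (leq_trans _ N2).
apply: cvg_to0_near => eps eps0; exists 1%N => // N /= N1.
suff -> : (E (2 * N) + (2 * N)%:R * ln (2 * N)%:R) / (2 * N)%:R -
  (E N + N%:R * ln N%:R) / N%:R = 0 by rewrite normr0 ltW.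
have N0 : 0 < N%:R :> R by rewrite ltr0n.
have := binary_energy_doubling (2^-1) (root_energy s) N; rewrite -/(E _) -/(E N).
have -> : (fun k => 2 * 2^-1 * root_energy s k.+1 - root_energy s k) = fun=> - ln 2.
  by apply/funext => k; rewrite mulfV// mul1r s0 root_energy0.
rewrite binary_energy_cst natrM lnM ?posrE// => e.
have -> : E (2 * N) = 2 * (E N - N%:R * ln 2) by lra.
by field; rewrite gt_eqF.
Qed.

Lemma normalized_energy_doubling_lt1 : -1 < s -> s < 1 -> s != 0 ->
  (normalized_energy s a (2 * N)%N - normalized_energy s a N)%E @[N --> \oo] --> 0%E.
Proof.
move=> s1 s2 s0; pose w k : R := root_energy s k - circle_energy s * 2 ^+ k.
apply: (@cvg_EFin_sub (fun N => binary_energy w N / N%:R `^ (1 + s))).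
  move=> N N2; rewrite /normalized_energy (gt_eqF s1) (negPf s0) s2 energyE -EFinB.
  rewrite EFin_div ?binary_energy_sub_expn//.
  by rewrite gt_eqF// powR_gt0// ltr0n (leq_trans _ N2).
by apply: doubling_limit_powR => //; exact: is_cvg_root_energy_sub.
Qed.

Lemma normalized_energy_doubling_1 : s = 1 ->
  (normalized_energy s a (2 * N)%N - normalized_energy s a N)%E @[N --> \oo] --> 0%E.
Proof.
move=> s1; have pi0 := pi_gt0 R.
apply: (@cvg_EFin_sub (fun N => (E N - pi^-1 * N%:R ^+ 2 * ln N%:R) / N%:R ^+ 2)).
  move=> N N2; rewrite /normalized_energy energyE s1 eqxx ltxx oner_eq0.
  have -> : ((1 : R) == -1) = false by rewrite gt_eqF// gtrN.
  by rewrite -EFinB EFin_div// expf_neq0// pnatr_eq0 -lt0n (leq_trans _ N2).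
pose m : R := ln 2 / pi.
pose d k : R := (2^-1 * root_energy s k.+1 - root_energy s k) - m * 2 ^+ k.
have hd : (fun k => d k * (2 `^ (- s)) ^+ k) @ \oo --> (0 : R).
  have h : (fun k => (root_energy 1 k.+1 - 2 * root_energy 1 k) / 2 ^+ k.+1 - m)
      @ \oo --> (0 : R).
    by rewrite -(subrr m); apply: cvgB; [exact: cvg_step1|exact: cvg_cst].
  apply: cvg_trans h; apply: near_eq_cvg; apply: nearW => k.
  rewrite /d s1 powR_inv1// exprVn exprS /=.
  by field; rewrite expf_neq0.
have h1 : -1 < s by rewrite s1; lra.
have := binary_energy_small_powR h1 hd; apply: cvg_trans; apply: near_eq_cvg.
exists 1%N => // N /= N1; have N0 : 0 < N%:R :> R by rewrite ltr0n.
have -> : N%:R `^ (1 + s) = N%:R ^+ 2.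
  by rewrite s1 -powR_mulrn// (_ : 1 + 1 = 2%:R).
have := binary_energy_doubling (4^-1) (root_energy s) N; rewrite -/(E _) -/(E N) => e.
have -> : binary_energy d N = 4^-1 * E (2 * N) - E N - N%:R ^+ 2 * m.
  rewrite e binary_energy_sub_expn; congr (binary_energy _ _).
  apply/funext => k; rewrite /d (_ : 2 * 4^-1 = 2^-1 :> R)//; by field.
rewrite natrM lnM ?posrE// /m.
move: (pi : R) pi0 => p p0.
by field; rewrite !gt_eqF.
Qed.

Lemma normalized_energy_doubling_gt1 : 1 < s ->
  (normalized_energy s a (2 * N)%N - normalized_energy s a N)%E @[N --> \oo] --> 0%E.
Proof.
move=> s1; have s2 : -1 < s by lra.
apply: (@cvg_EFin_sub (fun N => E N / N%:R `^ (1 + s))).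
  move=> N N2; rewrite /normalized_energy (gt_eqF s2) (gt_eqF s1).
  rewrite (gt_eqF (lt_trans ltr01 s1)) ltNge (ltW s1) /= energyE.
  by rewrite EFin_div// gt_eqF// powR_gt0// ltr0n (leq_trans _ N2).
by apply: doubling_limit_powR => //; exact: is_cvg_root_energy.
Qed.

End Cases.

End NormalizedEnergy.

Unset Implicit Arguments.

Theorem corollary1p2 (R : realType) (s : R) (a : nat -> R[i])
  (hs : -1 <= s) (ha : greedy_energy_sequence s a) :
  (normalized_energy s a (2 * N)%N - normalized_energy s a N)%E
    @[N --> \oo] --> 0%E.
Proof.
have [s1|s1] := eqVneq s (-1); first exact: normalized_energy_doubling_N1.
have s1' : -1 < s by rewrite lt_neqAle eq_sym s1.
have [s0|s0] := eqVneq s 0; first exact: normalized_energy_doubling_0.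
case: (ltgtP s 1) => s2.
- exact: normalized_energy_doubling_lt1.
- exact: normalized_energy_doubling_gt1.
- exact: normalized_energy_doubling_1.
Qed.
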